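(* The sets $\mathbb{D}$ and $\mathbb{D}_L$ are closed under locally uniform convergence: if $(\mathcal{F}_n)_{n\ge0}$ is a sequence in $\mathbb{D}$ (respectively in $\mathbb{D}_L$) which converges uniformly on every bounded interval of $\mathbb{R}$ to a function $\mathcal{F}$, then $\mathcal{F}\in\mathbb{D}$ (respectively $\mathcal{F}\in\mathbb{D}_L$).
   Context: $\mathbb{P}_+$ is the set of continuous positive-definite functions $f:\mathbb{R}\to\mathbb{C}$ with $f(0)=1$, i.e. the characteristic functions of real random variables. $\mathbb{D}$ is the set of analytic characteristic functions $\mathcal{F}\in\mathbb{P}_+$ such that $V\mathcal{F}\in\mathbb{P}_+$, where $V\mathcal{F}(t)=1/\mathcal{F}(it)$, $t\in\mathbb{R}$. Here $\mathcal{F}(it)$ is understood through analytic (meromorphic) continuation; precisely, $\mathcal{F}\in\mathbb{D}$ if and only if $\mathcal{F}\in\mathbb{P}_+$ extends analytically to a strip $\{|\Im z|<a\}$, $a>0$, and there is $\mathcal{G}\in\mathbb{P}_+$ with $\mathcal{F}(it)\mathcal{G}(t)=1$ for all real $t$ in a neighbourhood of $0$ (the identity then persists by continuation); such $\mathcal{G}$ is unique and $V\mathcal{F}:=\mathcal{G}$. $\mathbb{LP}$ (the Laguerre–Pólya class) is the set of entire functions, not identically zero, which are locally uniform limits on $\mathbb{C}$ of polynomials with real coefficients and only real zeros. $\mathbb{LP}_e=\{\varphi\in\mathbb{LP}:\varphi\text{ even},\ \varphi(0)=1\}$; equivalently $\varphi(z)=e^{-c^2z^2}\prod_k(1-z^2/z_k^2)$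 with $c\in\mathbb{R}$, $z_k>0$ (finite, possibly empty, or infinite family), $\sum_kz_k^{-2}<\infty$. $\mathbb{D}_L=\mathbb{LP}_e\cap\mathbb{P}_+$, where an entire function is identified with its restriction to $\mathbb{R}$. *)

(* Defs.v *)
From HB Require Import structures.
From mathcomp Require Import all_boot all_order all_algebra.
From mathcomp Require Import complex.
From mathcomp Require Import all_classical all_reals all_analysis.

Set Implicit Arguments.
Unset Strict Implicit.
Unset Printing Implicit Defensive.

Import Order.TTheory GRing.Theory Num.Theory.
Import numFieldNormedType.Exports.

Local Open Scope classical_set_scope.
Local Open Scope ring_scope.
Local Open Scope complex_scope.

(* The usual topology of the complex plane: R[i] is a normed module over itself.
   In particular [derivable f z 1], for f : R[i] -> R[i], is complex
   differentiability at z. *)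
HB.instance Definition _ (R : realType) := NormedModule.copy R[i] (R[i])^o.

Section Definitions.
Context {R : realType}.

(* [0 <= w] in R[i] means that w is a nonnegative real number. *)
Definition positive_definite (f : R -> R[i]) : Prop :=
  forall (n : nat) (t : 'I_n -> R) (c : 'I_n -> R[i]),
    0 <= \sum_(j < n) \sum_(k < n) c j * (c k)^* * f (t j - t k).

Definition Pplus : set (R -> R[i]) :=
  [set f | [/\ continuous f, positive_definite f & f 0 = 1]].

(* Used for open sets U only, where it is holomorphy. *)
Definition holomorphic_on (U : set R[i]) (f : R[i] -> R[i]) : Prop :=
  forall z, U z -> derivable f z 1.

Definition strip (a : R) : set R[i] := [set z | `|complex.Im z| < a].

(* The values of Fext outside the strip are irrelevant. *)
Definition extends_to_strip (F : R -> R[i]) (a : R) (Fext : R[i] -> R[i]) :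
    Prop :=
  holomorphic_on (strip a) Fext /\ forall t : R, Fext t%:C = F t.

(* G = V F, where V F (t) = 1 / F (i t); the notation [t *i] is the product of
   t and the imaginary unit. *)
Definition is_V (F G : R -> R[i]) : Prop :=
  exists (a : R) (Fext : R[i] -> R[i]),
    [/\ 0 < a, extends_to_strip F a Fext &
        \forall t \near (0 : R), Fext (t *i) * G t = 1].

Definition classD : set (R -> R[i]) :=
  [set F | Pplus F /\ exists2 G, Pplus G & is_V F G].

Definition complex_horner (p : {poly R}) (z : R[i]) : R[i] :=
  (map_poly (real_complex R) p).[z].

(* The zero polynomial is excluded: every complex number is a root of it. *)
Definition only_real_zeros (p : {poly R}) : Prop :=
  forall z : R[i], complex_horner p z = 0 -> complex.Im z = 0.

(* Locally uniform convergence on the (locally compact) complex plane is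
   uniform convergence on every compact subset. *)
Definition LP : set (R[i] -> R[i]) :=
  [set phi | [/\ holomorphic_on setT phi,
                 exists z, phi z != 0 &
                 exists p : nat -> {poly R},
                   (forall n, only_real_zeros (p n)) /\
                   {family compact, complex_horner (p n) @[n --> \oo] --> phi}]].

Definition LPe : set (R[i] -> R[i]) :=
  [set phi | [/\ LP phi, forall z, phi (- z) = phi z & phi 0 = 1]].

(* Entire functions are identified with their restrictions to the real line. *)
Definition classDL : set (R -> R[i]) :=
  [set F | Pplus F /\ exists2 phi, LPe phi & forall t : R, phi t%:C = F t].

Definition locally_uniform_cvg (F_ : nat -> R -> R[i]) (F : R -> R[i]) : Prop :=
  forall a b : R, {uniform `[a, b], F_ n @[n --> \oo] --> F}.

End Definitions.

Arguments Pplus R : clear implicits.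
Arguments LP R : clear implicits.
Arguments LPe R : clear implicits.
Arguments classD R : clear implicits.
Arguments classDL R : clear implicits.

(* Main.v *)
Require Import Defs.
From mathcomp Require Import all_boot all_order all_algebra.
From mathcomp Require Import complex.
From mathcomp Require Import all_classical all_reals all_analysis.
From mathcomp Require Import ring lra zify.
Set Implicit Arguments.
Unset Strict Implicit.
Unset Printing Implicit Defensive.
Import Order.TTheory GRing.Theory Num.Theory.
Import numFieldNormedType.Exports.
Local Open Scope classical_set_scope.
Local Open Scope ring_scope.
Local Open Scope complex_scope.

(* Stability of D.  Let G_n = V(F_n).  On some [0, d] the F_n eventually satisfy
   |F_n| >= 1/2.  Positive-definiteness of G_n makes the Taylor coefficients of
   G_n(i t) = 1 / F_n(t) (up to the sign of t) nonnegative, so by Pringsheim's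
   theorem this series converges on [0, d], with sum at most 2.  Inverting it
   bounds the coefficients of F_n as well, uniformly in n.  If f is
   positive-definite with a Taylor expansion at 0, so is the limit -f'' of its
   second difference quotients along an ultrafilter, which is therefore bounded by
   its value at 0; iterating, and recovering f from f'' by a maximum principle,
   one obtains Taylor expansions of the same radius at every real point.
   Limits of the Taylor coefficients and of the G_n(t) along a free ultrafilter of
   indices then produce the limits of F_n and G_n, and the local expansions of the
   limit glue to a function on a strip.  Holomorphic functions are expanded in power series by Goursat's argument.

   Stability of D_L.  For a polynomial p with real zeros x_j,
   p(z) p(-z) / p(0)^2 = prod_j (1 - z^2 / x_j^2), and
   1 + N d^2 / x^2 <= (1 - d^2 / x^2)^(- N).  Hence real-rooted polynomials close
   to 1 near 0 on the real line are bounded on each disc, uniformly; their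
   coefficients converge along an ultrafilter, and a diagonal sequence of them
   converges locally uniformly to an entire function. *)

(** * Convergent power series *)

(** The obstacle is that nothing provides a common strip of analyticity for the [F_n]: only their
    values on the real line are under control. Every radius must come out of a quantitative
    estimate, hence the predicate [abs_le c rho M]. It concerns finite sums of absolute values, so
    it survives coefficientwise limits, products, inversion and recentering, with explicit
    constants; the bound 2 on radius [d] for 1 / F_n becomes the bound 2 on radius [d / 4] for F_n.
    An ultrafilter gives every bounded sequence a limit, at all points at once and compatibly with
    sums and products. Derivatives therefore need not be shown to exist: it is enough to bound
    difference quotients. The contour integral of 1 / z is never computed. Cauchy's formula appears
    as a quotient of two power series, for which it suffices that this integral is nonzero. In D_L
    it is evenness that turns a bound on p(z) p(-z) into one on the limit itself, as phi(z) phi(-z)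
    = phi(z)^2. *)

Notation nrm := ComplexField.Normc.normc.

Section ComplexNorm.
Context {R : realType}.
Local Notation C := R[i].
Implicit Types (z w : C).

(** The norm of [R[i]] takes its values in [R[i]]; all estimates are made with the real number
    [nrm z] instead. *)
Lemma normr_nrm z : `|z| = (nrm z)%:C.
Proof. by rewrite normc_def; case: z. Qed.

Lemma nrm_ge0 z : 0 <= nrm z.
Proof. by rewrite -lecR -normr_nrm normr_ge0. Qed.

Lemma nrmM z w : nrm (z * w) = nrm z * nrm w.
Proof. exact: Normc.normcM. Qed.

Lemma nrmD z w : nrm (z + w) <= nrm z + nrm w.
Proof. exact: le_normcD. Qed.

Lemma nrmN z : nrm (- z) = nrm z.
Proof. exact: normcN. Qed.

Lemma nrmBC z w : nrm (z - w) = nrm (w - z).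
Proof. by rewrite -nrmN opprB. Qed.

Lemma nrm0 : nrm (0 : C) = 0.
Proof. exact: Normc.normc0. Qed.

Lemma nrm1 : nrm (1 : C) = 1.
Proof. exact: Normc.normc1. Qed.

Lemma nrm_eq0 z : (nrm z == 0) = (z == 0).
Proof.
by apply/eqP/eqP => [/Normc.eq0_normc//|->]; rewrite nrm0.
Qed.

Lemma nrm_gt0 z : (0 < nrm z) = (z != 0).
Proof. by rewrite lt_neqAle nrm_ge0 andbT eq_sym nrm_eq0. Qed.

Lemma nrmX z n : nrm (z ^+ n) = nrm z ^+ n.
Proof. by elim: n => [|n IH]; rewrite ?expr0 ?nrm1// !exprS nrmM IH. Qed.

Lemma nrmV z : nrm z^-1 = (nrm z)^-1.
Proof. exact: Normc.normcV. Qed.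

Lemma nrm_sum (I : Type) (r : seq I) (P : pred I) (f : I -> C) :
  nrm (\sum_(i <- r | P i) f i) <= \sum_(i <- r | P i) nrm (f i).
Proof.
elim/big_rec2 : _ => [|i a b _ ab]; first by rewrite nrm0.
by rewrite (le_trans (nrmD _ _))// lerD2l.
Qed.

Lemma nrm_real (x : R) : nrm (x%:C) = `|x|.
Proof. by rewrite /= expr0n addr0 sqrtr_sqr. Qed.

Lemma nrm_nat n : nrm (n%:R : C) = n%:R.
Proof. by rewrite -(rmorph_nat (real_complex R)) nrm_real ger0_norm. Qed.

Lemma nrm_iX k : nrm (('i%C : C) ^+ k) = 1.
Proof. by rewrite nrmX /= expr0n /= add0r expr1n sqrtr1 expr1n. Qed.

Lemma nrm_conj z : nrm (z^*) = nrm z.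
Proof. by case: z => a b /=; rewrite sqrrN. Qed.

Lemma Re_le_nrm z : `|complex.Re z| <= nrm z.
Proof. by rewrite -lecR -normr_nrm normc_ge_Re. Qed.

Lemma Im_le_nrm z : `|complex.Im z| <= nrm z.
Proof.
rewrite -(normrN (complex.Im z)) -ReiNIm (le_trans (Re_le_nrm _))//.
by rewrite nrmM -(expr1 'i%C) nrm_iX mulr1.
Qed.

Lemma nrm_le_ReIm z : nrm z <= `|complex.Re z| + `|complex.Im z|.
Proof.
rewrite [z in nrm z]complexE (le_trans (nrmD _ _))// nrmM !nrm_real.
by rewrite -(expr1 'i%C) nrm_iX mul1r.
Qed.

(** A positive element of [R[i]] has zero imaginary part, so real tolerances suffice. *)
Lemma cvgcP (T : Type) (F : set_system T) {FF : Filter F} (x : T -> C) (l : C) :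
  x @ F --> l <->
  (forall e : R, 0 < e -> \forall n \near F, nrm (x n - l) <= e).
Proof.
split=> [/cvgrPdist_le H e e0|H].
  have /H : 0 < e%:C by rewrite ltcR.
  by apply: filterS => n; rewrite normr_nrm lecR nrmBC.
apply/cvgrPdist_le => e; rewrite ltcE /= => /andP[/eqP Ime e0].
apply: filterS (H _ e0) => n; rewrite nrmBC normr_nrm.
by case: e Ime e0 => a b /= -> _; rewrite -[a +i* 0]/(a%:C) lecR.
Qed.

Lemma cvgc_Re (T : Type) (F : set_system T) {FF : Filter F} (x : T -> C) (l : C) :
  x @ F --> l -> (complex.Re (x n)) @[n --> F] --> complex.Re l.
Proof.
move=> /cvgcP H; apply/cvgrPdist_le => e e0.
apply: filterS (H _ e0) => n; apply: le_trans; rewrite nrmBC.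
by apply: le_trans (Re_le_nrm _); case: l {H} => a b; case: (x n) => c d.
Qed.

Lemma cvgc_Im (T : Type) (F : set_system T) {FF : Filter F} (x : T -> C) (l : C) :
  x @ F --> l -> (complex.Im (x n)) @[n --> F] --> complex.Im l.
Proof.
move=> /cvgcP H; apply/cvgrPdist_le => e e0.
apply: filterS (H _ e0) => n; apply: le_trans; rewrite nrmBC.
by apply: le_trans (Im_le_nrm _); case: l {H} => a b; case: (x n) => c d.
Qed.

Lemma cvgc_ReIm (T : Type) (F : set_system T) {FF : Filter F} (x : T -> C)
    (a b : R) :
  (complex.Re (x n)) @[n --> F] --> a -> (complex.Im (x n)) @[n --> F] --> b ->
  x @ F --> (a +i* b).
Proof.
move=> /cvgrPdist_le Ha /cvgrPdist_le Hb; apply/cvgcP => e e0.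
have e20 : 0 < e / 2 by rewrite divr_gt0.
apply: filterS2 (Ha _ e20) (Hb _ e20) => n; rewrite distrC => H1; rewrite distrC.
move=> H2; rewrite (le_trans (nrm_le_ReIm _))// (splitr e).
by move: H1 H2; case: (x n) => c d /= H1 H2; apply: lerD.
Qed.

Lemma nrm_cvg (T : Type) (F : set_system T) {FF : Filter F} (x : T -> C) (l : C) :
  x @ F --> l -> (nrm (x n)) @[n --> F] --> nrm l.
Proof.
move=> /cvgcP H; apply/cvgrPdist_le => e e0.
apply: filterS (H _ e0) => n; apply: le_trans.
have := nrmD (x n - l) l; have := nrmD (l - x n) (x n).
rewrite !subrK (nrmBC l) => H1 H2.
by rewrite ler_norml; apply/andP; split; lra.
Qed.

Lemma cvgc_cst (T : Type) (F : set_system T) {FF : Filter F} (a : C) :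
  (fun _ : T => a) @ F --> a.
Proof. exact: cvg_cst. Qed.

Lemma cvgcD (T : Type) (F : set_system T) {FF : Filter F} (x y : T -> C)
    (a b : C) : x @ F --> a -> y @ F --> b -> (fun n => x n + y n) @ F --> a + b.
Proof.
move=> xa yb.
exact: (@cvgD (C : numFieldType) (C : normedModType C) T F FF x y a b xa yb).
Qed.

Lemma cvgcN (T : Type) (F : set_system T) {FF : Filter F} (x : T -> C)
    (a : C) : x @ F --> a -> (fun n => - x n) @ F --> - a.
Proof.
move=> xa.
exact: (@cvgN (C : numFieldType) (C : normedModType C) T F FF x a xa).
Qed.

Lemma cvgcB (T : Type) (F : set_system T) {FF : Filter F} (x y : T -> C)
    (a b : C) : x @ F --> a -> y @ F --> b -> (fun n => x n - y n) @ F --> a - b.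
Proof. by move=> xa yb; exact: cvgcD xa (cvgcN yb). Qed.

Lemma cvgcM (T : Type) (F : set_system T) {FF : Filter F} (x y : T -> C)
    (a b : C) : x @ F --> a -> y @ F --> b -> (fun n => x n * y n) @ F --> a * b.
Proof.
move=> xa yb.
exact: (@cvgM (C : numFieldType) T F FF x y a b xa yb).
Qed.

Lemma nrm_cvg0 (T : Type) (F : set_system T) {FF : Filter F} (x : T -> C)
    (l : C) : x @ F --> l -> (fun n => nrm (x n - l)) @ F --> (0 : R).
Proof.
move=> /cvgcP H; apply/cvgrPdist_le => e e0; apply: filterS (H _ e0) => n.
by rewrite sub0r normrN ger0_norm// nrm_ge0.
Qed.

Lemma cvgc_sum (T I : Type) (r : seq I) (P : pred I) (F : set_system T)
    {FF : Filter F} (x : I -> T -> C) (a : I -> C) :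
  (forall i, x i @ F --> a i) ->
  (fun n => \sum_(i <- r | P i) x i n) @ F --> \sum_(i <- r | P i) a i.
Proof.
move=> xa; elim: r => [|i r IH].
  rewrite big_nil [X in X @ _](_ : _ = fun=> 0); first exact: cvgc_cst.
  by apply/funext => n; rewrite big_nil.
rewrite big_cons [X in X @ _](_ : _ = fun n => if P i then
    x i n + \sum_(j <- r | P j) x j n else \sum_(j <- r | P j) x j n); last first.
  by apply/funext => n; rewrite big_cons.
by case: (P i); [exact: cvgcD (xa i) IH|exact: IH].
Qed.

Lemma cvgc_unique (T : Type) (F : set_system T) {FF : ProperFilter F}
    (x : T -> C) (a b : C) : x @ F --> a -> x @ F --> b -> a = b.
Proof. by move=> xa xb; exact: cvg_unique xa xb. Qed.

End ComplexNorm.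

Arguments cvgc_cst {R T F FF} a.
Arguments ComplexField.Normc.normc : simpl never.

Lemma nbhs_nrmP (R : realType) (z : R[i]) (P : set R[i]) :
  nbhs z P <-> exists2 e : R, 0 < e & forall w, nrm (w - z) < e -> P w.
Proof.
split=> [/(@nbhs_ballP R[i] R[i])[e /= e0 H]|[e e0 H]].
  move: e0; rewrite ltcE /= => /andP[/eqP Ime e0].
  exists (complex.Re e) => // w wz; apply: H; rewrite /ball/= distrC normr_nrm.
  by case: e Ime e0 wz => a b /= -> _; rewrite -[a +i* 0]/(a%:C) ltcR.
apply/(@nbhs_ballP R[i] R[i]); exists e%:C; first by rewrite /= ltcR.
by move=> w; rewrite /ball/= distrC normr_nrm ltcR; exact: H.
Qed.

Lemma continuous_nrmP (R : realType) (f : R[i] -> R[i]) (z : R[i]) :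
  {for z, continuous f} <-> (forall e : R, 0 < e ->
    exists2 del : R, 0 < del & forall w, nrm (w - z) < del ->
      nrm (f w - f z) <= e).
Proof.
split=> [/(@cvgcP R R[i] (nbhs z) (nbhs_filter z)) H e /H/nbhs_nrmP//|H].
apply/(@cvgcP R R[i] (nbhs z) (nbhs_filter z)) => e /H Q.
exact/nbhs_nrmP.
Qed.

(** A first-order expansion without division: [h = 0] is no exception, and [l] is available for
    subtracting the affine part. *)
Lemma derivable_nrmP (R : realType) (f : R[i] -> R[i]) (z : R[i]) :
  derivable f z 1 <-> exists l : R[i], forall e : R, 0 < e ->
    exists2 del : R, 0 < del & forall h, nrm h < del ->
      nrm (f (z + h) - f z - l * h) <= e * nrm h.
Proof.
have key l h : h != 0 -> h^-1 *: (f (h *: 1 + z) - f z) - l =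
    h^-1 * (f (z + h) - f z - l * h).
  by move=> h0; rewrite /GRing.scale/= mulr1 addrC [h + z]addrC; field.
split=> [/cvg_ex[l /cvgcP H]|[l H]].
  exists l => e e0; have := H _ e0; rewrite near_withinE => /nbhs_nrmP[del d0 K].
  exists del => // h hd; have [->|h0] := eqVneq h 0.
    by rewrite addr0 mulr0 subr0 subrr nrm0 mulr0.
  have := K h; rewrite subr0 => /(_ hd h0); rewrite /= key//.
  by rewrite nrmM nrmV mulrC ler_pdivrMr// nrm_gt0.
apply/cvg_ex; exists l; apply/cvgcP => e e0; rewrite near_withinE.
have [del d0 K] := H _ e0; apply/nbhs_nrmP; exists del => // h.
rewrite subr0 => hd h0; rewrite /= key// nrmM nrmV mulrC.
by rewrite ler_pdivrMr ?nrm_gt0// K.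
Qed.

Lemma cvg_le_ub (R : realType) (T : Type) (F : set_system T)
    {FF : ProperFilter F} (x : T -> R) (l b : R) :
  x @ F --> l -> (\forall n \near F, x n <= b) -> l <= b.
Proof.
move=> xl xb; apply/ler_addgt0Pr => e e0.
move/cvgrPdist_le : xl => /(_ _ e0) xl.
have /filter_ex[n [xn]] : F [set n | x n <= b /\ `|l - x n| <= e].
  exact: filterI.
by rewrite ler_norml => /andP[]; lra.
Qed.

Lemma cvg_ge_lb (R : realType) (T : Type) (F : set_system T)
    {FF : ProperFilter F} (x : T -> R) (l b : R) :
  x @ F --> l -> (\forall n \near F, b <= x n) -> b <= l.
Proof.
move=> xl xb; apply/ler_addgt0Pr => e e0.
move/cvgrPdist_le : xl => /(_ _ e0) xl.
have /filter_ex[n [xn]] : F [set n | b <= x n /\ `|l - x n| <= e].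
  exact: filterI.
by rewrite ler_norml => /andP[]; lra.
Qed.

Lemma expr_small (R : realType) (x K e : R) :
  0 <= x -> x < 1 -> 0 < e -> \forall n \near \oo, K * x ^+ n <= e.
Proof.
move=> x0 x1 e0.
have : (fun n => K * x ^+ n) @ \oo --> K * 0.
  by apply: cvgMr; apply: cvg_expr; rewrite ger0_norm.
rewrite mulr0 => /cvgrPdist_le/(_ _ e0); apply: filterS => n.
by rewrite sub0r normrN ler_norml => /andP[].
Qed.

Section PowerSeries.
Context {R : realType}.
Local Notation C := R[i].
Implicit Types (c d e : nat -> C) (w z : C) (rho sigma M : R).

Definition ps c w (n : nat) : C := \sum_(0 <= k < n) c k * w ^+ k.

(** Defined for all [c] and [w]; it is the sum of the series once [abs_le] holds on a disc
    containing [w], by [psum_cvg]. *)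
Definition psum c w : C :=
  limn (fun n => complex.Re (ps c w n)) +i* limn (fun n => complex.Im (ps c w n)).

(** Absolute convergence on the closed disc of radius [rho], with sum at most [M], stated through
    finite sums so that it passes to coefficientwise limits. *)
Definition abs_le c rho M :=
  forall n, \sum_(0 <= k < n) nrm (c k) * rho ^+ k <= M.

Lemma abs_le_ge0 c rho M : abs_le c rho M -> 0 <= M.
Proof. by move=> /(_ 0); rewrite big_nil. Qed.

Lemma abs_le_term c rho M k : 0 <= rho -> abs_le c rho M ->
  nrm (c k) * rho ^+ k <= M.
Proof.
move=> r0 /(_ k.+1); rewrite big_nat_recr//=; apply: le_trans.
rewrite lerDr sumr_ge0// => i _.
by rewrite mulr_ge0 ?nrm_ge0 ?exprn_ge0.
Qed.

Lemma abs_le_coef c rho M k : 0 < rho -> abs_le c rho M ->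
  nrm (c k) <= M / rho ^+ k.
Proof.
by move=> r0 cM; rewrite ler_pdivlMr ?exprn_gt0// abs_le_term// ltW.
Qed.

Lemma abs_leW c rho sigma M : 0 <= sigma -> sigma <= rho -> abs_le c rho M ->
  abs_le c sigma M.
Proof.
move=> s0 sr cM n; apply: le_trans (cM n); apply: ler_sum => i _.
by rewrite ler_wpM2l ?nrm_ge0// lerXn2r// ?nnegrE// (le_trans s0).
Qed.

(** Cauchy-type bounds on single coefficients become summable at half the radius; 2 is the sum of
    the geometric series of ratio 1/2. *)
Lemma geo_abs_le c rho M : 0 < rho -> (forall k, nrm (c k) * rho ^+ k <= M) ->
  abs_le c (rho / 2) (2 * M).
Proof.
move=> r0 cM n.
have M0 : 0 <= M by apply: le_trans (cM 0); rewrite mulr_ge0 ?nrm_ge0.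
have -> : 2 * M = 2 * M * (2^-1 ^+ n) + \sum_(0 <= k < n) M * 2^-1 ^+ k.
  elim: n => [|n IH]; first by rewrite big_nil expr0 addr0 mulr1.
  by rewrite big_nat_recr//= {1}IH exprS; field.
rewrite -[leLHS]add0r lerD//.
  by rewrite mulr_ge0 ?exprn_ge0// ?mulr_ge0.
apply: ler_sum => k _; rewrite exprMn mulrA.
by rewrite ler_wpM2r// exprn_ge0.
Qed.

(** Every term of degree at least [m] gains a factor (|w| / rho)^m over its value at radius
    [rho]. *)
Lemma ps_dist c w rho M m n : 0 < rho -> abs_le c rho M -> nrm w <= rho ->
  (m <= n)%N -> nrm (ps c w n - ps c w m) <= M * (nrm w / rho) ^+ m.
Proof.
move=> r0 cM wr mn; rewrite /ps (@big_cat_nat _ _ _ m 0 n)//= addrAC subrr add0r.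
rewrite (le_trans (nrm_sum _ _ _))//.
have x0 : 0 <= nrm w / rho by rewrite divr_ge0 ?nrm_ge0// ltW.
have x1 : nrm w / rho <= 1 by rewrite ler_pdivrMr// mul1r.
apply: (@le_trans _ _ (\sum_(m <= k < n)
    (nrm w / rho) ^+ m * (nrm (c k) * rho ^+ k))).
  rewrite big_nat [leRHS]big_nat; apply: ler_sum => k /andP[mk kn].
  rewrite nrmM nrmX mulrCA ler_wpM2l ?nrm_ge0//.
  rewrite -{1}(divfK (lt0r_neq0 r0) (nrm w)) exprMn ler_wpM2r ?exprn_ge0 ?(ltW r0)//.
  by rewrite ler_wiXn2l.
rewrite -mulr_sumr mulrC ler_wpM2r ?exprn_ge0//.
apply: le_trans (cM n); rewrite (@big_cat_nat _ _ _ m 0 n)//= lerDr.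
by rewrite sumr_ge0// => i _; rewrite mulr_ge0 ?nrm_ge0 ?exprn_ge0 ?ltW.
Qed.

Lemma psum_eq c w z : ps c w @ \oo --> z -> psum c w = z.
Proof.
move=> H; rewrite /psum (cvg_lim _ (cvgc_Re H))// (cvg_lim _ (cvgc_Im H))//.
by case: z H.
Qed.

Lemma psum_cvg c w rho M : 0 < rho -> abs_le c rho M -> nrm w <= rho ->
  ps c w @ \oo --> psum c w.
Proof.
move=> r0 cM wr.
have sub (u : nat -> R) : (forall k, `|u k| <= nrm (c k * w ^+ k)) ->
    cvgn (series u).
  move=> H; apply: normed_cvg; apply: nondecreasing_is_cvgn.
    by apply/nondecreasing_seqP => n; rewrite [leRHS]big_nat_recr//= lerDl normr_ge0.
  exists M => _ [n _ <-]; apply: le_trans (cM n); apply: ler_sum => k _.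
  rewrite (le_trans (H k))// nrmM nrmX ler_wpM2l ?nrm_ge0// lerXn2r// ?nnegrE//.
    exact: nrm_ge0.
  exact: ltW.
apply: cvgc_ReIm.
  have -> : (fun n => complex.Re (ps c w n)) =
            series (fun k => complex.Re (c k * w ^+ k)).
    apply/funext; elim=> [|n IH]; first by rewrite /ps /series/= !big_nil.
    rewrite seriesSr -IH /ps big_nat_recr//=.
    by case: (\sum_(0 <= i < n) _) => a b; case: (_ * _).
  by apply: sub => k; exact: Re_le_nrm.
have -> : (fun n => complex.Im (ps c w n)) =
          series (fun k => complex.Im (c k * w ^+ k)).
  apply/funext; elim=> [|n IH]; first by rewrite /ps /series/= !big_nil.
  rewrite seriesSr -IH /ps big_nat_recr//=.
  by case: (\sum_(0 <= i < n) _) => a b; case: (_ * _).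
by apply: sub => k; exact: Im_le_nrm.
Qed.

Lemma psum_tail c w rho M n : 0 < rho -> abs_le c rho M -> nrm w <= rho ->
  nrm (psum c w - ps c w n) <= M * (nrm w / rho) ^+ n.
Proof.
move=> r0 cM wr; have H := psum_cvg r0 cM wr.
have H2 : (fun m => nrm (ps c w m - ps c w n)) @ \oo --> nrm (psum c w - ps c w n).
  exact: nrm_cvg (cvgcB H (cvgc_cst (ps c w n))).
apply: (cvg_le_ub H2); exists n => // m nm; exact: (ps_dist r0 cM wr).
Qed.

Lemma psum_bound c w rho M : 0 < rho -> abs_le c rho M -> nrm w <= rho ->
  nrm (psum c w) <= M.
Proof.
move=> r0 cM wr; have := psum_tail 0 r0 cM wr.
by rewrite /ps big_nil subr0 expr0 mulr1.
Qed.

Lemma psum0 c : psum c 0 = c 0.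
Proof.
apply: psum_eq; apply/cvgcP => e e0; near=> n.
rewrite /ps big_ltn; last by near: n; exact: nbhs_infty_gt.
rewrite expr0 mulr1 big_nat big1 ?addr0 ?subrr ?nrm0 ?ltW//.
by move=> i /andP[i0 _]; rewrite expr0n gtn_eqF// mulr0.
Unshelve. all: by end_near. Qed.

Lemma psum_poly (p : {poly C}) w : psum (fun k => p`_k) w = p.[w].
Proof.
apply: psum_eq; apply/cvgcP => e e0; near=> n.
have pn : (size p <= n)%N by near: n; exact: nbhs_infty_ge.
by rewrite (horner_coef_wide _ pn) /ps big_mkord subrr nrm0 ltW.
Unshelve. all: by end_near. Qed.

Lemma abs_leD c d rho M N : abs_le c rho M -> abs_le d rho N -> 0 <= rho ->
  abs_le (fun k => c k + d k) rho (M + N).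
Proof.
move=> cM dN r0 n; apply: le_trans (lerD (cM n) (dN n)).
rewrite -big_split/=; apply: ler_sum => k _.
by rewrite -mulrDl ler_wpM2r ?exprn_ge0// nrmD.
Qed.

Lemma psumD c d w rho M N : 0 < rho -> abs_le c rho M -> abs_le d rho N ->
  nrm w <= rho -> psum (fun k => c k + d k) w = psum c w + psum d w.
Proof.
move=> r0 cM dN wr; apply: psum_eq.
rewrite [X in X @ _ --> _](_ : _ = (fun n => ps c w n + ps d w n)); last first.
  apply/funext => n; rewrite /ps -big_split/=.
  by apply: eq_bigr => k _; rewrite mulrDl.
exact: cvgcD (psum_cvg r0 cM wr) (psum_cvg r0 dN wr).
Qed.

Lemma abs_le_eq c d rho M : (forall k, nrm (d k) <= nrm (c k)) -> 0 <= rho ->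
  abs_le c rho M -> abs_le d rho M.
Proof.
move=> cd r0 cM n; apply: le_trans (cM n); apply: ler_sum => k _.
by rewrite ler_wpM2r ?exprn_ge0.
Qed.

Lemma psumZ (a : C) c w rho M : 0 < rho -> abs_le c rho M ->
  nrm w <= rho -> psum (fun k => a * c k) w = a * psum c w.
Proof.
move=> r0 cM wr; apply: psum_eq.
rewrite [X in X @ _ --> _](_ : _ = (fun n => a * ps c w n)); last first.
  apply/funext => n; rewrite /ps mulr_sumr.
  by apply: eq_bigr => k _; rewrite mulrA.
exact: cvgcM (cvgc_cst _) (psum_cvg r0 cM wr).
Qed.

Lemma psum_scale (a : C) c w : psum (fun k => c k * a ^+ k) w = psum c (a * w).
Proof.
rewrite /psum; have -> // : ps (fun k => c k * a ^+ k) w = ps c (a * w).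
apply/funext => n; apply: eq_bigr => k _; by rewrite exprMn mulrA.
Qed.

End PowerSeries.

(** * Products and inverses of power series *)

Section Algebra.
Context {R : realType}.
Local Notation C := R[i].
Implicit Types (c d e : nat -> C) (w z : C) (rho sigma M : R).

Lemma psum_fin c w n : (forall j, (n <= j)%N -> c j = 0) -> psum c w = ps c w n.
Proof.
move=> cn; apply: psum_eq; apply/cvgcP => eps e0; exists n => // m /= nm.
rewrite /ps (@big_cat_nat _ _ _ n 0 m)//= addrAC subrr add0r.
rewrite big_nat big1 ?nrm0 ?(ltW e0)//.
by move=> i /andP[ni _]; rewrite cn// mul0r.
Qed.

Definition conv c e (n : nat) : C := \sum_(0 <= k < n.+1) c k * e (n - k)%N.

Lemma convS c e n :
  conv c e n = c 0%N * e n + \sum_(1 <= k < n.+1) c k * e (n - k)%N.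
Proof. by rewrite /conv big_ltn// subn0. Qed.

(** Truncations as polynomials, and their majorants. A product of truncations has the coefficients
    of the Cauchy product below degree [n], and evaluation is multiplicative, so estimates on [conv]
    reduce to polynomial identities. *)
Let pol c n : {poly C} := \poly_(k < n) c k.
Let apol c n : {poly R} := \poly_(k < n) nrm (c k).

Let apol_horner c rho M n : abs_le c rho M -> (apol c n).[rho] <= M.
Proof. by move=> /(_ n); rewrite horner_poly big_mkord. Qed.

Let polM_coef c e n k : nrm (pol c n * pol e n)`_k <= (apol c n * apol e n)`_k.
Proof.
rewrite !coefM (le_trans (nrm_sum _ _ _))//; apply: ler_sum => i _.
by rewrite nrmM !coef_poly; do 2 case: ifP => _; rewrite ?nrm0.
Qed.

Let apolM_ge0 c e n k : 0 <= (apol c n * apol e n)`_k.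
Proof.
rewrite coefM sumr_ge0// => i _; rewrite !coef_poly.
by do 2 case: ifP => _; rewrite ?mul0r ?mulr0// mulr_ge0 ?nrm_ge0.
Qed.

Let apolM_size c e n : (size (apol c n * apol e n)%R <= n + n)%N.
Proof.
apply: leq_trans (size_polyMleq _ _) _.
by rewrite (leq_trans (leq_pred _))// leq_add// size_poly.
Qed.

Let polM_size c e n : (size (pol c n * pol e n)%R <= n + n)%N.
Proof.
apply: leq_trans (size_polyMleq _ _) _.
by rewrite (leq_trans (leq_pred _))// leq_add// size_poly.
Qed.

Let polM_conv c e n k : (k < n)%N -> (pol c n * pol e n)`_k = conv c e k.
Proof.
move=> kn; rewrite coefM /conv big_mkord; apply: eq_bigr => i _.
rewrite !coef_poly (leq_ltn_trans _ kn) ?(leq_ltn_trans _ kn) ?leq_subr//.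
by rewrite -ltnS.
Qed.

Lemma abs_le_conv c e rho M N : 0 <= rho -> abs_le c rho M -> abs_le e rho N ->
  abs_le (conv c e) rho (M * N).
Proof.
move=> r0 cM eN n.
apply: (@le_trans _ _ (apol c n * apol e n).[rho]); last first.
  rewrite hornerM ler_pM ?apol_horner//.
    by rewrite horner_poly sumr_ge0// => i _; rewrite mulr_ge0 ?nrm_ge0 ?exprn_ge0.
  by rewrite horner_poly sumr_ge0// => i _; rewrite mulr_ge0 ?nrm_ge0 ?exprn_ge0.
rewrite (horner_coef_wide _ (apolM_size c e n)) -(big_mkord xpredT (fun k =>
  (apol c n * apol e n)`_k * rho ^+ k)) (@big_cat_nat _ _ _ n 0 (n + n))//=;
  last exact: leq_addr.
rewrite -[leLHS]addr0 lerD//.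
  rewrite big_nat [leRHS]big_nat; apply: ler_sum => k /andP[_ kn].
  by rewrite ler_wpM2r ?exprn_ge0// -(polM_conv c e kn) polM_coef.
by rewrite sumr_ge0// => i _; rewrite mulr_ge0 ?exprn_ge0.
Qed.

Lemma psumM c e w rho M N : 0 < rho -> abs_le c rho M -> abs_le e rho N ->
  nrm w < rho -> psum (conv c e) w = psum c w * psum e w.
Proof.
move=> r0 cM eN wr; apply: psum_eq.
have x0 : 0 <= nrm w / rho by rewrite divr_ge0 ?nrm_ge0// ltW.
have x1 : nrm w / rho < 1 by rewrite ltr_pdivrMr// mul1r.
(* The difference only has terms of degree [n] to 2n, dominated by those of the product of the
   majorants; this gives the factor (|w| / rho)^n, which tends to 0 since |w| < rho. *)
have H n : nrm (ps c w n * ps e w n - ps (conv c e) w n) <=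
    (M * N) * (nrm w / rho) ^+ n.
  have -> : ps c w n * ps e w n = (pol c n * pol e n).[w].
    by rewrite hornerM !horner_poly /ps !big_mkord.
  rewrite (horner_coef_wide _ (polM_size c e n)) -(big_mkord xpredT (fun k =>
    (pol c n * pol e n)`_k * w ^+ k)) (@big_cat_nat _ _ _ n 0 (n + n))//=;
    last exact: leq_addr.
  have -> : ps (conv c e) w n =
      \sum_(0 <= k < n) (pol c n * pol e n)`_k * w ^+ k.
    by rewrite /ps big_nat [RHS]big_nat; apply: eq_bigr => k /andP[_ kn];
       rewrite polM_conv.
  rewrite addrAC subrr add0r (le_trans (nrm_sum _ _ _))//.
  apply: (@le_trans _ _ (\sum_(n <= k < n + n) (nrm w / rho) ^+ n *
      ((apol c n * apol e n)`_k * rho ^+ k))).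
    rewrite big_nat [leRHS]big_nat; apply: ler_sum => k /andP[nk _].
    rewrite nrmM nrmX mulrCA.
    rewrite -{1}(divfK (lt0r_neq0 r0) (nrm w)) exprMn ler_pM ?nrm_ge0//.
      by rewrite mulr_ge0 ?exprn_ge0// ltW.
    by rewrite ler_wpM2r ?exprn_ge0 ?(ltW r0)// ler_wiXn2l// ltW.
  rewrite -mulr_sumr mulrC ler_wpM2r ?exprn_ge0//.
  apply: (@le_trans _ _ (apol c n * apol e n).[rho]); last first.
    rewrite hornerM ler_pM ?apol_horner//.
      by rewrite horner_poly sumr_ge0// => i _;
         rewrite mulr_ge0 ?nrm_ge0 ?exprn_ge0// ltW.
    by rewrite horner_poly sumr_ge0// => i _;
       rewrite mulr_ge0 ?nrm_ge0 ?exprn_ge0// ltW.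
  rewrite (horner_coef_wide _ (apolM_size c e n)) -(big_mkord xpredT (fun k =>
    (apol c n * apol e n)`_k * rho ^+ k)) (@big_cat_nat _ _ _ n 0 (n + n))//=;
    last exact: leq_addr.
  by rewrite lerDr sumr_ge0// => i _; rewrite mulr_ge0 ?exprn_ge0// ltW.
have L : (fun n => ps c w n * ps e w n) @ \oo --> psum c w * psum e w.
  exact: cvgcM (psum_cvg r0 cM (ltW wr)) (psum_cvg r0 eN (ltW wr)).
have D : (fun n => ps c w n * ps e w n - ps (conv c e) w n) @ \oo --> (0 : C).
  apply/cvgcP => eps e0; apply: filterS (expr_small (M * N) x0 x1 e0) => n.
  by rewrite subr0; apply: le_trans.
have -> : ps (conv c e) w = fun n => ps c w n * ps e w n -
    (ps c w n * ps e w n - ps (conv c e) w n).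
  by apply/funext => n; rewrite opprB addrC subrK.
rewrite -[psum c w * _]subr0; exact: cvgcB L D.
Qed.

(* Below, x / 2M majorizes (x/2M)^k for k >= 1, so the tail of c has norm at most
   1/2 and the Neumann series converges. *)
Lemma abs_le_inv c e rho M : 0 < rho -> abs_le c rho M -> c 0%N = 1 ->
  (forall n, conv c e n = (n == 0)%:R) -> abs_le e (rho / (2 * M)) 2.
Proof.
move=> r0 cM c0 ce N.
have M1 : 1 <= M.
  by have := abs_le_term 0 (ltW r0) cM; rewrite c0 nrm1 expr0 mulr1.
set s := rho / (2 * M).
have M20 : 0 < 2 * M by lra.
have s0 : 0 < s by rewrite divr_gt0.
pose c' k := if k == 0%N then 0 else c k.
have c'2 : abs_le c' s 2^-1.
  move=> n; apply: (@le_trans _ _ ((2 * M)^-1 * M)); last first.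
    by rewrite invfM -mulrA mulVf ?mulr1//; lra.
  apply: le_trans (ler_wpM2l _ (cM n)); last by rewrite invr_ge0 ltW.
  rewrite mulr_sumr; apply: ler_sum => -[|k] _; rewrite /c'/=.
    rewrite nrm0 mul0r.
    by rewrite !mulr_ge0 ?invr_ge0 ?nrm_ge0// ltW.
  rewrite mulrCA ler_wpM2l ?nrm_ge0// exprMn mulrC ler_wpM2r ?exprn_ge0 ?(ltW r0)//.
  rewrite exprS ler_piMr ?invr_ge0 ?(ltW M20)// exprn_ile1 ?invr_ge0 ?(ltW M20)//.
  by rewrite invf_le1//; lra.
set E := \sum_(0 <= k < N) nrm (e k) * s ^+ k.
have E0 : 0 <= E.
  by apply: sumr_ge0 => k _; rewrite mulr_ge0 ?nrm_ge0 ?exprn_ge0// ltW.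
(* [E] is a finite sum, so the term on the right can be absorbed without knowing beforehand that [e]
   converges. *)
suff : E <= 1 + 2^-1 * E by lra.
have step n : (n < N)%N ->
    nrm (e n) * s ^+ n <= (n == 0)%:R + (apol c' N * apol e N)`_n * s ^+ n.
  move=> nN.
  have en : e n = (n == 0)%:R - (pol c' N * pol e N)`_n.
    rewrite polM_conv// -ce !convS c0 mul1r /c' eqxx mul0r add0r.
    rewrite [X in _ - X](_ : _ = \sum_(1 <= k < n.+1) c k * e (n - k)%N) ?addrK//.
    by rewrite big_nat [RHS]big_nat; apply: eq_bigr => -[].
  rewrite {1}en (@le_trans _ _ (((n == 0)%:R + (apol c' N * apol e N)`_n) * s ^+ n))//.
    rewrite ler_wpM2r ?exprn_ge0 ?(ltW s0)// (le_trans (nrmD _ _))// nrmN.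
    by rewrite nrm_nat lerD2l polM_coef.
  rewrite mulrDl lerD2r; case: n {nN en} => [|n]; rewrite ?expr0 ?mulr1//.
  by rewrite mul0r.
apply: (@le_trans _ _ (\sum_(0 <= n < N)
  ((n == 0)%:R + (apol c' N * apol e N)`_n * s ^+ n))).
  by rewrite /E big_nat [leRHS]big_nat; apply: ler_sum => n /andP[_ /step].
rewrite big_split/= lerD//.
  case: N {E E0 step} => [|N]; first by rewrite big_nil.
  by rewrite big_ltn//= big_nat big1 ?addr0// => -[].
apply: (@le_trans _ _ (apol c' N * apol e N).[s]); last first.
  rewrite hornerM ler_pM ?(apol_horner _ c'2)//.
  - by rewrite horner_poly sumr_ge0// => i _;
       rewrite mulr_ge0 ?nrm_ge0 ?exprn_ge0// ltW.
  - by rewrite horner_poly sumr_ge0// => i _;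
       rewrite mulr_ge0 ?nrm_ge0 ?exprn_ge0// ltW.
  - by rewrite horner_poly /E big_mkord.
rewrite (horner_coef_wide _ (apolM_size c' e N)) -(big_mkord xpredT (fun k =>
  (apol c' N * apol e N)`_k * s ^+ k)) (@big_cat_nat _ _ _ N 0 (N + N))//=;
  last exact: leq_addr.
by rewrite lerDl sumr_ge0// => i _; rewrite mulr_ge0 ?exprn_ge0// ltW.
Qed.

Lemma conv_inv_ex c : c 0%N = 1 ->
  exists e, forall n, conv c e n = (n == 0)%:R.
Proof.
move=> c0.
(* Each coefficient of the inverse depends on all the previous ones, so the iteration carries the
   whole list. *)
pose step (s : seq C) :=
  rcons s (- \sum_(1 <= k < (size s).+1) c k * nth 0 s (size s - k)).
pose s n := iter n step [:: 1].
have size_s n : size (s n) = n.+1 by elim: n => //= n IH; rewrite size_rcons IH.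
have s_nth n m k : (k <= n)%N -> (n <= m)%N -> nth 0 (s m) k = nth 0 (s n) k.
  move=> kn; elim: m => [|m IH]; first by rewrite leqn0 => /eqP ->.
  rewrite leq_eqVlt => /predU1P[->//|nm]; rewrite /= nth_rcons size_s ltnS.
  by rewrite (leq_trans kn)// IH.
exists (fun n => nth 0 (s n) n) => -[|n].
  by rewrite /conv big_ltn// big_geq// c0 mul1r addr0.
rewrite convS c0 mul1r [nth 0 (s n.+1) n.+1]/=.
rewrite nth_rcons size_s ltnn eqxx addrC.
apply/eqP; rewrite addr_eq0 opprK; apply/eqP.
rewrite big_nat [RHS]big_nat; apply: eq_bigr => k /andP[k0 kn].
by rewrite (s_nth (n.+1 - k)%N n)//; lia.
Qed.

End Algebra.

(** * Limits of power series, change of centre, the identity theorem *)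

Section Recentering.
Context {R : realType}.
Local Notation C := R[i].
Implicit Types (c d e : nat -> C) (w z : C) (rho sigma M : R).

Lemma abs_le_lim (T : Type) (F : set_system T) {FF : ProperFilter F}
    (c : T -> nat -> C) c0 rho M : 0 <= rho ->
  (\forall n \near F, abs_le (c n) rho M) ->
  (forall k, c n k @[n --> F] --> c0 k) -> abs_le c0 rho M.
Proof.
move=> r0 cM cc0 N.
have L : (fun n => \sum_(0 <= k < N) nrm (c n k) * rho ^+ k) @ F -->
    \sum_(0 <= k < N) nrm (c0 k) * rho ^+ k.
  elim: N => [|N IH].
    rewrite big_nil [X in X @ _](_ : _ = fun=> 0); first exact: cvg_cst.
    by apply/funext => n; rewrite big_nil.
  rewrite big_nat_recr//= [X in X @ _](_ : _ = fun n =>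
    \sum_(0 <= k < N) nrm (c n k) * rho ^+ k + nrm (c n N) * rho ^+ N).
    apply: cvgD => //; apply: cvgMl; exact: nrm_cvg.
  by apply/funext => n; rewrite big_nat_recr.
apply: (cvg_le_ub L); apply: filterS cM => n; exact.
Qed.

(** The common bound makes all tails beyond some degree [K] at most [eps / 4] on the disc of radius
    [r]; the [K] remaining terms converge coefficientwise. *)
Lemma psum_lim_uniform (T : Type) (F : set_system T) {FF : ProperFilter F}
    (c : T -> nat -> C) c0 rho M r eps : 0 < rho ->
  (\forall n \near F, abs_le (c n) rho M) ->
  (forall k, c n k @[n --> F] --> c0 k) -> 0 <= r -> r < rho -> 0 < eps ->
  \forall n \near F, forall w, nrm w <= r ->
    nrm (psum (c n) w - psum c0 w) <= eps.
Proof.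
move=> rho0 cM cc0 r0 rr e0.
have c0M : abs_le c0 rho M by exact: abs_le_lim (ltW rho0) cM cc0.
have x0 : 0 <= r / rho by rewrite divr_ge0// ltW.
have x1 : r / rho < 1 by rewrite ltr_pdivrMr// mul1r.
have e40 : 0 < eps / 4 by rewrite divr_gt0.
have [K _ /(_ K (leqnn K)) HK] := expr_small M x0 x1 e40.
have L : (fun n => \sum_(0 <= k < K) nrm (c n k - c0 k) * r ^+ k) @ F --> (0 : R).
  elim: (K) => [|N IH].
    rewrite [X in X @ _](_ : _ = fun=> 0); first exact: cvg_cst.
    by apply/funext => n; rewrite big_nil.
  rewrite [X in X @ _](_ : _ = fun n =>
    \sum_(0 <= k < N) nrm (c n k - c0 k) * r ^+ k + nrm (c n N - c0 N) * r ^+ N).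
    have L2 : (fun n => nrm (c n N - c0 N) * r ^+ N) @ F --> 0 * r ^+ N.
      by apply: cvgMl; exact: nrm_cvg0 (cc0 N).
    have E (z : R) : z = 0 + 0 * r ^+ N -> (fun n => \sum_(0 <= k < N)
        nrm (c n k - c0 k) * r ^+ k + nrm (c n N - c0 N) * r ^+ N) @ F --> z.
      by move=> ->; exact: cvgD IH L2.
    by apply: E; rewrite mul0r addr0.
  by apply/funext => n; rewrite big_nat_recr.
have e20 : 0 < eps / 2 by rewrite divr_gt0.
move/cvgrPdist_le : L => /(_ _ e20) L.
apply: filterS2 cM L => n cnM; rewrite sub0r normrN => /ler_normlW Ln w wr.
have wx : nrm w / rho <= r / rho by rewrite ler_wpM2r// invr_ge0 ltW.
have tail d : abs_le d rho M -> nrm (psum d w - ps d w K) <= eps / 4.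
  move=> dM; apply: le_trans HK.
  rewrite (le_trans (psum_tail K rho0 dM (le_trans wr (ltW rr))))//.
  rewrite ler_wpM2l ?(abs_le_ge0 dM)// lerXn2r// ?nnegrE//.
  by rewrite divr_ge0 ?nrm_ge0// ltW.
have -> : psum (c n) w - psum c0 w = (psum (c n) w - ps (c n) w K) +
    (ps (c n) w K - ps c0 w K) - (psum c0 w - ps c0 w K) by ring.
have : nrm (ps (c n) w K - ps c0 w K) <= eps / 2.
  apply: le_trans Ln; rewrite /ps -sumrB (le_trans (nrm_sum _ _ _))//.
  apply: ler_sum => k _; rewrite -mulrBl nrmM nrmX ler_wpM2l ?nrm_ge0//.
  by rewrite lerXn2r// ?nnegrE// nrm_ge0.
have := tail _ cnM; have := tail _ c0M.
set a := psum (c n) w - _; set b := psum c0 w - _; set g := ps (c n) w K - _.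
move=> Hb Ha Hg; have := nrmD (a + g) (- b); have := nrmD a g; rewrite nrmN.
by move: Hb Ha Hg e0; lra.
Qed.

Lemma psum_lim (T : Type) (F : set_system T) {FF : ProperFilter F}
    (c : T -> nat -> C) c0 rho M w : 0 < rho ->
  (\forall n \near F, abs_le (c n) rho M) ->
  (forall k, c n k @[n --> F] --> c0 k) -> nrm w < rho ->
  psum (c n) w @[n --> F] --> psum c0 w.
Proof.
move=> rho0 cM cc0 wr; apply/cvgcP => e e0.
apply: filterS (psum_lim_uniform rho0 cM cc0 (nrm_ge0 w) wr e0) => n.
by apply; exact: lexx.
Qed.

(** The coefficients of the [j]-th derivative divided by j!; [recenter] thus lists the Taylor
    coefficients at [z]. *)
Definition shiftc c (j k : nat) : C := c (j + k)%N *+ 'C(j + k, j).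

Definition recenter c z (j : nat) : C := psum (shiftc c j) z.

Lemma binom_sum_le (a b : R) k J : 0 <= a -> 0 <= b ->
  \sum_(0 <= j < J) (a ^+ (k - j) * b ^+ j) *+ 'C(k, j) <= (a + b) ^+ k.
Proof.
move=> a0 b0; rewrite exprDn -(big_mkord xpredT (fun j =>
  (a ^+ (k - j) * b ^+ j) *+ 'C(k, j))).
have t0 j : 0 <= (a ^+ (k - j) * b ^+ j) *+ 'C(k, j).
  by rewrite mulrn_wge0// mulr_ge0 ?exprn_ge0.
have [Jk|kJ] := leqP J k.+1.
  by rewrite [leRHS](@big_cat_nat _ _ _ J)//= lerDl sumr_ge0.
rewrite (@big_cat_nat _ _ _ k.+1)//=; last exact: ltnW.
rewrite [X in _ + X]big_nat [X in _ + X]big1 ?addr0// => j /andP[kj _].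
by rewrite bin_small.
Qed.

Lemma binom_le (a b : R) j k : 0 <= a -> 0 <= b ->
  (a ^+ k * b ^+ j) *+ 'C(j + k, j) <= (a + b) ^+ (j + k).
Proof.
move=> a0 b0; apply: le_trans (binom_sum_le (j + k) j.+1 a0 b0).
rewrite big_nat_recr//= addKn lerDr sumr_ge0// => i _.
by rewrite mulrn_wge0// mulr_ge0 ?exprn_ge0.
Qed.

(** Cauchy's estimate for derivatives: the single binomial term C(j+k, j) a^k b^j is at most (a +
    b)^(j+k), so giving up [b] of the radius pays for a factor [b ^+ j]. *)
Lemma abs_le_shiftc c (a b : R) M j : 0 <= a -> 0 < b -> abs_le c (a + b) M ->
  abs_le (shiftc c j) a (M / b ^+ j).
Proof.
move=> a0 b0 cM n; rewrite ler_pdivlMr ?exprn_gt0// mulr_suml.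
apply: le_trans (cM (j + n)%N).
rewrite [leRHS](@big_cat_nat _ _ _ j)//=; last exact: leq_addr.
rewrite -[leLHS]add0r lerD//.
  rewrite sumr_ge0// => i _; rewrite mulr_ge0 ?nrm_ge0 ?exprn_ge0//.
  by rewrite addr_ge0// ltW.
rewrite [leRHS](_ : _ = \sum_(0 <= k < n)
    nrm (c (k + j)%N) * (a + b) ^+ (k + j)); last first.
  by rewrite -{1}(add0n j) big_addn addKn.
apply: ler_sum => k _.
rewrite addnC /shiftc -mulr_natr nrmM nrm_nat -!mulrA ler_wpM2l ?nrm_ge0//.
by apply: le_trans (binom_le j k a0 (ltW b0)); rewrite mulr_natl.
Qed.

(** The recentred coefficients of a truncation: all sums are finite and can be exchanged, and [n]
    then tends to infinity. For k < j the truncated subtraction is harmless since the binomial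
    coefficient vanishes. *)
Let fin c z n (j : nat) : C :=
  \sum_(0 <= k < n) c k * (z ^+ (k - j) *+ 'C(k, j)).

Let fin_abs_le c z rho M n : nrm z < rho -> abs_le c rho M ->
  abs_le (fin c z n) (rho - nrm z) M.
Proof.
move=> zr cM J; apply: le_trans (cM n).
apply: (@le_trans _ _ (\sum_(0 <= j < J) \sum_(0 <= k < n)
   nrm (c k) * ((nrm z ^+ (k - j) * (rho - nrm z) ^+ j) *+ 'C(k, j)))).
  apply: ler_sum => j _; rewrite -[X in _ <= X]mul1r.
  rewrite mul1r (le_trans (ler_wpM2r _ (nrm_sum _ _ _)))//.
    by rewrite exprn_ge0// subr_ge0 ltW.
  rewrite mulr_suml; apply: ler_sum => k _.
  rewrite nrmM -mulr_natr nrmM nrm_nat nrmX -!mulrA ler_wpM2l ?nrm_ge0//.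
  by rewrite mulrCA mulr_natl.
rewrite exchange_big/=; apply: ler_sum => k _.
rewrite -mulr_sumr ler_wpM2l ?nrm_ge0//.
apply: le_trans (binom_sum_le k J (nrm_ge0 z) _) _; first by rewrite subr_ge0 ltW.
by rewrite addrC subrK.
Qed.

Let fin_psum c z n w : psum (fin c z n) w = ps c (z + w) n.
Proof.
rewrite (@psum_fin _ _ _ n); last first.
  move=> j nj; rewrite /fin big_nat big1// => k /andP[_ kn].
  by rewrite bin_small ?mulr0// (leq_trans kn).
rewrite /ps /fin; under eq_bigr do rewrite mulr_suml.
rewrite exchange_big/=; rewrite big_nat [RHS]big_nat.
apply: eq_bigr => k /andP[_ kn].
rewrite exprDn -(big_mkord xpredT (fun j => (z ^+ (k - j) * w ^+ j) *+ 'C(k, j))).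
rewrite mulr_sumr [LHS](@big_cat_nat _ _ _ k.+1)//=.
rewrite [X in _ + X]big_nat [X in _ + X]big1 ?addr0; last first.
  by move=> j /andP[kj _]; rewrite bin_small// mulr0n mulr0 mul0r.
by apply: eq_bigr => j _; rewrite -mulrA mulrnAl.
Qed.

Let fin_cvg c z rho M j : nrm z < rho -> abs_le c rho M ->
  (fun n => fin c z n j) @ \oo --> recenter c z j.
Proof.
move=> zr cM; pose a := (nrm z + rho) / 2; pose b := (rho - nrm z) / 2.
have b0 : 0 < b by rewrite divr_gt0// subr_gt0.
have a0 : 0 < a by rewrite /a; have := nrm_ge0 z; lra.
have cM' : abs_le c (a + b) M by rewrite (_ : a + b = rho)// /a /b; field.
have za : nrm z <= a by rewrite /a; lra.
have L := psum_cvg a0 (abs_le_shiftc j (ltW a0) b0 cM') za.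
rewrite -(cvg_shiftn j) [X in X @ _](_ : _ = ps (shiftc c j) z); first exact: L.
apply/funext => n; rewrite /fin /ps /= addnC.
rewrite (@big_cat_nat _ _ _ j)//=; last exact: leq_addr.
rewrite big_nat big1 ?add0r; last first.
  by move=> k /andP[_ kj]; rewrite bin_small// mulr0n mulr0.
rewrite -{1}(add0n j) big_addn addKn; apply: eq_bigr => k _.
by rewrite addnC addKn /shiftc mulrnAr mulrnAl.
Qed.

Lemma abs_le_recenter c z rho M : nrm z < rho -> abs_le c rho M ->
  abs_le (recenter c z) (rho - nrm z) M.
Proof.
move=> zr cM; apply: (@abs_le_lim _ \oo _ (fin c z)).
- by rewrite subr_ge0 ltW.
- by apply: nearW => n; exact: fin_abs_le.
- by move=> j; exact: fin_cvg zr cM.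
Qed.

Lemma psum_recenter c z w rho M : nrm z < rho -> abs_le c rho M ->
  nrm w < rho - nrm z -> psum (recenter c z) w = psum c (z + w).
Proof.
move=> zr cM wr.
have s0 : 0 < rho - nrm z by rewrite subr_gt0.
have r0 : 0 < rho by apply: le_lt_trans zr; exact: nrm_ge0.
have L1 : (fun n => psum (fin c z n) w) @ \oo --> psum (recenter c z) w.
  apply: (psum_lim s0 _ _ wr).
    by apply: nearW => n; exact: fin_abs_le zr cM.
  by move=> j; exact: fin_cvg zr cM.
have L2 : (fun n => psum (fin c z n) w) @ \oo --> psum c (z + w).
  rewrite [X in X @ _](_ : _ = ps c (z + w)); last first.
    by apply/funext => n; rewrite fin_psum.
  apply: (psum_cvg r0 cM); apply: le_trans (nrmD _ _) _; lra.
exact: cvgc_unique L1 L2.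
Qed.

(** Once the lower coefficients vanish, |e k| t^k is at most the next tail K t^(k+1), and [t] may be
    taken arbitrarily small. Positive real points suffice. *)
Lemma psum_eq0 e rho M eta : 0 < rho -> 0 < eta -> abs_le e rho M ->
  (forall t : R, 0 < t -> t < eta -> psum e t%:C = 0) -> forall k, e k = 0.
Proof.
move=> r0 eta0 eM H k; elim/ltn_ind : k => k IH.
have M0 := abs_le_ge0 eM.
apply/eqP; rewrite -nrm_eq0; apply/eqP/le_anti; rewrite nrm_ge0 andbT.
apply/ler_addgt0Pr => eps e0; rewrite add0r.
pose K := M / rho ^+ k.+1.
have K0 : 0 <= K by rewrite divr_ge0// exprn_ge0// ltW.
pose t := Num.min (Num.min (eta / 2) rho) (eps / (K + 1)).
have K1 : 0 < K + 1 by rewrite ltr_wpDl.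
have t0 : 0 < t by rewrite !lt_min r0 andbT !divr_gt0.
have t1 : t < eta by rewrite !gt_min (_ : eta / 2 < eta)//; lra.
have t2 : t <= rho by rewrite !ge_min lexx orbT.
have t3 : t * (K + 1) <= eps by rewrite -ler_pdivlMr// ge_min lexx orbT.
have nt : nrm t%:C = t by rewrite nrm_real gtr0_norm.
have := psum_tail k.+1 r0 eM (_ : nrm t%:C <= rho); rewrite nt => /(_ t2).
rewrite H// sub0r nrmN /ps big_nat_recr//= big_nat big1; last first.
  by move=> i /andP[_ ik]; rewrite IH// mul0r.
rewrite add0r nrmM nrmX nt.
have -> : M * (t / rho) ^+ k.+1 = K * t * t ^+ k.
  by rewrite /K expr_div_n [t ^+ k.+1]exprS; ring.
rewrite ler_pM2r ?exprn_gt0// => /le_trans; apply.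
by apply: le_trans t3; rewrite mulrC ler_wpM2l ?(ltW t0)// lerDl.
Qed.

Lemma psum_inj c d rho M N eta : 0 < rho -> 0 < eta ->
  abs_le c rho M -> abs_le d rho N ->
  (forall t : R, 0 < t -> t < eta -> psum c t%:C = psum d t%:C) -> c =1 d.
Proof.
move=> r0 eta0 cM dN H k; apply/eqP; rewrite -subr_eq0; apply/eqP.
have dN' : abs_le (fun k => (-1) * d k) rho N.
  by apply: abs_le_eq dN; rewrite ?(ltW r0)// => j; rewrite mulN1r nrmN.
have := @psum_eq0 (fun k => c k + (-1) * d k) rho (M + N) (Num.min eta rho) r0.
rewrite lt_min eta0 r0 => /(_ isT (abs_leD cM dN' (ltW r0))) E.
rewrite -mulN1r E// => t t0; rewrite lt_min => /andP[te tr].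
have tr' : nrm t%:C <= rho by rewrite nrm_real gtr0_norm// ltW.
by rewrite (psumD r0 cM dN' tr') (psumZ _ r0 dN tr') H// mulN1r subrr.
Qed.

(** After recentering at [z], the error of the linear approximation is a tail starting at degree 2,
    at most M (|h| / s)^2. *)
Lemma derivable_psum c z rho M : nrm z < rho -> abs_le c rho M ->
  derivable (psum c) z 1.
Proof.
move=> zr cM; set s := rho - nrm z.
have s0 : 0 < s by rewrite subr_gt0.
have dM := abs_le_recenter zr cM; set d := recenter c z in dM.
apply/derivable_nrmP; exists (d 1%N) => e e0.
have M0 := abs_le_ge0 cM.
have K0 : 0 < M / s ^+ 2 + 1 by rewrite ltr_wpDl// divr_ge0// exprn_ge0// ltW.
exists (Num.min (s / 2) (e / (M / s ^+ 2 + 1))).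
  by rewrite lt_min !divr_gt0.
move=> h; rewrite lt_min => /andP[hs he].
have hs' : nrm h < s by lra.
have -> : psum c (z + h) = psum d h by rewrite (psum_recenter zr cM).
have -> : psum c z = d 0%N.
  have := @psum_recenter c z 0 rho M zr cM.
  by rewrite nrm0 addr0 psum0 => /(_ s0).
have := psum_tail 2 s0 dM (ltW hs').
rewrite /ps !big_nat_recr//= big_nil add0r expr0 mulr1 expr1 opprD addrA.
move/le_trans; apply; rewrite expr_div_n mulrCA mulrC expr2 mulrA ler_wpM2r ?nrm_ge0//.
move: he; rewrite ltr_pdivlMr// => /ltW; apply: le_trans.
by rewrite mulrC ler_wpM2l ?nrm_ge0// lerDl.
Qed.

End Recentering.

(** * Goursat's theorem and analyticity *)

Section SegmentIntegral.
Context {R : realType}.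
Local Notation C := R[i].
Local Notation mu := (@lebesgue_measure R).
Implicit Types (u v : R -> C) (a b c d : R).

Definition rint (u : R -> R) a b : R := \int[mu]_(x in `[a, b]) u x.

Lemma integrable_cont (u : R -> R) a b : continuous u ->
  mu.-integrable `[a, b] (EFin \o u).
Proof.
move=> cu; apply: continuous_compact_integrable; first exact: segment_compact.
exact: continuous_subspaceT.
Qed.

Lemma rintD (u v : R -> R) a b : continuous u -> continuous v ->
  rint (fun x => u x + v x) a b = rint u a b + rint v a b.
Proof. by move=> cu cv; rewrite /rint RintegralD//; exact: integrable_cont. Qed.

Lemma rintZ (k : R) (u : R -> R) a b : continuous u ->
  rint (fun x => k * u x) a b = k * rint u a b.
Proof. by move=> cu; rewrite /rint RintegralZl//; exact: integrable_cont. Qed.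

Lemma rint_cst (k : R) a b : a <= b -> rint (fun=> k) a b = k * (b - a).
Proof.
move=> ab; rewrite /rint Rintegral_cst//= lebesgue_measure_itv/= lte_fin.
by move: ab; rewrite le_eqVlt => /predU1P[->|->//]; rewrite ltxx subrr.
Qed.

Lemma rint_le (u v : R -> R) a b : continuous u -> continuous v ->
  (forall x, a <= x -> x <= b -> u x <= v x) -> rint u a b <= rint v a b.
Proof.
move=> cu cv uv; rewrite /rint le_Rintegral//; try exact: integrable_cont.
by move=> x /=; rewrite in_itv/= => /andP[]; exact: uv.
Qed.

Lemma rint_cat (u : R -> R) a b c : continuous u -> a <= b -> b <= c ->
  rint u a c = rint u a b + rint u b c.
Proof.
move=> cu ab bc; apply/eqP; rewrite addrC -subr_eq; apply/eqP.
rewrite /rint Rintegral_itvB ?bnd_simp//; last exact: integrable_cont.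
rewrite Rintegral_itv_obnd_cbnd//.
by apply: integrableS (integrable_cont b c cu) => //; exact: subset_itv_oc_cc.
Qed.

Lemma rint_bound (u : R -> R) a b M : continuous u -> a <= b ->
  (forall x, a <= x -> x <= b -> `|u x| <= M) -> `|rint u a b| <= M * (b - a).
Proof.
move=> cu ab uM; rewrite ler_norml -mulNr -!rint_cst//.
by apply/andP; split; apply: rint_le => //; try exact: cst_continuous;
  move=> x ax xb; have := uM x ax xb; rewrite ler_norml => /andP[].
Qed.

Definition cint u a b : C :=
  rint (fun x => complex.Re (u x)) a b +i* rint (fun x => complex.Im (u x)) a b.

Lemma cont_Re u : continuous u -> continuous (fun x => complex.Re (u x)).
Proof. move=> cu x; exact: cvgc_Re (cu x). Qed.

Lemma cont_Im u : continuous u -> continuous (fun x => complex.Im (u x)).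
Proof. move=> cu x; exact: cvgc_Im (cu x). Qed.

Let addE (a b c d : R) : (a +i* b) + (c +i* d) = (a + c) +i* (b + d) :> C.
Proof. by []. Qed.

Let mulE (a b c d : R) :
  (a +i* b) * (c +i* d) = (a * c - b * d) +i* (a * d + b * c) :> C.
Proof. by []. Qed.

Lemma cintD u v a b : continuous u -> continuous v ->
  cint (fun x => u x + v x) a b = cint u a b + cint v a b.
Proof.
move=> cu cv; rewrite /cint addE -!rintD; try exact: cont_Re;
  try exact: cont_Im.
by congr (_ +i* _); congr rint; apply/funext => x; case: (u x) => p q;
  case: (v x).
Qed.

Lemma cintZ (k : C) u a b : continuous u ->
  cint (fun x => k * u x) a b = k * cint u a b.
Proof.
move=> cu; case: k => p q; have cr := cont_Re cu; have ci := cont_Im cu.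
have cZ (t : R) (f : R -> R) : continuous f -> continuous (fun x => t * f x).
  by move=> cf x; apply: cvgMr; exact: cf.
rewrite /cint mulE -mulNr -!rintZ// -!rintD//; try exact: cZ.
by congr (_ +i* _); congr rint; apply/funext => x; case: (u x) => e f /=;
  rewrite ?mulNr.
Qed.

Lemma cint_cst (k : C) a b : a <= b -> cint (fun=> k) a b = k * (b - a)%:C.
Proof.
by case: k => p q ab; rewrite /cint !rint_cst// /GRing.mul/= !mulr0 subr0 add0r.
Qed.

Lemma cint_cat u a b c : continuous u -> a <= b -> b <= c ->
  cint u a c = cint u a b + cint u b c.
Proof.
move=> cu ab bc; rewrite /cint (rint_cat (cont_Re cu) ab bc).
by rewrite (rint_cat (cont_Im cu) ab bc).
Qed.

(** The factor 2 comes from bounding real and imaginary parts separately; only the order of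
    magnitude matters in the sequel. *)
Lemma cint_bound u a b M : continuous u -> a <= b ->
  (forall x, a <= x -> x <= b -> nrm (u x) <= M) ->
  nrm (cint u a b) <= 2 * M * (b - a).
Proof.
move=> cu ab uM; rewrite (le_trans (nrm_le_ReIm _))//= -mulrA mulr2n mulrDl mul1r.
apply: lerD; apply: rint_bound => //; try exact: cont_Re; try exact: cont_Im.
- by move=> x ax xb; rewrite (le_trans (Re_le_nrm _))// uM.
- by move=> x ax xb; rewrite (le_trans (Im_le_nrm _))// uM.
Qed.

End SegmentIntegral.

(** * Contour integrals over rectangles *)

Section Rectangle.
Context {R : realType}.
Local Notation C := R[i].
Implicit Types (f g : C -> C) (a b c d : R).

(* The contour integral of f over the positively oriented boundary of
   [a, b] x [c, d], opposite sides being merged. *)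
Definition rect f a b c d : C :=
  cint (fun x => f (x +i* c) - f (x +i* d)) a b +
  'i%C * cint (fun y => f (b +i* y) - f (a +i* y)) c d.

(** Continuity along the four lines that carry the sides: functions with a singularity inside the
    rectangle still satisfy it. *)
Definition sides_cont f a b c d :=
  [/\ continuous (fun x : R => f (x +i* c)), continuous (fun x : R => f (x +i* d)),
      continuous (fun y : R => f (a +i* y)) & continuous (fun y : R => f (b +i* y))].

Lemma cont_sides f a b c d : continuous f -> sides_cont f a b c d.
Proof.
move=> cf.
have H (k : R) : continuous (fun x : R => f (x +i* k)).
  move=> x; apply: (@continuous_comp _ _ _ (fun x : R => x +i* k) f); last exact: cf.
  apply: cvgc_ReIm; [exact: cvg_id|exact: cvg_cst].
have V (k : R) : continuous (fun y : R => f (k +i* y)).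
  move=> x; apply: (@continuous_comp _ _ _ (fun y : R => k +i* y) f); last exact: cf.
  apply: cvgc_ReIm; [exact: cvg_cst|exact: cvg_id].
by split.
Qed.

Lemma contcB (T : topologicalType) (u v : T -> C) :
  continuous u -> continuous v -> continuous (fun x => u x - v x).
Proof. move=> cu cv x; exact: cvgcB (cu x) (cv x). Qed.

Lemma contcD (T : topologicalType) (u v : T -> C) :
  continuous u -> continuous v -> continuous (fun x => u x + v x).
Proof. move=> cu cv x; exact: cvgcD (cu x) (cv x). Qed.

Lemma contcM (T : topologicalType) (u v : T -> C) :
  continuous u -> continuous v -> continuous (fun x => u x * v x).
Proof. move=> cu cv x; exact: cvgcM (cu x) (cv x). Qed.

Lemma rectD f g a b c d : sides_cont f a b c d -> sides_cont g a b c d ->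
  rect (fun z => f z + g z) a b c d = rect f a b c d + rect g a b c d.
Proof.
move=> [f1 f2 f3 f4] [g1 g2 g3 g4]; rewrite /rect.
rewrite [cint _ a b](_ : _ = cint (fun x => (f (x +i* c) - f (x +i* d)) +
    (g (x +i* c) - g (x +i* d))) a b); last first.
  by congr cint; apply/funext => x; rewrite opprD addrACA.
rewrite [cint _ c d](_ : _ = cint (fun x => (f (b +i* x) - f (a +i* x)) +
    (g (b +i* x) - g (a +i* x))) c d); last first.
  by congr cint; apply/funext => x; rewrite opprD addrACA.
rewrite (cintD _ _ (contcB f1 f2) (contcB g1 g2)).
by rewrite (cintD _ _ (contcB f4 f3) (contcB g4 g3)) mulrDr addrACA.
Qed.

Lemma rectZ k f a b c d : sides_cont f a b c d ->
  rect (fun z => k * f z) a b c d = k * rect f a b c d.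
Proof.
move=> [f1 f2 f3 f4]; rewrite /rect.
rewrite [cint _ a b](_ : _ = cint (fun x => k * (f (x +i* c) - f (x +i* d))) a b);
  last by congr cint; apply/funext => x; rewrite mulrBr.
rewrite [cint _ c d](_ : _ = cint (fun x => k * (f (b +i* x) - f (a +i* x))) c d);
  last by congr cint; apply/funext => x; rewrite mulrBr.
rewrite (cintZ _ _ _ (contcB f1 f2)) (cintZ _ _ _ (contcB f4 f3)).
by rewrite mulrDr mulrCA.
Qed.

Lemma rect_bound f a b c d M : sides_cont f a b c d -> a <= b -> c <= d ->
  (forall x, a <= x -> x <= b -> nrm (f (x +i* c)) <= M) ->
  (forall x, a <= x -> x <= b -> nrm (f (x +i* d)) <= M) ->
  (forall y, c <= y -> y <= d -> nrm (f (a +i* y)) <= M) ->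
  (forall y, c <= y -> y <= d -> nrm (f (b +i* y)) <= M) ->
  nrm (rect f a b c d) <= 4 * M * ((b - a) + (d - c)).
Proof.
move=> [f1 f2 f3 f4] ab cd H1 H2 H3 H4.
rewrite mulrDr (le_trans (nrmD _ _))// nrmM -(expr1 'i%C) nrm_iX mul1r.
have -> : 4 * M = 2 * (M + M) by ring.
apply: lerD; [apply: (cint_bound (contcB f1 f2) ab)|
  apply: (cint_bound (contcB f4 f3) cd)].
- by move=> x ax xb; rewrite (le_trans (nrmD _ _))// nrmN lerD// ?H1 ?H2.
- by move=> x ax xb; rewrite (le_trans (nrmD _ _))// nrmN lerD// ?H3 ?H4.
Qed.

Lemma rect_cat_x f a m b c d : continuous f -> a <= m -> m <= b ->
  rect f a b c d = rect f a m c d + rect f m b c d.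
Proof.
move=> cf am mb; have [f1 f2 f3 f4] := cont_sides a b c d cf.
have [_ _ f5 _] := cont_sides m b c d cf.
rewrite /rect (cint_cat (contcB f1 f2) am mb).
rewrite [cint _ c d](_ : _ = cint (fun x => (f (m +i* x) - f (a +i* x)) +
    (f (b +i* x) - f (m +i* x))) c d); last first.
  by congr cint; apply/funext => x; ring.
by rewrite (cintD _ _ (contcB f5 f3) (contcB f4 f5)) mulrDr addrACA.
Qed.

Lemma rect_cat_y f a b c m d : continuous f -> c <= m -> m <= d ->
  rect f a b c d = rect f a b c m + rect f a b m d.
Proof.
move=> cf cm md; have [f1 f2 f3 f4] := cont_sides a b c d cf.
have [f5 _ _ _] := cont_sides a b m d cf.
rewrite /rect (cint_cat (contcB f4 f3) cm md).
rewrite [cint _ a b](_ : _ = cint (fun x => (f (x +i* c) - f (x +i* m)) +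
    (f (x +i* m) - f (x +i* d))) a b); last first.
  by congr cint; apply/funext => x; ring.
by rewrite (cintD _ _ (contcB f1 f5) (contcB f5 f2)) mulrDr addrACA.
Qed.

Lemma rect_affine (k l : C) a b c d : a <= b -> c <= d ->
  rect (fun z => k + l * z) a b c d = 0.
Proof.
move=> ab cd; rewrite /rect.
have E1 x : k + l * (x +i* c) - (k + l * (x +i* d)) = l * ('i%C * (c - d)%:C).
  by rewrite opprD addrACA subrr add0r -mulrBr; congr (_ * _); apply/eqP;
     rewrite eq_complex/=; apply/andP; split; apply/eqP; ring.
have E2 y : k + l * (b +i* y) - (k + l * (a +i* y)) = l * (b - a)%:C.
  by rewrite opprD addrACA subrr add0r -mulrBr; congr (_ * _); apply/eqP;
     rewrite eq_complex/= subrr !eqxx.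
under [X in cint X a b]eq_fun do rewrite E1.
under [X in cint X c d]eq_fun do rewrite E2.
rewrite !cint_cst// -[c - d]opprB rmorphN/=; ring.
Qed.

End Rectangle.

(** * Goursat's theorem by bisection *)

Section Goursat.
Context {R : realType}.
Local Notation C := R[i].
Implicit Types (f g : C -> C) (a b c d : R).

Lemma mid_le a b : a <= b -> a <= (a + b) / 2 /\ (a + b) / 2 <= b.
Proof. by move=> ab; split; lra. Qed.

(** Cousin's principle: if [P] fails on a rectangle, it fails on one of its quarters, and so on; the
    nested quarters shrink to a point around which [P] holds on all small rectangles. *)
Lemma rect_bisection (P : R -> R -> R -> R -> Prop) a0 b0 c0 d0 :
  (forall a b c d, a <= b -> c <= d ->
     P a ((a + b) / 2) c ((c + d) / 2) -> P ((a + b) / 2) b c ((c + d) / 2) ->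
     P a ((a + b) / 2) ((c + d) / 2) d -> P ((a + b) / 2) b ((c + d) / 2) d ->
     P a b c d) ->
  (forall x y, a0 <= x -> x <= b0 -> c0 <= y -> y <= d0 ->
     exists2 del, 0 < del & forall a b c d, a <= x -> x <= b -> c <= y -> y <= d ->
       b - a < del -> d - c < del -> P a b c d) ->
  a0 <= b0 -> c0 <= d0 -> P a0 b0 c0 d0.
Proof.
move=> split4 loc ab0 cd0; apply: contrapT => nP.
pose bad (q : R * R * R * R) := let: (a, b, c, d) := q in
  [/\ a <= b, c <= d & ~ P a b c d].
pose child (q q' : R * R * R * R) := let: (a, b, c, d) := q in
  let: (a', b', c', d') := q' in
  [/\ a <= a', b' <= b, c <= c', d' <= d &
      b' - a' = (b - a) / 2 /\ d' - c' = (d - c) / 2].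
have next (q : R * R * R * R) : bad q -> exists q', child q q' /\ bad q'.
  move: q => [[[a b] c] d] [ab cd np]; pose m := (a + b) / 2; pose k := (c + d) / 2.
  have am : a <= m by rewrite /m; lra.
  have mb : m <= b by rewrite /m; lra.
  have ck : c <= k by rewrite /k; lra.
  have kd : k <= d by rewrite /k; lra.
  apply: contrapT => H; apply: np; apply: split4 => //; apply: contrapT => np; apply: H.
  - by exists (a, m, c, k); split; split => //; split; rewrite /m /k; field.
  - by exists (m, b, c, k); split; split => //; split; rewrite /m /k; field.
  - by exists (a, m, k, d); split; split => //; split; rewrite /m /k; field.
  - by exists (m, b, k, d); split; split => //; split; rewrite /m /k; field.
have /choice[nx nxP] : forall q, exists q', bad q -> child q q' /\ bad q'.
  by move=> q; have [/next[q' ?]|nb] := pselect (bad q); [exists q'|exists q].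
pose s n := iter n nx (a0, b0, c0, d0).
have sbad n : bad (s n).
  by elim: n => [|n /nxP[]//]; split.
have schild n : child (s n) (s n.+1) by have /nxP[] := sbad n.
pose sa n := (s n).1.1.1; pose sb n := (s n).1.1.2.
pose sc n := (s n).1.2; pose sd n := (s n).2.
have E n : s n = (sa n, sb n, sc n, sd n).
  by rewrite /sa /sb /sc /sd; case: (s n) => [[[]]].
have stp n : [/\ sa n <= sa n.+1, sb n.+1 <= sb n, sc n <= sc n.+1,
    sd n.+1 <= sd n & sb n.+1 - sa n.+1 = (sb n - sa n) / 2 /\
    sd n.+1 - sc n.+1 = (sd n - sc n) / 2].
  by have := schild n; rewrite (E n) (E n.+1).
have inv n : [/\ sa n <= sb n, sc n <= sd n & ~ P (sa n) (sb n) (sc n) (sd n)].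
  by have := sbad n; rewrite (E n).
have lim (u v : nat -> R) : (forall n, u n <= u n.+1) -> (forall n, v n.+1 <= v n) ->
    (forall n, u n <= v n) -> exists x, forall n, u n <= x /\ x <= v n.
  move=> uu vv uv.
  have ndu : nondecreasing_seq u by apply/nondecreasing_seqP.
  have niv : nonincreasing_seq v by apply/nonincreasing_seqP.
  have ub n m : u m <= v n.
    have [nm|/ltnW mn] := leqP n m; first by apply: le_trans (uv m) _; exact: niv.
    by apply: le_trans (uv n); exact: ndu.
  have cu : cvgn u by apply: nondecreasing_is_cvgn => //; exists (v 0) => _ [n _ <-].
  exists (limn u) => n; split; first exact: nondecreasing_cvgn_le.
  by apply: (cvg_le_ub cu); apply: nearW => m; exact: ub.
have [x Hx] : exists x, forall n, sa n <= x /\ x <= sb n.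
  by apply: lim => n; have [] := stp n; have [] := inv n.
have [y Hy] : exists y, forall n, sc n <= y /\ y <= sd n.
  by apply: lim => n; have [] := stp n; have [] := inv n.
have [] := loc x y (proj1 (Hx 0)) (proj2 (Hx 0)) (proj1 (Hy 0)) (proj2 (Hy 0)).
move=> del d0' Hdel.
have Lab n : sb n - sa n = (b0 - a0) * 2^-1 ^+ n.
  elim: n => [|n IH]; first by rewrite mulr1.
  by have [_ _ _ _ [-> _]] := stp n; rewrite IH exprSr mulrA.
have Lcd n : sd n - sc n = (d0 - c0) * 2^-1 ^+ n.
  elim: n => [|n IH]; first by rewrite mulr1.
  by have [_ _ _ _ [_ ->]] := stp n; rewrite IH exprSr mulrA.
have h0 : 0 <= 2^-1 :> R by rewrite invr_ge0.
have h1 : 2^-1 < 1 :> R by rewrite invf_lt1// ltr1n.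
have del20 : 0 < del / 2 by rewrite divr_gt0.
have [N1 _ HN1] := expr_small (b0 - a0) h0 h1 del20.
have [N2 _ HN2] := expr_small (d0 - c0) h0 h1 del20.
have [_ _] := inv (N1 + N2)%N; apply.
have lt2 : del / 2 < del by lra.
have [? ?] := Hx (N1 + N2)%N; have [? ?] := Hy (N1 + N2)%N.
apply: Hdel => //; apply: le_lt_trans lt2.
  by rewrite Lab; apply: HN1; exact: leq_addr.
by rewrite Lcd; apply: HN2; exact: leq_addl.
Qed.

Lemma nrm_corner (x y p q a b c d : R) : a <= x -> x <= b -> c <= y -> y <= d ->
  a <= p -> p <= b -> c <= q -> q <= d ->
  nrm ((x +i* y) - (p +i* q)) <= (b - a) + (d - c).
Proof.
move=> *; apply: le_trans (nrm_le_ReIm _) _ => /=.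
by apply: lerD; rewrite ler_norml; apply/andP; split; lra.
Qed.

Lemma continuous_affine (k l : C) : continuous (fun z : C => k + l * z).
Proof.
move=> z; exact: cvgcD (cvgc_cst k) (cvgcM (cvgc_cst l) (@cvg_id _ (nbhs z))).
Qed.

(** The bound 4 e L^2, with L the sum of the two side lengths, is shared equally among the four
    quarters. Around a point it holds because affine functions have zero integral, and what is left
    of [f] after subtracting its affine approximation is at most e L. *)
Lemma goursat f a b c d : continuous f -> a <= b -> c <= d ->
  (forall x y, a <= x -> x <= b -> c <= y -> y <= d -> derivable f (x +i* y) 1) ->
  rect f a b c d = 0.
Proof.
move=> cf ab cd df; apply/eqP; rewrite -nrm_eq0; apply/eqP/le_anti.
rewrite nrm_ge0 andbT; apply/ler_addgt0Pr => eps eps0; rewrite add0r.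
set L0 := (b - a) + (d - c).
have L00 : 0 <= L0 by rewrite /L0; lra.
have K0 : 0 < 4 * L0 ^+ 2 + 1 by rewrite ltr_wpDl// mulr_ge0// sqr_ge0.
pose e := eps / (4 * L0 ^+ 2 + 1).
have e0 : 0 < e by rewrite divr_gt0.
apply: (@le_trans _ _ (4 * e * L0 ^+ 2)); last first.
  rewrite -mulrA mulrCA /e mulrAC ler_pdivrMr//.
  by rewrite ler_wpM2l ?(ltW eps0)//; lra.
rewrite /L0; pose P a b c d := nrm (rect f a b c d) <= 4 * e * (b - a + (d - c)) ^+ 2.
rewrite -/(P a b c d); apply: (@rect_bisection P a b c d) => //.
  move=> a' b' c' d' ab' cd'; rewrite /P.
  set m := (a' + b') / 2; set k := (c' + d') / 2 => P1 P2 P3 P4.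
  have [am mb] : a' <= m /\ m <= b' := mid_le ab'.
  have [ck kd] : c' <= k /\ k <= d' := mid_le cd'.
  rewrite (rect_cat_x _ _ cf am mb) !(rect_cat_y _ _ cf ck kd).
  have E1 : m - a' = (b' - a') / 2 by rewrite /m; field.
  have E2 : b' - m = (b' - a') / 2 by rewrite /m; field.
  have E3 : k - c' = (d' - c') / 2 by rewrite /k; field.
  have E4 : d' - k = (d' - c') / 2 by rewrite /k; field.
  rewrite E1 E3 in P1; rewrite E2 E3 in P2; rewrite E1 E4 in P3; rewrite E2 E4 in P4.
  have E5 : 4 * e * (b' - a' + (d' - c')) ^+ 2 =
    (4 * e * ((b' - a') / 2 + (d' - c') / 2) ^+ 2) *+ (2 + 2) by field.
  rewrite E5; apply: le_trans (nrmD _ _) _.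
  rewrite mulrnDr mulr2n; apply: lerD.
    exact: le_trans (nrmD _ _) (lerD P1 P3).
  exact: le_trans (nrmD _ _) (lerD P2 P4).
move=> x y ax xb cy yd.
have [l Hl] := (derivable_nrmP _ _).1 (df _ _ ax xb cy yd).
have [del del0 Hdel] := Hl _ e0.
exists (del / 2); first by rewrite divr_gt0.
move=> a' b' c' d' ax' xb' cy' yd' abd cdd; rewrite /P.
set p := x +i* y in Hdel *; set L := b' - a' + (d' - c').
have ab' := le_trans ax' xb'; have cd' := le_trans cy' yd'.
pose h z := f z + (- (f p - l * p) + (- l) * z).
have ch : continuous h.
  exact: (@contcD R _ f _ cf (@continuous_affine (- (f p - l * p)) (- l))).
have -> : rect f a' b' c' d' = rect h a' b' c' d'.
  rewrite rectD; [|exact: cont_sides|by apply: cont_sides; exact: continuous_affine].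
  by rewrite rect_affine// addr0.
have L0' : 0 <= L by rewrite /L; lra.
have Hh x' y' : a' <= x' -> x' <= b' -> c' <= y' -> y' <= d' ->
    nrm (h (x' +i* y')) <= e * L.
  move=> ? ? ? ?; set z := x' +i* y'.
  have zp : nrm (z - p) <= L by exact: nrm_corner.
  have := Hdel (z - p); rewrite [p + _]addrC subrK.
  have -> : f z - f p - l * (z - p) = h z by rewrite /h; ring.
  move=> /(_ _)/le_trans; apply; first by rewrite (le_lt_trans zp)// /L; lra.
  by rewrite ler_wpM2l// ltW.
have := rect_bound (cont_sides a' b' c' d' ch) ab' cd' (M := e * L).
have -> : 4 * e * L ^+ 2 = 4 * (e * L) * L by ring.
by apply=> t ? ?; apply: Hh.
Qed.

(** Only a small square around the exceptional point escapes [goursat]; since [f] is bounded there,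
    its integral is as small as desired. *)
Lemma goursat_punctured f a b c d p q : continuous f ->
  a < p -> p < b -> c < q -> q < d ->
  (forall x y, a <= x -> x <= b -> c <= y -> y <= d -> x +i* y != p +i* q ->
     derivable f (x +i* y) 1) ->
  rect f a b c d = 0.
Proof.
move=> cf ap pb cq qd df; apply/eqP; rewrite -nrm_eq0; apply/eqP/le_anti.
rewrite nrm_ge0 andbT; apply/ler_addgt0Pr => eps eps0; rewrite add0r.
have [del del0 Hdel] : exists2 del, 0 < del & forall w, nrm (w - (p +i* q)) < del ->
    nrm (f w - f (p +i* q)) <= 1.
  by apply/nbhs_nrmP; move/cvgcP : (cf (p +i* q)) => /(_ _ ltr01).
set M := nrm (f (p +i* q)) + 1.
have M0 : 0 < M by rewrite ltr_wpDl// nrm_ge0.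
(* [t] is the half-side of the small square: it must fit inside the rectangle, stay where [f] is
   bounded by [M] (4t < del), and give an integral of at most 16 M t <= eps. *)
pose t := Num.min (Num.min (Num.min (p - a) (b - p)) (Num.min (q - c) (d - q)))
            (Num.min (del / 5) (eps / (16 * M))).
have [t0 t1 t2 t3] : [/\ 0 < t, t <= p - a, t <= b - p & t <= q - c].
  split; rewrite /t ?lt_min ?ge_min ?lexx ?orbT ?subr_gt0 ?ap ?pb ?cq ?qd//.
  by rewrite !divr_gt0// mulr_gt0.
have [t4 t5 t6] : [/\ t <= d - q, t <= del / 5 & t <= eps / (16 * M)].
  by split; rewrite /t !ge_min ?lexx ?orbT.
have zero a' b' c' d' : a <= a' -> b' <= b -> c <= c' -> d' <= d -> a' <= b' ->
    c' <= d' -> (a' <= p -> p <= b' -> c' <= q -> q <= d' -> False) ->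
    rect f a' b' c' d' = 0.
  move=> aa bb cc dd ab' cd' H; apply: goursat => // x y ax xb cy yd.
  apply: df; [exact: le_trans ax|exact: le_trans bb|exact: le_trans cy|
    exact: le_trans dd|].
  apply/eqP => -[xp yq]; move: ax xb cy yd; rewrite xp yq; exact: H.
have le1 : a <= p - t by lra.
have le2 : p - t <= p + t by lra.
have le3 : p + t <= b by lra.
have le4 : c <= q - t by lra.
have le5 : q - t <= q + t by lra.
have le6 : q + t <= d by lra.
rewrite (@rect_cat_x _ f a (p - t) b)//; last lra.
rewrite (@rect_cat_x _ f (p - t) (p + t) b)//.
rewrite (@rect_cat_y _ f (p - t) (p + t) c (q - t) d)//; last lra.
rewrite (@rect_cat_y _ f (p - t) (p + t) (q - t) (q + t) d)//.
rewrite (zero a (p - t))//; try lra.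
rewrite (zero (p + t) b)//; try lra.
rewrite (zero _ _ c (q - t))//; try lra.
rewrite (zero _ _ (q + t) d)//; try lra.
rewrite !add0r !addr0.
have Hf x y : p - t <= x -> x <= p + t -> q - t <= y -> y <= q + t ->
    nrm (f (x +i* y)) <= M.
  move=> ? ? ? ?; have := Hdel (x +i* y).
  have : nrm ((x +i* y) - (p +i* q)) <= (p + t) - (p - t) + ((q + t) - (q - t)).
    by apply: nrm_corner => //; rewrite ?lerBlDr ?lerDl ?ltW// ler_wpDr// ltW.
  move=> /le_lt_trans H /(_ (H _ _)) H'.
  have := nrmD (f (x +i* y) - f (p +i* q)) (f (p +i* q)); rewrite subrK.
  move/le_trans; apply; rewrite addrC lerD2l; apply: H'.
  by rewrite (_ : _ + _ = 4 * t); [move: del0 t5; clear; lra|ring].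
have := rect_bound (cont_sides (p - t) (p + t) (q - t) (q + t) cf) le2 le5 (M := M).
have tM : t * (16 * M) <= eps by rewrite -ler_pdivlMr// mulr_gt0.
have -> : 4 * M * (p + t - (p - t) + (q + t - (q - t))) = t * (16 * M) by ring.
by move=> /(_ _ _ _ _)/le_trans; apply => // x ? ?; apply: Hf.
Qed.

End Goursat.

(** * Power series expansion of holomorphic functions *)

Section Analyticity.
Context {R : realType}.
Local Notation C := R[i].
Implicit Types (f g F : C -> C) (r : R) (w z : C).

Lemma derivable_cont f z : derivable f z 1 -> {for z, continuous f}.
Proof.
move=> /derivable_nrmP[l /(_ 1 ltr01)[del del0 H]]; apply/continuous_nrmP => e e0.
have K0 : 0 < nrm l + 1 by rewrite ltr_wpDl// nrm_ge0.
exists (Num.min del (e / (nrm l + 1))).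
  by rewrite lt_min del0 divr_gt0.
move=> w; rewrite lt_min => /andP[/H]; rewrite [z + _]addrC subrK mul1r => H1 H2.
have := nrmD (f w - f z - l * (w - z)) (l * (w - z)); rewrite subrK nrmM.
move/le_trans; apply; move: H2; rewrite ltr_pdivlMr// => /ltW; apply: le_trans.
apply: le_trans (lerD H1 (lexx _)) _.
by rewrite [leRHS]mulrDr mulr1 [nrm l * _]mulrC [leRHS]addrC.
Qed.

(** With [l] the derivative of [f] at [w], this removes the singularity of the difference quotient:
    it is then continuous at [w], though not yet known to be differentiable there. *)
Definition quo f l w z : C := if z == w then l else (z - w)^-1 * (f z - f w).

Lemma cvg_inv_sub z w : z != w -> {for z, continuous (fun z => (z - w)^-1)}.
Proof.
move=> zw; have zw0 : z - w != 0 by rewrite subr_eq0.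
apply: (@cvgV C C (nbhs z) _ (fun z => z - w) _ zw0).
exact: cvgcB (@cvg_id _ (nbhs z)) (cvgc_cst w).
Qed.

Lemma cvg_quo_neq f l w z : z != w -> {for z, continuous f} ->
  {for z, continuous (quo f l w)}.
Proof.
move=> zw cf.
have H : {for z, continuous (fun z => (z - w)^-1 * (f z - f w))}.
  exact: cvgcM (cvg_inv_sub zw) (cvgcB cf (cvgc_cst (f w))).
apply/continuous_nrmP => e e0; rewrite {2}/quo (negbTE zw).
move/continuous_nrmP : H => /(_ _ e0)[del del0 H].
exists (Num.min del (nrm (z - w))).
  by rewrite lt_min del0 nrm_gt0 subr_eq0.
move=> u; rewrite lt_min => /andP[/H Hu uz]; rewrite /quo; case: eqP => // uw.
by move: uz; rewrite uw nrmBC ltxx.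
Qed.

Lemma derivable_quo f l w z : z != w -> derivable f z 1 ->
  derivable (quo f l w) z 1.
Proof.
move=> zw /derivable_nrmP[d Hd]; apply/derivable_nrmP.
set D := nrm (z - w); have D0 : 0 < D by rewrite nrm_gt0 subr_eq0.
set k := quo f l w z.
have zw0 : z - w != 0 by rewrite subr_eq0.
exists ((d - k) / (z - w)) => e e0.
have eD0 : 0 < e * D / 4 by rewrite divr_gt0// mulr_gt0.
have [del del0 Hdel] := Hd _ eD0.
have K0 : 0 < 4 * nrm (d - k) + 1 by rewrite ltr_wpDl// mulr_ge0// nrm_ge0.
(* |h| < D / 2 keeps z + h at distance at least D / 2 from [w]; the other two bounds make each of
   the two error terms below at most e |h| / 2. *)
exists (Num.min (Num.min del (D / 2)) (e * D ^+ 2 / (4 * nrm (d - k) + 1))).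
  by rewrite !lt_min del0 !divr_gt0// mulr_gt0// exprn_gt0.
move=> h; rewrite !lt_min => /andP[/andP[/Hdel hd hD] hK].
have hw : D / 2 <= nrm (z + h - w).
  have := nrmD (z + h - w) (- h); rewrite nrmN.
  rewrite (_ : z + h - w - h = z - w) -/D; first lra.
  by ring.
have zhw0 : z + h - w != 0.
  by rewrite -nrm_gt0; apply: lt_le_trans hw; rewrite divr_gt0.
have zhw : z + h != w by rewrite -subr_eq0.
have -> : quo f l w (z + h) - k - (d - k) / (z - w) * h =
    (f (z + h) - f z - d * h) / (z + h - w) -
    (d - k) * h * h / ((z + h - w) * (z - w)).
  rewrite /k /quo (negbTE zw) (negbTE zhw); field.
  by rewrite zw0 zhw0.
rewrite (le_trans (nrmD _ _))// nrmN (_ : e * nrm h = e * nrm h / 2 + e * nrm h / 2);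
  last by field.
have i0 : 0 < nrm (z + h - w) by rewrite nrm_gt0.
apply: lerD.
  rewrite nrmM nrmV ler_pdivrMr//; apply: le_trans hd _.
  rewrite (_ : e * D / 4 * nrm h = e * nrm h / 2 * (D / 2)); last by field.
  by rewrite ler_wpM2l// divr_ge0// mulr_ge0 ?nrm_ge0// ltW.
rewrite nrmM nrmV !nrmM -/D ler_pdivrMr ?mulr_gt0//.
apply: (@le_trans _ _ (e * nrm h / 2 * (D / 2 * D))); last first.
  rewrite ler_wpM2l// ?ler_wpM2r// ?(ltW D0)//.
  by rewrite divr_ge0// mulr_ge0 ?nrm_ge0// ltW.
rewrite (_ : e * nrm h / 2 * (D / 2 * D) = nrm h * (e * D ^+ 2 / 4)); last by field.
rewrite mulrC ler_wpM2l ?nrm_ge0//.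
move: hK; rewrite ltr_pdivlMr// => /ltW; rewrite mulrDr mulr1.
by have := nrm_ge0 h; lra.
Qed.

(** The boundary of the square of half-side [r], and even the lines carrying it, avoid the open disc
    of radius [r]; this is why hypotheses on [r <= nrm z] suffice here and below. *)
Lemma rect_eq_sq f g r : 0 < r -> (forall z, r <= nrm z -> f z = g z) ->
  rect f (- r) r (- r) r = rect g (- r) r (- r) r.
Proof.
move=> r0 fg.
have H (x y : R) : `|y| = r -> f (x +i* y) = g (x +i* y).
  by move=> yr; apply: fg; rewrite -yr -[y]/(complex.Im (x +i* y)) Im_le_nrm.
have V (x y : R) : `|x| = r -> f (x +i* y) = g (x +i* y).
  by move=> xr; apply: fg; rewrite -xr -[x]/(complex.Re (x +i* y)) Re_le_nrm.
have r1 : `|r| = r by rewrite gtr0_norm.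
have r2 : `|- r| = r by rewrite normrN.
rewrite /rect; congr (cint _ _ _ + _ * cint _ _ _); apply/funext => x.
  by rewrite !H.
by rewrite !V.
Qed.

Lemma sides_cont_sq f r : 0 < r -> (forall z, r <= nrm z -> {for z, continuous f}) ->
  sides_cont f (- r) r (- r) r.
Proof.
move=> r0 cf.
have r1 : `|r| = r by rewrite gtr0_norm.
have r2 : `|- r| = r by rewrite normrN.
have H (k : R) : `|k| = r -> continuous (fun x : R => f (x +i* k)).
  move=> kr x; apply: (@continuous_comp _ _ _ (fun x : R => x +i* k) f).
    apply: cvgc_ReIm; [exact: cvg_id|exact: cvg_cst].
  by apply: cf; rewrite -kr -[k in `|k|]/(complex.Im (x +i* k)) Im_le_nrm.
have V (k : R) : `|k| = r -> continuous (fun y : R => f (k +i* y)).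
  move=> kr x; apply: (@continuous_comp _ _ _ (fun y : R => k +i* y) f).
    apply: cvgc_ReIm; [exact: cvg_cst|exact: cvg_id].
  by apply: cf; rewrite -kr -[k in `|k|]/(complex.Re (k +i* x)) Re_le_nrm.
by split; [exact: H|exact: H|exact: V|exact: V].
Qed.

Lemma sides_contD f g a b c d : sides_cont f a b c d -> sides_cont g a b c d ->
  sides_cont (fun z => f z + g z) a b c d.
Proof.
move=> [f1 f2 f3 f4] [g1 g2 g3 g4].
by split; [exact: (contcD f1 g1)|exact: (contcD f2 g2)|exact: (contcD f3 g3)|
  exact: (contcD f4 g4)].
Qed.

Lemma sides_contZ k f a b c d : sides_cont f a b c d ->
  sides_cont (fun z => k * f z) a b c d.
Proof.
move=> [f1 f2 f3 f4]; have H (u : R -> C) : continuous u -> continuous (fun x => k * u x).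
  move=> cu x; exact: cvgcM (cvgc_cst k) (cu x).
by split; [exact: H f1|exact: H f2|exact: H f3|exact: H f4].
Qed.

Lemma rect_bound_sq f r M : 0 < r -> (forall z, r <= nrm z -> {for z, continuous f}) ->
  (forall z, r <= nrm z -> nrm z <= 2 * r -> nrm (f z) <= M) ->
  nrm (rect f (- r) r (- r) r) <= 16 * M * r.
Proof.
move=> r0 cf fM.
have B (x y : R) : `|x| <= r -> `|y| <= r -> (`|x| == r) || (`|y| == r) ->
    nrm (f (x +i* y)) <= M.
  move=> xr yr xy; apply: fM.
    by case/orP: xy => /eqP <-; [exact: (Re_le_nrm (x +i* y))|
      exact: (Im_le_nrm (x +i* y))].
  by apply: le_trans (nrm_le_ReIm _) _ => /=; lra.
have r1 : `|r| = r by rewrite gtr0_norm.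
have r2 : `|- r| = r by rewrite normrN.
have rr : - r <= r by lra.
have := rect_bound (sides_cont_sq r0 cf) rr rr (M := M).
have -> : 4 * M * (r - - r + (r - - r)) = 16 * M * r by ring.
by apply=> x x1 x2; apply: B; rewrite ?r1 ?r2 ?eqxx ?orbT// ler_norml x1.
Qed.

Lemma cvg_zpow k z : z != 0 -> {for z, continuous (fun z => z ^- k)}.
Proof.
move=> z0; elim: k => [|k IH].
  have -> : (fun z : C => z ^- 0) = fun=> 1 by apply/funext => u; rewrite expr0 invr1.
  exact: (@cvgc_cst R C (nbhs z) (nbhs_filter z) 1).
have -> : (fun z : C => z ^- k.+1) = fun u : C => (u - 0)^-1 * u ^- k.
  by apply/funext => u; rewrite exprS invfM subr0.
exact: cvgcM (cvg_inv_sub z0) IH.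
Qed.

(** The denominator, normalised to constant term 1, is inverted by [abs_le_inv]. This serves both
    for Cauchy's formula and for expanding 1 / F in Pringsheim's theorem. *)
Lemma psum_quotient f k k' rho M N : 0 < rho -> abs_le k rho M ->
  abs_le k' rho N -> k' 0%N != 0 ->
  (forall w, nrm w < rho -> psum k w = f w * psum k' w) ->
  exists r c, [/\ 0 < r, exists B, abs_le c r B &
    forall w, nrm w < r -> f w = psum c w].
Proof.
move=> rho0 kM k'N k0 H; pose q j := (k' 0%N)^-1 * k' j.
have k00 : 0 < nrm (k' 0%N) by rewrite nrm_gt0.
have scale (c : nat -> C) B : abs_le c rho B ->
    abs_le (fun j => (k' 0%N)^-1 * c j) rho ((nrm (k' 0%N))^-1 * B).
  move=> cB n; apply: le_trans (ler_wpM2l _ (cB n)); last by rewrite invr_ge0 ltW.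
  by rewrite mulr_sumr; apply: ler_sum => j _; rewrite nrmM nrmV mulrA.
have qM := scale _ _ k'N; rewrite -/q in qM.
have q0 : q 0%N = 1 by rewrite /q mulVf.
have [e He] := conv_inv_ex q0.
have eM := abs_le_inv rho0 qM q0 He.
set s := rho / _ in eM; set Q := (nrm _)^-1 * N in s eM qM.
have Q1 : 1 <= Q.
  by have := abs_le_term 0 (ltW rho0) qM; rewrite q0 nrm1 expr0 mulr1.
have s0 : 0 < s by rewrite divr_gt0//; lra.
have sr : s <= rho by rewrite ler_pdivrMr; [rewrite ler_peMr// ?(ltW rho0)//; lra|lra].
have AM := abs_leW (ltW s0) sr (scale _ _ kM).
have qs := abs_leW (ltW s0) sr qM.
exists s, (conv (fun j => (k' 0%N)^-1 * k j) e); split => //.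
  by eexists; exact: abs_le_conv (ltW s0) AM eM.
move=> w ws; rewrite (psumM s0 AM eM ws).
have wr : nrm w < rho := lt_le_trans ws sr.
rewrite (psumZ _ rho0 kM (ltW wr)) H// mulrCA -mulrA.
rewrite [X in _ = _ * X](_ : _ = psum q w * psum e w); last first.
  by rewrite /q (psumZ _ rho0 k'N (ltW wr)).
rewrite -(psumM s0 qs eM ws) (@psum_fin _ _ _ 1).
  by rewrite /ps big_nat1 He expr0 !mulr1.
by move=> [|j] // _; rewrite He.
Qed.

(** The integral plays the role of 2 pi i. Both pairs of sides contribute i times the integral of 2r
    / (x^2 + r^2), which is positive because the integrand is at least 1 / r. *)
Lemma kappa0_neq0 r : 0 < r -> rect (fun z => z^-1) (- r) r (- r) r != 0.
Proof.
move=> r0.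
have cinv : continuous (fun x : R => 2 * r / (x ^+ 2 + r ^+ 2)).
  move=> x; apply: cvgMr; apply: cvgV.
    by rewrite gt_eqF// ltr_wpDl ?sqr_ge0// exprn_gt0.
  by apply: cvgD; [apply: exprn_continuous|exact: cvg_cst].
have rr : - r <= r by lra.
have I : 0 < rint (fun x : R => 2 * r / (x ^+ 2 + r ^+ 2)) (- r) r.
  apply: lt_le_trans (_ : 0 < rint (fun=> r^-1) (- r) r) _.
    by rewrite rint_cst// mulr_gt0 ?invr_gt0//; lra.
  apply: rint_le; [exact: cst_continuous|exact: cinv|move=> x x1 x2].
  rewrite ler_pdivlMr; last first.
    by rewrite ltr_wpDl ?sqr_ge0// exprn_gt0.
  rewrite mulrC ler_pdivrMr//; nra.
apply/eqP => /(congr1 (@complex.Im R)); rewrite /rect.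
have sq x : x ^+ 2 + r ^+ 2 != 0 by rewrite gt_eqF// ltr_wpDl ?sqr_ge0// exprn_gt0.
have E1 (x : R) : (x +i* (- r))^-1 - (x +i* r)^-1 =
    0 +i* (2 * r / (x ^+ 2 + r ^+ 2)).
  apply/eqP; rewrite eq_complex/=; apply/andP; split; apply/eqP.
    by rewrite sqrrN subrr.
  by rewrite sqrrN; field.
have E2 (x : R) : (r +i* x)^-1 - ((- r) +i* x)^-1 =
    (2 * r / (x ^+ 2 + r ^+ 2)) +i* 0.
  have sq' : r ^+ 2 + x ^+ 2 != 0 by rewrite addrC.
  apply/eqP; rewrite eq_complex/=; apply/andP; split; apply/eqP.
    by rewrite sqrrN; field; rewrite ?sq ?sq'.
  by rewrite sqrrN subrr.
under [X in cint X]eq_fun do rewrite E1.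
under [X in _ * cint X _ _]eq_fun do rewrite E2.
set u := (fun x => 2 * r / (x ^+ 2 + r ^+ 2)) in I *.
have -> : cint (fun x => 0 +i* u x) (- r) r = 0 +i* rint u (- r) r.
  by congr (_ +i* _); rewrite [LHS](rint_cst 0 rr) mul0r.
have -> : cint (fun x => u x +i* 0) (- r) r = rint u (- r) r +i* 0.
  by congr (_ +i* _); rewrite [LHS](rint_cst 0 rr) mul0r.
by rewrite /= mul0r mul1r add0r => H; lra.
Qed.

(** Composing with this 1-Lipschitz map in both coordinates extends a function from a square to a
    continuous function on the whole plane, as the integration lemmas require. *)
Let clamp (s t : R) : R := Num.max (- s) (Num.min s t).

Let clamp_id s t : `|t| <= s -> clamp s t = t.
Proof.
rewrite ler_norml => /andP[t1 t2].
by rewrite /clamp (min_idPr t2) (max_idPr t1).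
Qed.

Let clamp_norm s t : 0 <= s -> `|clamp s t| <= s.
Proof.
move=> s0; rewrite ler_norml /clamp le_max lexx/= ge_max ge_min lexx/= andbT.
by rewrite ge0_cp.
Qed.

Let clamp_dist s t u : `|clamp s t - clamp s u| <= `|t - u|.
Proof.
have Hmin (x y : R) : `|Num.min s x - Num.min s y| <= `|x - y|.
  have := ler_norm (x - y); have := ler_norm (- (x - y)); rewrite normrN.
  by case: (leP s x) => ?; case: (leP s y) => ? *; rewrite ler_norml;
    apply/andP; split; lra.
have Hmax (x y : R) : `|Num.max (- s) x - Num.max (- s) y| <= `|x - y|.
  have := ler_norm (x - y); have := ler_norm (- (x - y)); rewrite normrN.
  by case: (leP (- s) x) => ?; case: (leP (- s) y) => ? *; rewrite ler_norml;
    apply/andP; split; lra.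
exact: le_trans (Hmax _ _) (Hmin _ _).
Qed.

(** Expanding in powers of w / z the vanishing integral of (f(z) - f(w)) / (z - w) yields sum A_j
    w^j = f(w) sum K_j w^j, where A_j and K_j are the integrals of f(z) z^(-j-1) and z^(-j-1). As
    K_0 is nonzero, [f] is a quotient of two power series. *)
Lemma holomorphic_psum F (a : R) : 0 < a ->
  (forall z, `|complex.Im z| < a -> derivable F z 1) ->
  exists r c, [/\ 0 < r, exists B, abs_le c r B &
    forall w, nrm w < r -> F w = psum c w].
Proof.
move=> a0 dF; pose s := a / 2; have s0 : 0 < s by rewrite divr_gt0.
have sa : s < a by rewrite /s; lra.
pose cl z : C := clamp s (complex.Re z) +i* clamp s (complex.Im z).
pose f z := F (cl z).
have cl_id z : `|complex.Re z| <= s -> `|complex.Im z| <= s -> cl z = z.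
  by move=> h1 h2; rewrite /cl !clamp_id//; case: z {h1 h2}.
have cl_nrm z : nrm z <= s -> cl z = z.
  move=> zs; apply: cl_id; first exact: le_trans (Re_le_nrm _) zs.
  exact: le_trans (Im_le_nrm _) zs.
have cl_dist z w : nrm (cl z - cl w) <= 2 * nrm (z - w).
  apply: le_trans (nrm_le_ReIm _) _; rewrite mulr2n mulrDl mul1r.
  apply: lerD; apply: le_trans (clamp_dist _ _ _) _.
    by apply: le_trans (Re_le_nrm (z - w)); case: z w => [? ?] [? ?].
  by apply: le_trans (Im_le_nrm (z - w)); case: z w => [? ?] [? ?].
have cf z : {for z, continuous f}.
  apply/continuous_nrmP => e e0.
  have /derivable_cont/continuous_nrmP/(_ _ e0)[del del0 H] : derivable F (cl z) 1.
    by apply: dF; rewrite (le_lt_trans _ sa)// clamp_norm// ltW.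
  exists (del / 2); first by rewrite divr_gt0.
  by move=> w wz; apply: H; apply: le_lt_trans (cl_dist _ _) _; lra.
have df z : `|complex.Re z| < s -> `|complex.Im z| < s -> derivable f z 1.
  move=> z1 z2; apply/derivable_nrmP.
  have /derivable_nrmP[l Hl] : derivable F z 1 by apply: dF; exact: lt_trans sa.
  exists l => e e0; have [del del0 H] := Hl _ e0.
  exists (Num.min del (Num.min (s - `|complex.Re z|) (s - `|complex.Im z|))).
    by rewrite !lt_min del0 !subr_gt0 z1 z2.
  move=> h; rewrite !lt_min => /andP[hd /andP[h1 h2]].
  have -> : f z = F z by rewrite /f cl_id// ltW.
  have -> : f (z + h) = F (z + h).
    rewrite /f cl_id//.
      have := ler_normD (complex.Re z) (complex.Re h); have := Re_le_nrm h.
      by case: z h h1 {hd h2 H Hl z1 z2} => [? ?] [? ?] /=; lra.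
    have := ler_normD (complex.Im z) (complex.Im h); have := Im_le_nrm h.
    by case: z h h2 {hd h1 H Hl z1 z2} => [? ?] [? ?] /=; lra.
  exact: H.
have [del del0 Hdel] := (continuous_nrmP f 0).1 (cf 0) 1 ltr01.
(* The corners of the square have norm at most 2r < del, so [M] bounds [f] on its boundary; r < s
   keeps the square where [f] is differentiable. *)
pose r := Num.min (del / 3) (s / 2).
have r0 : 0 < r by rewrite lt_min !divr_gt0.
have rd : r <= del / 3 by rewrite ge_min lexx.
have rs : r <= s / 2 by rewrite ge_min lexx orbT.
set M := nrm (f 0) + 1.
have M0 : 0 < M by rewrite ltr_wpDl// nrm_ge0.
have fM z : nrm z <= 2 * r -> nrm (f z) <= M.
  move=> zr; have := nrmD (f z - f 0) (f 0); rewrite subrK => /le_trans; apply.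
  by rewrite addrC lerD2l; apply: Hdel; rewrite subr0; lra.
have nz z : r <= nrm z -> z != 0 by rewrite -nrm_gt0; exact: lt_le_trans.
have npow j z : r <= nrm z -> nrm (z ^- j) <= r ^- j.
  move=> rz; rewrite nrmV nrmX lef_pV2 ?posrE ?exprn_gt0 ?nrm_gt0 ?nz//.
  by rewrite lerXn2r// ?nnegrE ?nrm_ge0// ltW.
pose A j := rect (fun z => z ^- j.+1 * f z) (- r) r (- r) r.
pose K j := rect (fun z => z ^- j.+1) (- r) r (- r) r.
have cpow j z : r <= nrm z -> {for z, continuous (fun z : C => z ^- j)}.
  by move=> rz; exact: cvg_zpow (nz _ rz).
have cpowf j z : r <= nrm z -> {for z, continuous (fun z : C => z ^- j * f z)}.
  by move=> rz; exact: cvgcM (cpow j z rz) (cf z).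
have bA j : nrm (A j) * r ^+ j <= 16 * M.
  have : nrm (A j) <= 16 * (r ^- j.+1 * M) * r.
    apply: (rect_bound_sq r0 (cpowf j.+1)).
    move=> z rz zr; rewrite nrmM ler_pM ?nrm_ge0//; first exact: npow.
    exact: fM.
  rewrite (_ : 16 * (r ^- j.+1 * M) * r = 16 * M / r ^+ j).
    by rewrite ler_pdivlMr// exprn_gt0.
  by rewrite exprS invfM; field; rewrite expf_neq0 gt_eqF.
have bK j : nrm (K j) * r ^+ j <= 16.
  have : nrm (K j) <= 16 * (r ^- j.+1) * r.
    apply: (rect_bound_sq r0 (cpow j.+1)).
    by move=> z rz zr; exact: npow.
  rewrite (_ : 16 * (r ^- j.+1) * r = 16 / r ^+ j).
    by rewrite ler_pdivlMr// exprn_gt0.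
  by rewrite exprS invfM; field; rewrite expf_neq0 gt_eqF.
have Ale := geo_abs_le r0 bA; have Kle := geo_abs_le r0 bK.
have r20 : 0 < r / 2 by rewrite divr_gt0.
have main w : nrm w < r / 2 -> psum A w = f w * psum K w.
  move=> wr.
  have wr' : nrm w < r by lra.
  have zw z : r <= nrm z -> z != w.
    by move=> rz; apply: contraTneq rz => ->; rewrite -ltNge.
  pose q z := (z - w)^-1 * (f z - f w).
  have cq z : r <= nrm z -> {for z, continuous q}.
    move=> rz; exact: cvgcM (cvg_inv_sub (zw _ rz)) (cvgcB (cf z) (@cvgc_cst R C (nbhs z) (nbhs_filter z) (f w))).
  have Rew := Re_le_nrm w; have Imw := Im_le_nrm w.
  have rq0 : rect q (- r) r (- r) r = 0.
    have /derivable_nrmP[l Hl] : derivable f w 1 by apply: df; lra.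
    rewrite (@rect_eq_sq q (quo f l w) r)//; last first.
      by move=> z rz; rewrite /quo (negbTE (zw _ rz)).
    have wE : complex.Re w +i* complex.Im w = w by case: (w).
    have [w1 w2] : - r < complex.Re w /\ complex.Re w < r.
      by apply/andP; rewrite -ltr_norml (le_lt_trans Rew).
    have [w3 w4] : - r < complex.Im w /\ complex.Im w < r.
      by apply/andP; rewrite -ltr_norml (le_lt_trans Imw).
    apply: (@goursat_punctured _ _ _ _ _ _ (complex.Re w) (complex.Im w));
      [|exact: w1|exact: w2|exact: w3|exact: w4|].
      move=> z; have [->|] := eqVneq z w; last by move/cvg_quo_neq; apply; exact: cf.
      apply/continuous_nrmP => e e0; have [del1 del10 H] := Hl _ e0.
      exists del1 => // u; rewrite {2}/quo eqxx /quo; case: eqP => [_ _|/eqP uw].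
        by rewrite subrr nrm0 ltW.
      move=> /H; rewrite [w + _]addrC subrK.
      have uw0 : u - w != 0 by rewrite subr_eq0.
      have -> : (u - w)^-1 * (f u - f w) - l = (f u - f w - l * (u - w)) / (u - w).
        by field.
      by rewrite nrmM nrmV ler_pdivrMr// nrm_gt0.
    move=> x y x1 x2 y1 y2; rewrite wE => zw'; apply: derivable_quo => //.
    have rs' : r < s by apply: le_lt_trans rs _; lra.
    by apply: df; rewrite /= (le_lt_trans _ rs')// ler_norml ?x1 ?y1.
  (* The remainder after [n] uses of 1 / (z - w) = 1 / z + (w / z) / (z - w). *)
  pose T n := rect (fun z => w ^+ n * (z ^- n * q z)) (- r) r (- r) r.
  have step n : 0 = ps A w n - f w * ps K w n + T n.
    elim: n => [|n IH].
      rewrite /ps !big_nil mulr0 subrr add0r -[LHS]rq0; apply: rect_eq_sq => // z _.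
      by rewrite expr0 mul1r invr1 mul1r.
    rewrite [LHS]IH /ps !big_nat_recr//= -/(ps A w n) -/(ps K w n).
    suff -> : T n = w ^+ n * (A n - f w * K n) + T n.+1 by ring.
    have sc1 : sides_cont (fun z => z ^- n.+1 * f z) (- r) r (- r) r.
      exact: sides_cont_sq r0 (cpowf n.+1).
    have sc2 : sides_cont (fun z : C => z ^- n.+1) (- r) r (- r) r.
      exact: sides_cont_sq r0 (cpow n.+1).
    have sc3 : sides_cont (fun z => - f w * z ^- n.+1) (- r) r (- r) r.
      apply: (sides_cont_sq r0) => z rz.
      exact: cvgcM (@cvgc_cst R C (nbhs z) (nbhs_filter z) (- f w)) (cpow _ _ rz).
    have sc4 : sides_cont (fun z => z ^- n.+1 * q z) (- r) r (- r) r.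
      by apply: (sides_cont_sq r0) => z rz; exact: cvgcM (cpow _ _ rz) (cq _ rz).
    have E1 : T n = rect (fun z => w ^+ n * (z ^- n.+1 * f z + - f w * z ^- n.+1) +
        w ^+ n.+1 * (z ^- n.+1 * q z)) (- r) r (- r) r.
      apply: rect_eq_sq => // z rz; rewrite /q.
      have z0 := nz _ rz; have zw0 : z - w != 0 by rewrite subr_eq0 zw.
      by rewrite !exprS; field; rewrite zw0 z0 expf_neq0.
    rewrite E1 (rectD (sides_contZ (w ^+ n) (sides_contD sc1 sc3))
      (sides_contZ (w ^+ n.+1) sc4)) (rectZ _ (sides_contD sc1 sc3)).
    by rewrite (rectD sc1 sc3) (rectZ (- f w) sc2) mulNr.
  have x0 : 0 <= 2^-1 :> R by rewrite invr_ge0.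
  have x1 : 2^-1 < 1 :> R by rewrite invf_lt1// ltr1n.
  (* On the boundary |w / z| <= 1/2, and |q| <= 2M / (r / 2) because |z - w| >= r / 2. *)
  have bT n : nrm (T n) <= 16 * (2^-1 ^+ n * (4 * M / r)) * r.
    apply: (rect_bound_sq r0).
      move=> z rz; exact: cvgcM (@cvgc_cst R C (nbhs z) (nbhs_filter z) (w ^+ n))
        (cvgcM (cpow _ _ rz) (cq _ rz)).
    move=> z rz zr; rewrite mulrA nrmM ler_pM ?nrm_ge0//.
      rewrite -exprVn -exprMn nrmX lerXn2r// ?nnegrE ?nrm_ge0// nrmM nrmV.
      rewrite ler_pdivrMr ?nrm_gt0 ?nz//; lra.
    rewrite /q nrmM nrmV.
    have zw2 : r / 2 <= nrm (z - w).
      by have := nrmD (z - w) w; rewrite subrK; lra.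
    have zw0 : 0 < nrm (z - w) by apply: lt_le_trans zw2.
    rewrite mulrC ler_pdivrMr//; apply: (@le_trans _ _ (4 * M / r * (r / 2))); last first.
      by rewrite ler_wpM2l// divr_ge0 ?(ltW r0)// mulr_ge0// ltW.
    rewrite (_ : 4 * M / r * (r / 2) = M + M); last by field; rewrite gt_eqF.
    rewrite (le_trans (nrmD _ _))// nrmN lerD ?fM//.
    by apply: le_trans (ltW wr') _; lra.
  have wr2 : nrm w <= r / 2 by exact: ltW.
  have L1 : (fun n => ps A w n - f w * ps K w n) @ \oo --> psum A w - f w * psum K w.
    exact: cvgcB (psum_cvg r20 Ale wr2) (cvgcM (cvgc_cst _) (psum_cvg r20 Kle wr2)).
  have L2 : (fun n => ps A w n - f w * ps K w n) @ \oo --> (0 : C).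
    apply/cvgcP => e e0.
    apply: filterS (expr_small (16 * (4 * M / r) * r) x0 x1 e0) => n; apply: le_trans.
    rewrite subr0 -nrmN -[X in nrm X]sub0r {1}(step n) addrAC subrr add0r.
    by apply: le_trans (bT n) _; rewrite le_eqVlt; apply/orP; left; apply/eqP; ring.
  by apply/eqP; rewrite -subr_eq0; apply/eqP; exact: cvgc_unique L1 L2.
have K0 : K 0%N != 0.
  rewrite /K (@rect_eq_sq _ (fun z => z^-1))//; first exact: kappa0_neq0.
have [rho [c [rho0 cB fc]]] := psum_quotient r20 Ale Kle K0 main.
exists (Num.min rho s), c; split => //; first by rewrite lt_min rho0.
  by have [B cB'] := cB; exists B; apply: abs_leW cB';
    rewrite ?le_min ?(ltW rho0) ?(ltW s0) ?ge_min ?lexx.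
move=> w; rewrite lt_min => /andP[wr ws]; rewrite -fc// /f cl_nrm//.
exact: ltW.
Qed.

End Analyticity.

(** * Positive-definite functions and Taylor expansion *)

Arguments conjc : simpl never.

Section PositiveDefinite.
Context {R : realType}.
Local Notation C := R[i].
Implicit Types (f g : R -> C) (t u h : R).

Lemma pdP f : positive_definite f <-> forall (n : nat) (t : 'I_n -> R)
  (c : 'I_n -> C), 0 <= \sum_(j < n) \sum_(k < n) c j * conjc (c k) * f (t j - t k).
Proof. by []. Qed.

Lemma pd0 f : positive_definite f -> 0 <= f 0.
Proof.
move=> /pdP/(_ 1%N (fun=> 0) (fun=> 1)).
by rewrite !big_ord1 /= subrr conjc1 !mul1r.
Qed.

(** The form at the points [t] and 0 is real for the weights (1, 1) and (1, i); these two conditions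
    determine f(-t). *)
Lemma pd_herm f t : positive_definite f -> f (- t) = conjc (f t).
Proof.
move=> pf; have f0 := pd0 pf.
have H (l : C) : 0 <= f 0 + conjc l * f t + (l * f (- t) + l * conjc l * f 0).
  have := (pdP f).1 pf 2%N (fun i => if i == ord0 then t else 0)
    (fun i => if i == ord0 then 1 else l).
  rewrite !big_ord_recl !big_ord0 /= conjc1 !subrr subr0 sub0r.
  by rewrite !addr0 !mul1r mulr1.
have := H 1; have := H 'i%C; move: f0; rewrite !lecE.
case: (f 0) => a0 b0; case: (f t) => a b; case: (f (- t)) => a' b' /=.
rewrite /conjc /=.
move=> /andP[/eqP -> _] /andP[/eqP H1 _] /andP[/eqP H2 _].
by apply/eqP; rewrite eq_complex /=; apply/andP; split; apply/eqP; lra.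
Qed.

Lemma nrm_sqr (z : C) : z * conjc z = ((nrm z) ^+ 2)%:C.
Proof. by rewrite -sqr_normc normr_nrm rmorphXn. Qed.

(** Cauchy-Schwarz: adjoin the point 0 with weight -(s L), where [L] is the sum on the left. The
    form becomes a nonnegative polynomial in the real number [s], to be evaluated at the best
    [s]. *)
Lemma pd_CS f (n : nat) (t : 'I_n -> R) (c : 'I_n -> C) : positive_definite f ->
  nrm (\sum_(j < n) c j * f (t j)) ^+ 2 <= complex.Re (f 0) *
    complex.Re (\sum_(j < n) \sum_(k < n) c j * conjc (c k) * f (t j - t k)).
Proof.
move=> pf; set L := \sum_(j < n) c j * f (t j).
set Q := \sum_(j < n) \sum_(k < n) _.
have H (s : R) : 0 <= (s ^+ 2 * nrm L ^+ 2)%:C * f 0 -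
    (2 * s * nrm L ^+ 2)%:C + Q.
  have := (pdP f).1 pf n.+1 (fun i => if unlift ord0 i is Some j then t j else 0)
    (fun i => if unlift ord0 i is Some j then c j else - (s%:C * L)).
  rewrite big_ord_recl [X in X + _]big_ord_recl unlift_none subrr.
  under eq_bigr do rewrite liftK sub0r.
  under [X in _ + X]eq_bigr do rewrite big_ord_recl unlift_none liftK subr0.
  under [X in _ + X]eq_bigr do under eq_bigr do rewrite liftK.
  rewrite big_split/= -/Q.
  have -> : \sum_(i < n) - (s%:C * L) * conjc (c i) * f (- t i) = - (s%:C * L) * conjc L.
    have -> : conjc L = \sum_(i < n) conjc (c i * f (t i)) by rewrite /L rmorph_sum.
    rewrite [RHS]mulr_sumr; apply: eq_bigr => i _.
    by rewrite (pd_herm _ pf) -mulrA -rmorphM.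
  have -> : \sum_(i < n) c i * conjc (- (s%:C * L)) * f (t i) = - (s%:C * conjc L) * L.
    rewrite -[X in _ = _ * X]/(\sum_(j < n) c j * f (t j)) [RHS]mulr_sumr; apply: eq_bigr => i _.
    by rewrite -mulrA mulrCA rmorphN rmorphM /= conjc_real; ring.
  have LL := nrm_sqr L.
  rewrite rmorphN rmorphM /= conjc_real.
  have -> : (s ^+ 2 * nrm L ^+ 2)%:C = s%:C ^+ 2 * (L * conjc L).
    by rewrite LL -rmorphXn -rmorphM.
  have -> : (2 * s * nrm L ^+ 2)%:C = 2 * s%:C * (L * conjc L).
    by rewrite LL -(rmorph_nat (real_complex R)) -!rmorphM.
  by congr (0 <= _); ring.
have X0 : 0 <= nrm L ^+ 2 by rewrite sqr_ge0.
have := pd0 pf; rewrite lecE => /andP[_].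
have {}H s : 0 <= s ^+ 2 * nrm L ^+ 2 * complex.Re (f 0) - 2 * s * nrm L ^+ 2 +
    complex.Re Q.
  have := H s; rewrite lecE => /andP[_]; case: (f 0) => a b; case: (Q) => p q /=.
  by rewrite !mul0r subr0.
move: H; set X := nrm L ^+ 2 in X0 *; set a := complex.Re (f 0); set q := complex.Re Q.
move=> H; rewrite le_eqVlt => /predU1P[/= a0|/= a0].
  (* When f(0) = 0 the polynomial is affine in [s], which forces [L] to vanish. *)
  rewrite -a0 mul0r; have [//|X1] := leP X 0.
  have := H ((q + 1) / X); rewrite -a0 mulr0 add0r.
  by rewrite (_ : 2 * ((q + 1) / X) * X = 2 * (q + 1)); [have := H 0; rewrite -a0; lra|
     field; rewrite gt_eqF].
have := H a^-1.
have -> : a^-1 ^+ 2 * X * a - 2 * a^-1 * X + q = q - X / a by field; rewrite gt_eqF.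
by rewrite subr_ge0 ler_pdivrMr// mulrC.
Qed.

Lemma pd_le0 f t : positive_definite f -> nrm (f t) <= complex.Re (f 0).
Proof.
move=> pf; have := pd_CS (fun _ : 'I_1 => t) (fun=> 1) pf.
rewrite !big_ord1 /= subrr conjc1 !mul1r -expr2 ler_pXn2r ?nnegrE ?nrm_ge0//.
by have := pd0 pf; rewrite lecE => /andP[].
Qed.

(** Weights 1 and -1 in [pd_CS]. Increments anywhere are controlled by the behaviour at 0, so
    continuity or a Lipschitz bound at 0 propagates to the whole line. *)
Lemma pd_dist f t u : positive_definite f -> nrm (f t - f u) ^+ 2 <=
  2 * complex.Re (f 0) * complex.Re (f 0 - f (t - u)).
Proof.
move=> pf; have := pd_CS (fun i : 'I_2 => if i == ord0 then t else u)
  (fun i => if i == ord0 then 1 else -1) pf.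
rewrite !big_ord_recl !big_ord0 /= !addr0 !subrr conjc1 !mul1r mulN1r.
rewrite rmorphN/= conjc1 mulrNN !mulN1r !mulr1 !mul1r => /le_trans; apply.
rewrite -[u - t]opprB (pd_herm _ pf); case: (f 0) => a b; case: (f (t - u)) => p q /=.
lra.
Qed.

Lemma pd_cont f : positive_definite f -> {for 0, continuous f} -> continuous f.
Proof.
move=> pf f0 t.
have K0 : 0 < 2 * complex.Re (f 0) + 1.
  by have := pd0 pf; rewrite lecE => /andP[_]/=; lra.
apply/(@cvgcP R R (nbhs t) (nbhs_filter t)) => e e0.
have e1 : 0 < e ^+ 2 / (2 * complex.Re (f 0) + 1) by rewrite divr_gt0// exprn_gt0.
move/(@cvgcP R R (nbhs 0) (nbhs_filter 0)) : f0 => /(_ _ e1).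
move=> /nbhs_ballP[del /= del0 H]; apply/nbhs_ballP; exists del => // u.
rewrite /ball/= => tu; rewrite -(@ler_pXn2r _ 2) ?nnegrE ?nrm_ge0// ?(ltW e0)//.
apply: le_trans (pd_dist _ _ pf) _.
have := H (u - t); rewrite /ball/= sub0r opprB => /(_ tu) {}H.
have : complex.Re (f 0 - f (u - t)) <= e ^+ 2 / (2 * complex.Re (f 0) + 1).
  rewrite nrmBC in H; apply: le_trans H; apply: le_trans (Re_le_nrm _).
  exact: ler_norm.
rewrite ler_pdivlMr// => H2.
have : 0 <= complex.Re (f 0 - f (u - t)).
  have := pd_le0 (u - t) pf; have := Re_le_nrm (f (u - t)).
  have := ler_norm (complex.Re (f (u - t))).
  by case: (f 0) => a b; case: (f (u - t)) => p q /=; lra.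
by move: H2; nra.
Qed.

(** The form of this function is that of [f] itself with each point t_j doubled into t_j and t_j +
    h, with weights c_j and -c_j. *)
Lemma pd_diff2 f h : positive_definite f ->
  positive_definite (fun t => f t + f t - f (t + h) - f (t - h)).
Proof.
move=> pf; apply/pdP => n t c.
have := (pdP f).1 pf (n + n)%N (fun i => match fintype.split i with inl j => t j | inr j => t j + h end)
  (fun i => match fintype.split i with inl j => c j | inr j => - c j end).
have sl (i : 'I_n) : fintype.split (lshift n i) = inl i :> 'I_n + 'I_n by exact: (unsplitK (inl i)).
have sr (i : 'I_n) : fintype.split (rshift n i) = inr i :> 'I_n + 'I_n by exact: (unsplitK (inr i)).
rewrite big_split_ord/=.
under eq_bigr do rewrite big_split_ord/= sl.
under [X in _ + X]eq_bigr do rewrite big_split_ord/= sr.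
rewrite -big_split/=; congr (0 <= _); apply: eq_bigr => j _.
rewrite -!big_split/=; apply: eq_bigr => k _.
rewrite !sl !sr rmorphN/=.
have -> : t j - (t k + h) = t j - t k - h by ring.
have -> : t j + h - t k = t j - t k + h by ring.
have -> : t j + h - (t k + h) = t j - t k by ring.
by ring.
Qed.

Lemma pd_scale f (k : R) : 0 <= k -> positive_definite f ->
  positive_definite (fun t => k%:C * f t).
Proof.
move=> k0 pf; apply/pdP => n t c.
rewrite (_ : \sum_(j < n) _ = k%:C *
    \sum_(j < n) \sum_(l < n) c j * conjc (c l) * f (t j - t l)).
  by rewrite mulr_ge0// ?ler0c//; exact: (pdP f).1.
rewrite mulr_sumr; apply: eq_bigr => j _; rewrite mulr_sumr.
by apply: eq_bigr => l _; rewrite mulrCA.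
Qed.

Lemma pd_lim (T : Type) (F : set_system T) {FF : ProperFilter F}
    (f : T -> R -> C) (g : R -> C) : (forall n, positive_definite (f n)) ->
  (forall t, f n t @[n --> F] --> g t) -> positive_definite g.
Proof.
move=> pf fg; apply/pdP => n t c.
have L : (fun m => \sum_(j < n) \sum_(k < n) c j * conjc (c k) * f m (t j - t k)) @ F -->
    \sum_(j < n) \sum_(k < n) c j * conjc (c k) * g (t j - t k).
  apply: cvgc_sum => j; apply: cvgc_sum => k.
  exact: cvgcM (cvgc_cst _) (fg _).
have P m : 0 <= \sum_(j < n) \sum_(k < n) c j * conjc (c k) * f m (t j - t k).
  exact: (pdP (f m)).1.
rewrite lecE; apply/andP; split.
  apply/eqP; apply/le_anti/andP; split.
    apply: (cvg_le_ub (cvgc_Im L)); apply: nearW => m.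
    by have := P m; rewrite lecE => /andP[/eqP ->].
  apply: (cvg_ge_lb (cvgc_Im L)); apply: nearW => m.
  by have := P m; rewrite lecE => /andP[/eqP ->].
apply: (cvg_ge_lb (cvgc_Re L)); apply: nearW => m.
by have := P m; rewrite lecE => /andP[_].
Qed.

End PositiveDefinite.

(** * Limits along an ultrafilter, and convexity from second differences *)

Section Ultralimit.
Context {R : realType} (U : set_system nat) {UU : UltraFilter U}.
Context (oU : \oo `<=` U).
Local Notation C := R[i].

(** The image of [U] contains a compact segment, hence has a cluster point, and a cluster point of
    an ultrafilter is a limit. *)
Lemma ultra_cvg (x : nat -> R) K : (\forall n \near U, `|x n| <= K) ->
  exists l : R, x @ U --> l.
Proof.
move=> xK.
have HK : (x @ U) `[- K, K]%classic.
  by apply: filterS xK => n /=; rewrite in_itv/= ler_norml.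
have [l [_ cl]] := @segment_compact R (- K) K (x @ U) _ HK.
exists l => B lB; case: (in_ultra_setVsetC (x @^-1` B) UU) => // NB.
by have [y [h1 h2]] := cl (~` B) B NB lB.
Qed.

Definition ulim (x : nat -> C) : C :=
  lim ((fun n => complex.Re (x n)) @ U) +i* lim ((fun n => complex.Im (x n)) @ U).

Lemma ulim_eq (x : nat -> C) l : x @ U --> l -> ulim x = l.
Proof.
move=> H; rewrite /ulim (cvg_lim _ (cvgc_Re H))// (cvg_lim _ (cvgc_Im H))//.
by case: l H.
Qed.

Lemma ulim_cvg (x : nat -> C) K : (\forall n \near U, nrm (x n) <= K) ->
  x @ U --> ulim x.
Proof.
move=> xK.
have [a Ha] : exists l : R, (fun n => complex.Re (x n)) @ U --> l.
  by apply: (ultra_cvg (K := K)); apply: filterS xK => n; apply: le_trans;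
     exact: Re_le_nrm.
have [b Hb] : exists l : R, (fun n => complex.Im (x n)) @ U --> l.
  by apply: (ultra_cvg (K := K)); apply: filterS xK => n; apply: le_trans;
     exact: Im_le_nrm.
have H : x @ U --> a +i* b by exact: cvgc_ReIm Ha Hb.
by rewrite (ulim_eq H).
Qed.

(** The increments at which difference quotients are sampled, so that their limits are taken along
    [U] too. *)
Definition step (n : nat) : R := n.+1%:R^-1.

Local Notation h := step.

Lemma step_gt0 n : 0 < h n. Proof. by rewrite invr_gt0. Qed.

Lemma step_small (e : R) : 0 < e -> \forall n \near U, h n < e.
Proof.
move=> e0; apply: oU; have /cvgrPdist_lt/(_ _ e0) := @cvg_harmonic R.
by apply: filterS => n; rewrite sub0r normrN ger0_norm// ltW// step_gt0.
Qed.

Section Convexity.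
Implicit Types (phi : R -> R) (a b u w : R).

Definition diff2 phi u (n : nat) : R :=
  (phi (u + h n) + phi (u - h n) - 2 * phi u) * (h n) ^- 2.

(** If phi(w) > 0, adding e (u - a)(u - b) with a small e > 0 leaves half of that value at [w] and
    the boundary values nonpositive. At an interior maximum of the sum, the second differences of
    [phi] have a limit at most -2e, a contradiction. *)
Lemma maximum_principle phi a b w : continuous phi ->
  (forall u, a < u -> u < b -> exists2 l : R, 0 <= l & diff2 phi u @ U --> l) ->
  phi a <= 0 -> phi b <= 0 -> a <= w -> w <= b -> phi w <= 0.
Proof.
move=> cphi D2 pa pb aw wb; rewrite leNgt; apply/negP => pw.
have {}aw : a < w by rewrite lt_neqAle aw andbT; apply: contraTneq pw => <-;
  rewrite -leNgt.
have {}wb : w < b by rewrite lt_neqAle wb andbT; apply: contraTneq pw => ->;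
  rewrite -leNgt.
have ab : a < b by exact: lt_trans wb.
have P0 : 0 < (w - a) * (b - w) by rewrite mulr_gt0// subr_gt0.
pose e := phi w / (2 * ((w - a) * (b - w))).
have e0 : 0 < e by rewrite divr_gt0// mulr_gt0.
pose psi u := phi u + e * ((u - a) * (u - b)).
have cpsi : continuous psi.
  move=> u; apply: cvgD; first exact: cphi.
  by apply: cvgMr; apply: cvgM; apply: cvgB; (exact: cvg_id || exact: cvg_cst).
have psiw : 0 < psi w.
  rewrite (_ : psi w = phi w / 2); first by rewrite divr_gt0.
  by rewrite /psi /e; field; rewrite !subr_eq0 (gt_eqF aw) (gt_eqF wb).
have [m mab Hm] := EVT_max (ltW ab) (continuous_subspaceT cpsi).
have psim : 0 < psi m.
  by apply: lt_le_trans psiw _; apply: Hm; rewrite in_itv/= !ltW.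
move: mab; rewrite in_itv/= => /andP[am mb].
have {}am : a < m.
  rewrite lt_neqAle am andbT; apply: contraTneq psim => <-.
  by rewrite -leNgt /psi subrr mul0r mulr0 addr0.
have {}mb : m < b.
  rewrite lt_neqAle mb andbT; apply: contraTneq psim => ->.
  by rewrite -leNgt /psi subrr !mulr0 addr0.
have [l l0 Hl] := D2 _ am mb.
have : l <= - (2 * e).
  apply: (cvg_le_ub Hl).
  have d0 : 0 < Num.min (m - a) (b - m) by rewrite lt_min !subr_gt0 am mb.
  apply: filterS (step_small d0) => n; rewrite lt_min => /andP[h1 h2].
  have hn := step_gt0 n.
  rewrite /diff2 ler_pdivrMr ?exprn_gt0//.
  have := Hm (m + h n); have := Hm (m - h n); rewrite !in_itv/=.
  have -> : a <= m - h n <= b by apply/andP; split; lra.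
  have -> : a <= m + h n <= b by apply/andP; split; lra.
  move=> /(_ isT) H1 /(_ isT) H2; move: H1 H2; rewrite /psi.
  by clear; set x := phi (m - h n); set y := phi (m + h n); set z := phi m; nra.
by lra.
Qed.

Lemma chord_le phi a b w : continuous phi ->
  (forall u, exists2 l : R, 0 <= l & diff2 phi u @ U --> l) ->
  a < b -> a <= w -> w <= b ->
  phi w * (b - a) <= phi a * (b - w) + phi b * (w - a).
Proof.
move=> cphi D2 ab aw wb; have ba : 0 < b - a by rewrite subr_gt0.
pose k := (phi b - phi a) / (b - a).
pose psi u := phi u - (phi a + k * (u - a)).
have : psi w <= 0.
  apply: (@maximum_principle psi a b) => //.
  - move=> u; apply: cvgB; first exact: cphi.
    apply: cvgD; first exact: cvg_cst.
    by apply: cvgMr; apply: cvgB; (exact: cvg_id || exact: cvg_cst).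
  - move=> u _ _; have [l l0 Hl] := D2 u; exists l => //.
    rewrite (_ : diff2 psi u = diff2 phi u)//.
    by apply/funext => n; rewrite /diff2 /psi; congr (_ * _); ring.
  - by rewrite /psi subrr mulr0 addr0 subrr.
  - by rewrite /psi /k divfK ?gt_eqF//; lra.
rewrite /psi subr_le0 -(ler_pM2r ba) => /le_trans; apply.
by rewrite le_eqVlt; apply/orP; left; apply/eqP; rewrite /k; field; rewrite gt_eqF.
Qed.

(** For v > 0, the chords over [0, v] and [-h, h] bound the symmetric difference quotient at 0 by
    phi(v) / v. As that quotient tends to 0, phi(v) is nonnegative; reflection treats negative
    arguments. *)
Lemma convex_ge0 phi u : continuous phi ->
  (forall u, exists2 l : R, 0 <= l & diff2 phi u @ U --> l) -> phi 0 = 0 ->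
  (fun n => (phi (h n) - phi (- h n)) * (2 * h n)^-1) @ U --> (0 : R) ->
  0 <= phi u.
Proof.
move=> cphi D2 p0 D1.
have pos (psi : R -> R) v : continuous psi ->
    (forall u, exists2 l : R, 0 <= l & diff2 psi u @ U --> l) -> psi 0 = 0 ->
    (fun n => (psi (h n) - psi (- h n)) * (2 * h n)^-1) @ U --> (0 : R) ->
    0 < v -> 0 <= psi v.
  move=> {cphi D2 p0 D1} cphi D2 p0 D1 v0; rewrite leNgt; apply/negP => pv.
  have : 0 <= psi v / v.
    apply: (cvg_le_ub D1); apply: filterS (step_small v0) => n hv.
    have hn := step_gt0 n.
    rewrite ler_pdivrMr ?mulr_gt0//.
    have H1 := chord_le cphi D2 v0 (ltW hn) (ltW hv).
    have hh : - h n < h n by lra.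
    have h0 : - h n <= 0 by lra.
    have H2 := chord_le cphi D2 hh h0 (ltW hn).
    rewrite p0 mul0r add0r !subr0 in H1; rewrite p0 mul0r sub0r !opprK in H2.
    have H3 : psi (h n) <= psi v / v * h n.
      by rewrite mulrAC ler_pdivlMr.
    have H4 : 0 <= psi (- h n) + psi (h n).
      by rewrite -(pmulr_lge0 _ hn) mulrDl -mulrDl; lra.
    by lra.
  by rewrite pmulr_lge0 ?invr_gt0// leNgt pv.
have [u0|u0|->] := ltgtP u 0; [|exact: (pos phi)|by rewrite p0].
rewrite -(opprK u); apply: (pos (fun x => phi (- x))).
- by move=> x; apply: (@continuous_comp _ _ _ -%R phi); [exact: opp_continuous|exact: cphi].
- move=> x; have [l l0 Hl] := D2 (- x); exists l => //.
  rewrite (_ : diff2 _ x = diff2 phi (- x))//.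
  apply/funext => n; rewrite /diff2 !opprD opprK.
  by congr ((_ - _) * _); rewrite addrC.
- by rewrite oppr0.
- rewrite -oppr0 [X in X @ _](_ : _ = fun n =>
    - ((phi (h n) - phi (- h n)) * (2 * h n)^-1)); first exact: cvgN.
  by apply/funext => n; rewrite opprK -mulNr opprB.
- by rewrite oppr_gt0.
Qed.

End Convexity.

End Ultralimit.

(** * Taylor expansion of positive-definite functions at every real point *)

Section Taylor.
Context {R : realType} (U : set_system nat) {UU : UltraFilter U}.
Context (oU : \oo `<=` U).
Local Notation C := R[i].
Local Notation h := (@step R).
Implicit Types (f g : R -> C) (t u : R) (c : nat -> C).

(** Real analyticity at 0 with given coefficients, on an interval of unspecified length; other
    points are reached by translating [f]. *)
Definition near0 f c := exists r M,
  [/\ 0 < r, abs_le c r M & forall t : R, `|t| < r -> f t = psum c t%:C].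

(** The sign is that of -f'', which is the one preserving positive-definiteness. *)
Definition dq2 f t (n : nat) : C :=
  ((h n) ^- 2)%:C * (f t + f t - f (t + h n) - f (t - h n)).

Definition dq1 f t (n : nat) : C :=
  ((2 * h n)^-1)%:C * (f (t + h n) - f (t - h n)).

Definition negD2 f t : C := ulim U (dq2 f t).

Definition D1 f t : C := ulim U (dq1 f t).

Lemma near0_val f c : near0 f c -> f 0 = c 0%N.
Proof. by move=> [r [M [r0 _ ->]]]; rewrite ?normr0// psum0. Qed.

Lemma near0_cont f c : near0 f c -> {for 0, continuous f}.
Proof.
move=> fc; have f0 := near0_val fc; have [r [M [r0 cM H]]] := fc.
apply/(@cvgcP R R (nbhs 0) (nbhs_filter 0)) => e e0.
have M0 := abs_le_ge0 cM; have K0 : 0 < M / r + 1 by rewrite ltr_wpDl// divr_ge0// ltW.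
apply/nbhs_ballP; exists (Num.min r (e / (M / r + 1))) => /=.
  by rewrite lt_min r0 divr_gt0.
move=> t; rewrite /ball/= sub0r normrN lt_min => /andP[tr te]; rewrite f0 H//.
have tr' : nrm t%:C <= r by rewrite nrm_real ltW.
have := psum_tail 1 r0 cM tr'; rewrite /ps big_nat1 mulr1 expr1 nrm_real.
move/le_trans; apply; move: te; rewrite ltr_pdivlMr// => /ltW; apply: le_trans.
by rewrite mulrDr mulr1 mulrCA lerDl.
Qed.

Lemma near0_dq2 f c r M t : 0 < r -> abs_le c r M ->
  (forall t : R, `|t| < r -> f t = psum c t%:C) -> `|t| < r ->
  dq2 f t @ U --> - 2 * psum (shiftc c 2) t%:C.
Proof.
move=> r0 cM H tr; have tr' : nrm t%:C < r by rewrite nrm_real.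
pose d := recenter c t%:C; pose s := r - `|t|.
have s0 : 0 < s by rewrite subr_gt0.
have dM : abs_le d s M by rewrite /s -(nrm_real t); exact: abs_le_recenter.
have M0 := abs_le_ge0 cM.
have fE v : `|v| < s -> f (t + v) = psum d v%:C.
  move=> vs; rewrite H; last by rewrite (le_lt_trans (ler_normD _ _))//;
    move: vs; rewrite /s; lra.
  have vs' : nrm v%:C < r - nrm t%:C by rewrite !nrm_real.
  rewrite rmorphD; exact: esym (psum_recenter tr' cM vs').
rewrite -[psum (shiftc c 2) _]/(d 2%N).
have ftE : f t = d 0%N.
  by have := fE 0; rewrite normr0 addr0 psum0; apply.
apply/cvgcP => e e0.
have K0 : 0 < 2 * M / s ^+ 3 + 1.
  by rewrite ltr_wpDl// divr_ge0 ?exprn_ge0 ?mulr_ge0// ltW.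
have es0 : 0 < Num.min s (e / (2 * M / s ^+ 3 + 1)) by rewrite lt_min s0 divr_gt0.
apply: filterS (step_small oU es0) => n; rewrite lt_min => /andP[hs he].
have hn := step_gt0 (R := R) n; set y := h n in hn hs he *.
have ys : `|y| < s by rewrite gtr0_norm.
have Nys : `|- y| < s by rewrite normrN.
have tail v : `|v| < s -> nrm (psum d v%:C - (d 0%N + d 1%N * v%:C + d 2%N * v%:C ^+ 2))
    <= M * (`|v| / s) ^+ 3.
  move=> vs; have := @psum_tail _ d v%:C s M 3 s0 dM; rewrite nrm_real => /(_ (ltW vs)).
  by rewrite /ps !big_nat_recr//= big_nil add0r expr0 mulr1 expr1.
have := tail _ ys; have := tail _ Nys; rewrite normrN (gtr0_norm hn) => T1 T2.
rewrite /dq2 -/y ftE (fE _ ys) (fE _ Nys).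
set a := psum d y%:C in T2 *; set b := psum d (- y)%:C in T1 *.
have yC : y%:C != 0 by rewrite -nrm_gt0 nrm_real normr_gt0 gt_eqF.
have -> : (y ^- 2)%:C * (d 0%N + d 0%N - a - b) - -2 * d 2%N =
    - (y%:C ^- 2 * ((a - (d 0%N + d 1%N * y%:C + d 2%N * y%:C ^+ 2)) +
      (b - (d 0%N + d 1%N * (- y)%:C + d 2%N * (- y)%:C ^+ 2)))).
  by rewrite rmorphN fmorphV rmorphXn; field.
rewrite nrmN nrmM nrmV nrmX nrm_real (gtr0_norm hn) mulrC ler_pdivrMr ?exprn_gt0//.
apply: le_trans (le_trans (nrmD _ _) (lerD T2 T1)) _.
move: he; rewrite ltr_pdivlMr// => /ltW he.
apply: (@le_trans _ _ (y * (2 * M / s ^+ 3 + 1) * y ^+ 2)); last first.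
  by rewrite ler_wpM2r ?exprn_ge0 ?(ltW hn).
rewrite expr_div_n mulrDr mulrDl mulr1.
rewrite (_ : M * (y ^+ 3 / s ^+ 3) + M * (y ^+ 3 / s ^+ 3) =
  y * (2 * M / s ^+ 3) * y ^+ 2); last by ring.
by rewrite lerDl mulr_ge0 ?exprn_ge0// ltW.
Qed.

Lemma pd_dq2 f n : positive_definite f -> positive_definite (fun t => dq2 f t n).
Proof.
move=> pf; apply: pd_scale; last exact: pd_diff2.
by rewrite invr_ge0 exprn_ge0// ltW// step_gt0.
Qed.

(** At t = 0 the quotients converge, by the expansion of [f]; positive-definiteness makes their
    value at 0 a bound at all [t]. *)
Lemma dq2_bound f c : positive_definite f -> near0 f c ->
  exists2 K, 0 <= K & \forall n \near U, forall t, nrm (dq2 f t n) <= K.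
Proof.
move=> pf [r [M [r0 cM H]]].
have L : dq2 f 0 @ U --> - 2 * psum (shiftc c 2) (0 : R)%:C.
  by apply: (near0_dq2 r0 cM H); rewrite normr0.
set l := - 2 * _ in L; exists (nrm l + 1); first by rewrite addr_ge0 ?nrm_ge0.
move/cvgcP : L => /(_ _ ltr01); apply: filterS => n H1 t.
apply: le_trans (pd_le0 t (pd_dq2 n pf)) _.
apply: le_trans (le_trans (ler_norm _) (Re_le_nrm _)) _.
by have := nrmD (dq2 f 0 n - l) l; rewrite subrK; lra.
Qed.

Lemma negD2_cvg f c t : positive_definite f -> near0 f c ->
  dq2 f t @ U --> negD2 f t.
Proof.
move=> pf fc; have [K _ H] := dq2_bound pf fc.
by apply: (ulim_cvg (K := K)); apply: filterS H => n.
Qed.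

(** By [pd_dist], |f(v+y) - f(v)|^2 <= 2 a Re(f(0) - f(y)), and the bound on [dq2] at 0 makes this
    at most a K y^2. The constant a K + 1 avoids the square root of a K. *)
Lemma D1_cvg f c t : positive_definite f -> near0 f c ->
  dq1 f t @ U --> D1 f t.
Proof.
move=> pf fc; have [K K0 H] := dq2_bound pf fc; set a := complex.Re (f 0).
have a0 : 0 <= a by have := pd0 pf; rewrite lecE => /andP[].
apply: (ulim_cvg (K := a * K + 1)); apply: filterS H => n /(_ 0) Hn.
have hn := step_gt0 (R := R) n; rewrite /dq1; set y := h n in hn *.
have step v : nrm (f (v + y) - f v) <= (a * K + 1) * y.
  rewrite -(@ler_pXn2r _ 2) ?nnegrE ?nrm_ge0//; last first.
    by rewrite mulr_ge0 ?(ltW hn)// addr_ge0// mulr_ge0.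
  apply: le_trans (pd_dist _ _ pf) _; rewrite [v + y - v]addrAC subrr add0r -/a.
  have : 2 * complex.Re (f 0 - f y) <= K * y ^+ 2.
    move: Hn; rewrite /dq2 -/y add0r sub0r (pd_herm _ pf) => Hn.
    have := le_trans (le_trans (ler_norm _) (Re_le_nrm _)) Hn.
    case: (f 0) => p q; case: (f y) => p' q' /=; rewrite mul0r subr0 mulrC.
    by rewrite ler_pdivrMr ?exprn_gt0//; apply: le_trans; lra.
  move=> H1; apply: (@le_trans _ _ (a * (K * y ^+ 2))).
    by rewrite mulrAC mulrC ler_wpM2l// mulrC.
  rewrite exprMn mulrA ler_wpM2r ?exprn_ge0 ?(ltW hn)//.
  have : 0 <= a * K by rewrite mulr_ge0.
  by clear; move: (a * K) => z z0; nra.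
rewrite nrmM nrm_real ger0_norm; last by rewrite invr_ge0 mulr_ge0// ltW.
rewrite mulrC ler_pdivrMr ?mulr_gt0//.
have := step t; have := step (t - y); rewrite subrK.
have := nrmD (f (t + y) - f t) (f t - f (t - y)); rewrite addrA subrK.
by lra.
Qed.

Lemma negD2_pd f c : positive_definite f -> near0 f c ->
  positive_definite (negD2 f).
Proof.
move=> pf fc; apply: (@pd_lim _ _ U _ (fun n t => dq2 f t n)).
  by move=> n; exact: pd_dq2.
by move=> t; exact: negD2_cvg fc.
Qed.

Lemma negD2_near0 f c : near0 f c ->
  near0 (negD2 f) (fun k => - 2 * shiftc c 2 k).
Proof.
move=> [r [M [r0 cM H]]].
have r20 : 0 < r / 2 by rewrite divr_gt0.
have cM' : abs_le c (r / 2 + r / 2) M by rewrite -splitr.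
have sM := abs_le_shiftc 2 (ltW r20) r20 cM'; set M' := M / _ in sM.
exists (r / 2), (2 * M'); split => //.
  move=> n; apply: le_trans (ler_wpM2l _ (sM n)) => //.
  rewrite mulr_sumr; apply: ler_sum => k _.
  by rewrite nrmM nrmN nrm_nat mulrA.
move=> t tr; have tr' : `|t| < r by lra.
rewrite (psumZ _ r20 sM) ?nrm_real ?(ltW tr)//.
by apply: ulim_eq; exact: near0_dq2 r0 cM H tr'.
Qed.

(** The candidate for f^(k)(t) / k!. The recursion goes two derivatives at a time because [negD2 f]
    is again positive-definite, whereas f' need not be. *)
Fixpoint tc (k : nat) f t {struct k} : C :=
  match k with
  | 0 => f t
  | k'.+1 => match k' with
    | 0 => D1 f t
    | k''.+1 => - tc k'' (negD2 f) t / (k''.+1 * k''.+2)%:R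
    end
  end.

(** Up to the factor (2m)!, this is the value at 0 of the [m]-th iterate of [negD2], a
    positive-definite function. *)
Lemma near0_sign f c m : positive_definite f -> near0 f c ->
  0 <= (-1) ^+ m * c (2 * m)%N.
Proof.
elim: m f c => [|m IH] f c pf fc.
  by rewrite muln0 expr0 mul1r -(near0_val fc) pd0.
have := IH _ _ (negD2_pd pf fc) (negD2_near0 fc).
rewrite /shiftc (_ : 2 + 2 * m = 2 * m.+1)%N; last by rewrite mulnS.
have b0 : (0 : C) < ('C(2 * m.+1, 2) * 2)%:R.
  by rewrite ltr0n muln_gt0 andbT bin_gt0 mulnS.
rewrite (_ : (-1) ^+ m * (-2 * (c (2 * m.+1)%N *+ 'C(2 * m.+1, 2))) =
  (-1) ^+ m.+1 * c (2 * m.+1)%N * ('C(2 * m.+1, 2) * 2)%:R).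
  by rewrite pmulr_lge0.
by rewrite -mulr_natr natrM exprS; ring.
Qed.

Let psum0_ps c n : (0 < n)%N -> ps c 0 n = c 0%N.
Proof.
case: n => // n _; rewrite /ps big_nat_recl// expr0 mulr1 big1 ?addr0// => k _.
by rewrite expr0n mulr0.
Qed.

Let x (t : R) : C := t%:C.
Let y n : C := (h n)%:C.

Let y_cvg : y @ U --> (0 : C).
Proof.
apply/cvgcP => e e0; apply: filterS (step_small oU e0) => n.
by rewrite subr0 nrm_real gtr0_norm ?step_gt0//; exact: ltW.
Qed.

Let y_neq0 n : y n != 0.
Proof. by rewrite -nrm_gt0 nrm_real normr_gt0 gt_eqF ?step_gt0. Qed.

Let cvg_shiftp (z : C) k : (fun n => (z + y n) ^+ k) @ U --> z ^+ k.
Proof.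
have L : (fun n => z + y n) @ U --> z + 0 by exact: cvgcD (cvgc_cst z) y_cvg.
rewrite addr0 in L; elim: k => [|k IH].
  rewrite expr0 [X in X @ _](_ : _ = fun=> 1); first exact: cvgc_cst.
  by apply/funext => n; rewrite expr0.
rewrite exprS [X in X @ _](_ : _ = fun n => (z + y n) * (z + y n) ^+ k).
  exact: cvgcM L IH.
by apply/funext => n; rewrite exprS.
Qed.

Let cvg_shiftm (z : C) k : (fun n => (z - y n) ^+ k) @ U --> z ^+ k.
Proof.
have L : (fun n => z - y n) @ U --> z - 0 by exact: cvgcB (cvgc_cst z) y_cvg.
rewrite subr0 in L; elim: k => [|k IH].
  rewrite expr0 [X in X @ _](_ : _ = fun=> 1); first exact: cvgc_cst.
  by apply/funext => n; rewrite expr0.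
rewrite exprS [X in X @ _](_ : _ = fun n => (z - y n) * (z - y n) ^+ k).
  exact: cvgcM L IH.
by apply/funext => n; rewrite exprS.
Qed.

(** Symmetric first and second difference quotients of the monomial of degree [k]; a recurrence on
    [k] gives their limits. *)
Let mono1 (z : C) k n : C := (2 * y n)^-1 * ((z + y n) ^+ k - (z - y n) ^+ k).

Let mono2 (z : C) k n : C :=
  (y n) ^- 2 * ((z + y n) ^+ k + (z - y n) ^+ k - 2 * z ^+ k).

Let mono1_cvg z k : mono1 z k @ U --> k%:R * z ^+ k.-1.
Proof.
elim: k => [|k IH].
  rewrite mul0r [X in X @ _](_ : _ = fun=> 0); first exact: cvgc_cst.
  by apply/funext => n; rewrite /mono1 !expr0 subrr mulr0.
have E : mono1 z k.+1 = fun n => z * mono1 z k n +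
    2^-1 * ((z + y n) ^+ k + (z - y n) ^+ k).
  by apply/funext => n; rewrite /mono1 !exprS; field; rewrite y_neq0.
rewrite E (_ : _ * _ = z * (k%:R * z ^+ k.-1) + 2^-1 * (z ^+ k + z ^+ k)).
  apply: cvgcD; first exact: cvgcM (cvgc_cst z) IH.
  have L : (fun n => (z + y n) ^+ k + (z - y n) ^+ k) @ U --> z ^+ k + z ^+ k.
    exact: cvgcD (@cvg_shiftp z k) (@cvg_shiftm z k).
  exact: cvgcM (cvgc_cst _) L.
case: k {IH E} => [|k]; first by rewrite mul0r mulr0 add0r; field.
by rewrite -(natr1 k.+1) /= exprS; field.
Qed.

Let mono2_cvg z k : mono2 z k @ U --> (k * k.-1)%:R * z ^+ k.-2.
Proof.
elim: k => [|k IH].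
  rewrite mul0r [X in X @ _](_ : _ = fun=> 0); first exact: cvgc_cst.
  by apply/funext => n; rewrite /mono2 !expr0; ring.
have E : mono2 z k.+1 = fun n => z * mono2 z k n + 2 * mono1 z k n.
  by apply/funext => n; rewrite /mono1 /mono2 !exprS; field; rewrite y_neq0.
rewrite E (_ : _ * _ = z * ((k * k.-1)%:R * z ^+ k.-2) + 2 * (k%:R * z ^+ k.-1)).
  apply: cvgcD; first exact: cvgcM (cvgc_cst z) IH.
  exact: cvgcM (cvgc_cst _) (@mono1_cvg z k).
case: k {IH E} => [|[|k]]; first by rewrite muln0 !mul0r !mulr0 addr0.
  by rewrite muln0 mul0r mulr0 add0r muln1 mul1r.
rewrite /= !natrM -(natr1 k.+2) -(natr1 k.+1) exprS; ring.
Qed.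

(** Reduces a complex estimate to real ones, to which [convex_ge0] applies. *)
Let nrm_dual (z : C) B : 0 <= B ->
  (forall l : C, nrm l <= 1 -> complex.Re (l * z) <= B) -> nrm z <= B.
Proof.
move=> B0 H; have [->|z0] := eqVneq z 0; first by rewrite nrm0.
have nz : 0 < nrm z by rewrite nrm_gt0.
have := H ((nrm z)^-1%:C * conjc z).
rewrite nrmM nrm_real nrm_conj ger0_norm ?invr_ge0 ?nrm_ge0// mulVf ?gt_eqF//.
move=> /(_ (lexx _)); rewrite -mulrA [conjc z * z]mulrC nrm_sqr.
by rewrite expr2 -rmorphM mulKf ?gt_eqF.
Qed.

(** Up to (2m)!, |c_{2m}| is the largest value of the derivative of order 2m, attained at 0. The
    induction step integrates the estimate for [negD2 f] twice: B v^k2 - Re(l W(v)) vanishes at 0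
    with zero slope, and its second differences have nonnegative limits, so it is nonnegative by
    [convex_ge0]. *)
Lemma pd_taylor_bound m f c t u : positive_definite f -> near0 f c ->
  nrm (f (t + u) - ps (fun k => tc k f t) u%:C (2 * m)) <=
  nrm (c (2 * m)%N) * u ^+ (2 * m).
Proof.
elim: m f c t u => [|m IH] f c t u pf fc.
  rewrite muln0 /ps big_nil subr0 mulr1 (le_trans (pd_le0 _ pf))//.
  rewrite -(near0_val fc); apply: le_trans (Re_le_nrm _); exact: ler_norm.
set k2 := (2 * m.+1)%N; have k2E : k2 = (2 * m).+2 by rewrite /k2 mulnS.
set B := nrm (c k2); have B0 : 0 <= B by exact: nrm_ge0.
pose a k := tc k f t; pose g := negD2 f; pose cg k : C := - 2 * shiftc c 2 k.
have pg : positive_definite g := negD2_pd pf fc.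
have gc : near0 g cg := negD2_near0 fc.
(* The induction hypothesis for [g] thus has exactly the second derivative of B v^k2 on its
   right-hand side. *)
have cgE : nrm (cg (2 * m)%N) = B * (k2 * k2.-1)%:R.
  have -> : cg (2 * m)%N = (- (2 * 'C(k2, 2))%:R : C) * c k2.
    rewrite /cg /shiftc (_ : 2 + 2 * m = k2)%N; last by rewrite k2E.
    by rewrite -mulr_natr natrM; ring.
  rewrite nrmM nrmN nrm_nat mulrC; congr (_ * _%:R).
  by rewrite -(mul_bin_diag k2 1) bin1.
pose W v := f (t + v) - ps a (x v) k2.
have cf := pd_cont pf (near0_cont fc).
have upow0 (v : R) : 0 <= v ^+ k2 by apply: exprn_even_ge0; rewrite /k2 oddM.
apply: nrm_dual; first by rewrite mulr_ge0.
move=> l l1; rewrite -/(a) -/(W u) -subr_ge0.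
pose psi v : C := B%:C * x v ^+ k2 - l * W v.
have psiE v : complex.Re (psi v) = B * v ^+ k2 - complex.Re (l * W v).
  rewrite /psi /x -rmorphXn -rmorphM; by case: (l * W v).
rewrite -psiE; apply: (convex_ge0 (U := U) oU (phi := fun v => complex.Re (psi v))).
- apply: cont_Re.
  have cx : continuous x.
    move=> v; apply: cvgc_ReIm; [exact: cvg_id|exact: cvg_cst].
  have cc (z : C) : continuous (fun _ : R => z) by move=> v; exact: cvgc_cst.
  have cxk k : continuous (fun v => x v ^+ k).
    elim: k => [|k IHk].
      exact: (cc 1).
    have -> : (fun v : R => x v ^+ k.+1) = fun v => x v * x v ^+ k.
      by apply/funext => v; rewrite exprS.
    exact: (contcM cx IHk).
  apply: (contcB (contcM (cc _) (cxk _))); apply: (contcM (cc _)).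
  apply: contcB.
    move=> v; apply: (@continuous_comp _ _ _ (fun v => t + v) f); last exact: cf.
    by apply: cvgD; [exact: cvg_cst|exact: cvg_id].
  move=> v; rewrite /ps; apply: cvgc_sum => k.
  exact: cvgcM (cvgc_cst _) (cxk k v).
- move=> v.
  pose L : C := B%:C * ((k2 * k2.-1)%:R * x v ^+ k2.-2) +
    l * (g (t + v) - ps (fun k => tc k g t) (x v) (2 * m)).
  have QL : (fun n => y n ^- 2 * (psi (v + h n) + psi (v - h n) - 2 * psi v)) @ U --> L.
    have E : (fun n => y n ^- 2 * (psi (v + h n) + psi (v - h n) - 2 * psi v)) =
      fun n => B%:C * mono2 (x v) k2 n + l * (dq2 f (t + v) n +
        \sum_(0 <= k < k2) a k * mono2 (x v) k n).
      apply/funext => n.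
      have -> : \sum_(0 <= k < k2) a k * mono2 (x v) k n = y n ^- 2 *
          (ps a (x v + y n) k2 + ps a (x v - y n) k2 - 2 * ps a (x v) k2).
        rewrite /ps mulr_sumr -big_split -sumrB mulr_sumr; apply: eq_bigr => k _.
        by rewrite /mono2 /=; ring.
      rewrite /mono2 /dq2 /psi /W /x !rmorphD !rmorphN /= -/(y n) fmorphV rmorphXn.
      rewrite -/(y n) !addrA.
      move: (ps a (v%:C + y n) k2) (ps a (v%:C - y n) k2) (ps a v%:C k2) => P1 P2 P3.
      move: (y n ^- 2) ((v%:C + y n) ^+ k2) ((v%:C - y n) ^+ k2) (v%:C ^+ k2).
      move: (f (t + v + h n)) (f (t + v - h n)) (f (t + v)) (B%:C); clear.
      by move=> *; ring.
    rewrite E; apply: cvgcD; first exact: cvgcM (cvgc_cst _) (@mono2_cvg _ _).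
    apply: cvgcM (cvgc_cst l) _; apply: cvgcD; first exact: negD2_cvg fc.
    have -> : - ps (fun k => tc k g t) (x v) (2 * m) =
        \sum_(0 <= k < k2) a k * ((k * k.-1)%:R * x v ^+ k.-2).
      rewrite k2E big_nat_recl// big_nat_recl// mul0n mul0r mulr0 add0r.
      rewrite mulr0 add0r /ps -sumrN; apply: eq_bigr => k _.
      rewrite /a [tc k.+2 f t]/= -/g [k.+2.-1]/= [k.+2.-2]/= [(k.+2 * _)%N]mulnC.
      have N0 : (k.+1 * k.+2)%:R != 0 :> C by rewrite pnatr_eq0.
      by rewrite mulrA divfK// mulNr.
    by apply: cvgc_sum => k; exact: cvgcM (cvgc_cst _) (@mono2_cvg _ _).
  exists (complex.Re L); last first.
    have -> : diff2 (fun v => complex.Re (psi v)) v = fun n => complex.Re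
        (y n ^- 2 * (psi (v + h n) + psi (v - h n) - 2 * psi v)).
      apply/funext => n; rewrite /diff2 /y -rmorphXn -fmorphV.
      case: (psi (v + h n)) => p q; case: (psi (v - h n)) => p' q'.
      by case: (psi v) => p'' q'' /=; ring.
    exact: cvgc_Re QL.
  have := IH _ _ t v pg gc; rewrite cgE -/(x v); set Z := g (t + v) - _ => HZ.
  have HZ' : - (B * (k2 * k2.-1)%:R * v ^+ (2 * m)) <= complex.Re (l * Z).
    rewrite lerNl; apply: le_trans HZ; apply: le_trans (ler_norm _) _.
    rewrite normrN (le_trans (Re_le_nrm _))// nrmM.
    by rewrite ler_piMl ?nrm_ge0.
  rewrite /L -/Z k2E -[(2 * m).+2.-2]/(2 * m)%N -k2E /x -rmorphXn.
  rewrite -(rmorph_nat (real_complex R)) -!rmorphM.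
  case: (l * Z) HZ' => p q /=; rewrite mulrA; lra.
- by rewrite psiE expr0n k2E/= mulr0 sub0r /W addr0 /x psum0_ps// subrr mulr0 oppr0.
(* The slope of [psi] at 0 vanishes because the first Taylor coefficient is by definition the limit
   [D1 f t] of the same quotients. *)
- have QL : (fun n => (2 * y n)^-1 * (psi (h n) - psi (- h n))) @ U --> (0 : C).
    have E : (fun n => (2 * y n)^-1 * (psi (h n) - psi (- h n))) =
      fun n => B%:C * mono1 0 k2 n - l * (dq1 f t n -
        \sum_(0 <= k < k2) a k * mono1 0 k n).
      apply/funext => n.
      have -> : \sum_(0 <= k < k2) a k * mono1 0 k n = (2 * y n)^-1 *
          (ps a (y n) k2 - ps a (- y n) k2).
        rewrite /ps -sumrB mulr_sumr; apply: eq_bigr => k _.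
        by rewrite /mono1 add0r sub0r; ring.
      rewrite /mono1 /dq1 /psi /W /x rmorphN /= -/(y n) fmorphV rmorphM.
      rewrite (rmorph_nat (real_complex R)) -/(y n) add0r sub0r.
      move: (ps a (y n) k2) (ps a (- y n) k2) (y n ^+ k2) ((- y n) ^+ k2).
      move: ((2 * y n)^-1) (f (t + h n)) (f (t - h n)) (B%:C); clear.
      by move=> *; ring.
    have L1 : (fun n => \sum_(0 <= k < k2) a k * mono1 0 k n) @ U --> a 1%N.
      have E1 : \sum_(0 <= k < k2) a k * (k%:R * 0 ^+ k.-1) = a 1%N.
        rewrite k2E !big_nat_recl// mul0r mulr0 add0r expr0 mulr1 mulr1.
        by rewrite big1 ?addr0// => k _; rewrite /= expr0n /= !mulr0.
      rewrite -E1; apply: cvgc_sum => k.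
      exact: cvgcM (cvgc_cst _) (@mono1_cvg _ _).
    have L2 : (fun n => dq1 f t n - \sum_(0 <= k < k2) a k * mono1 0 k n) @ U -->
        D1 f t - a 1%N.
      exact: cvgcB (D1_cvg pf fc) L1.
    have L3 : (fun n => B%:C * mono1 0 k2 n) @ U --> B%:C * (k2%:R * 0 ^+ k2.-1).
      exact: cvgcM (cvgc_cst _) (@mono1_cvg _ _).
    have L4 : (fun n => l * (dq1 f t n - \sum_(0 <= k < k2) a k * mono1 0 k n)) @ U -->
        l * (D1 f t - a 1%N) by exact: cvgcM (cvgc_cst l) L2.
    have Z1 : D1 f t - a 1%N = 0 by rewrite subrr.
    have Z2 : B%:C * (k2%:R * 0 ^+ k2.-1) = 0 by rewrite k2E /= expr0n /= !mulr0.
    rewrite Z1 mulr0 in L4; rewrite Z2 in L3; rewrite E -[X in _ --> X]subr0.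
    exact: cvgcB L3 L4.
  have -> : (fun n => (complex.Re (psi (h n)) - complex.Re (psi (- h n))) *
      (2 * h n)^-1) = fun n => complex.Re ((2 * y n)^-1 * (psi (h n) - psi (- h n))).
    apply/funext => n; rewrite /y -(rmorph_nat (real_complex R)) -rmorphM -fmorphV.
    by case: (psi (h n)) => p q; case: (psi (- h n)) => p' q' /=; ring.
  exact: cvgc_Re QL.
Qed.

(** Two consecutive remainders at s = rho and s = -rho, each at most [M], bound the pair of terms of
    degrees 2m and 2m+1 by 2M. Hence the coefficient bounds at radius [rho], and absolute
    convergence at half of it. *)
Lemma pd_taylor f c t rho M : positive_definite f -> near0 f c -> 0 < rho ->
  (forall m, nrm (c (2 * m)%N) * rho ^+ (2 * m) <= M) ->
  abs_le (fun k => tc k f t) (rho / 2) (4 * M) /\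
  forall u, `|u| < rho / 2 -> f (t + u) = psum (fun k => tc k f t) u%:C.
Proof.
move=> pf fc rho0 cM; set a := fun k => tc k f t.
have r20 : 0 < rho / 2 by rewrite divr_gt0.
have M0 : 0 <= M by apply: le_trans (cM 0%N); rewrite mulr_ge0 ?nrm_ge0 ?exprn_ge0// ltW.
have pair m (s : R) : `|s| = rho ->
    nrm (a (2 * m)%N * s%:C ^+ (2 * m) + a (2 * m).+1 * s%:C ^+ (2 * m).+1) <= 2 * M.
  move=> sr; have B j : nrm (f (t + s) - ps a s%:C (2 * j)) <= M.
    apply: le_trans (pd_taylor_bound j t s pf fc) _; apply: le_trans (cM j).
    by rewrite !exprM -sr real_normK ?num_real.
  have := B m; have := B m.+1; rewrite mulnS /ps !big_nat_recr//= => B1 B2.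
  set S := \sum_(0 <= k < _) _ in B1 B2.
  have := nrmD (f (t + s) - S) (- (f (t + s) - (S + a (2 * m)%N * s%:C ^+ (2 * m) +
     a (2 * m).+1 * s%:C ^+ (2 * m).+1))).
  rewrite nrmN (_ : f (t + s) - S - _ = a (2 * m)%N * s%:C ^+ (2 * m) +
     a (2 * m).+1 * s%:C ^+ (2 * m).+1); last by ring.
  by move/le_trans; apply; rewrite mulr2n mulrDl mul1r lerD.
(* Adding and subtracting the bounds at rho and -rho separates the even term from the odd one. *)
have both m : nrm (a (2 * m)%N) * rho ^+ (2 * m) <= 2 * M /\
    nrm (a (2 * m).+1) * rho ^+ (2 * m).+1 <= 2 * M.
  have := pair m rho (gtr0_norm rho0); have := pair m (- rho).
  rewrite normrN (gtr0_norm rho0) => /(_ erefl).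
  have rX j : rho ^+ j = nrm (rho%:C ^+ j) by rewrite nrmX nrm_real gtr0_norm.
  have e1 : (- rho)%:C ^+ (2 * m) = rho%:C ^+ (2 * m) by rewrite rmorphN !exprM sqrrN.
  have e2 : (- rho)%:C ^+ (2 * m).+1 = - rho%:C ^+ (2 * m).+1.
    by rewrite !exprS e1 rmorphN mulNr.
  rewrite !rX -!nrmM e1 e2 mulrN.
  set p := a (2 * m)%N * _; set q := a (2 * m).+1 * _ => H1 H2.
  have D2 (z : C) : nrm (z + z) = nrm z + nrm z.
    by rewrite -mulr2n -mulr_natl nrmM nrm_nat mulr2n mulrDl !mul1r.
  split.
    have := nrmD (p + q) (p - q); rewrite (_ : p + q + (p - q) = p + p); last by ring.
    by rewrite D2; lra.
  have := nrmD (p + q) (- (p - q)); rewrite (_ : p + q - (p - q) = q + q); last by ring.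
  by rewrite D2 nrmN; lra.
have geo k : nrm (a k) * rho ^+ k <= 2 * M.
  rewrite -(odd_double_half k) -mul2n; case: (odd k); rewrite ?add1n ?add0n.
    by have [] := both k./2.
  by have [] := both k./2.
have aM : abs_le a (rho / 2) (4 * M).
  by rewrite (_ : 4 * M = 2 * (2 * M)); [exact: geo_abs_le|ring].
split=> // u ur; have ur' : nrm u%:C <= rho / 2 by rewrite nrm_real ltW.
apply/eqP; rewrite -subr_eq0 -nrm_eq0; apply/eqP/le_anti; rewrite nrm_ge0 andbT.
apply/ler_addgt0Pr => e e0; rewrite add0r.
pose q := `|u| / (rho / 2); have q0 : 0 <= q by rewrite divr_ge0// ltW.
have q1 : q < 1 by rewrite ltr_pdivrMr// mul1r.
(* 5M is [M] for the Taylor remainder plus 4M for the tail of the series. *)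
have [n _ /(_ n (leqnn n)) Hn] := expr_small (5 * M) q0 q1 e0.
apply: le_trans Hn.
have T1 := pd_taylor_bound n t u pf fc; rewrite -/a in T1.
have T2 := psum_tail (2 * n) r20 aM ur'; rewrite nrm_real -/q in T2.
have q2n : q ^+ (2 * n) <= q ^+ n by rewrite ler_wiXn2l// ?(ltW q1)// leq_pmull.
have T1' : nrm (c (2 * n)%N) * u ^+ (2 * n) <= M * q ^+ (2 * n).
  have -> : u ^+ (2 * n) = (q / 2) ^+ (2 * n) * rho ^+ (2 * n).
    rewrite -exprMn (_ : q / 2 * rho = `|u|).
      by rewrite [RHS]exprM real_normK ?num_real// -exprM.
    by rewrite /q; field; rewrite gt_eqF.
  rewrite mulrCA mulrC ler_pM ?mulr_ge0 ?nrm_ge0 ?exprn_ge0 ?divr_ge0 ?(ltW rho0)//.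
  by rewrite lerXn2r// ?nnegrE ?divr_ge0//; lra.
have := nrmD (f (t + u) - ps a u%:C (2 * n)) (- (psum a u%:C - ps a u%:C (2 * n))).
rewrite nrmN (_ : _ - _ - _ = f (t + u) - psum a u%:C); last by ring.
have : 5 * M * q ^+ (2 * n) <= 5 * M * q ^+ n by rewrite ler_wpM2l// mulr_ge0.
by move: T1 T1' T2; lra.
Qed.

End Taylor.

(** * Pringsheim's theorem *)

Section NonnegativeCoefficients.
Context {R : realType}.
Local Notation C := R[i].
Implicit Types (c d e : nat -> C) (t rho M : R).

Let ge0E (z : C) : 0 <= z -> z = (nrm z)%:C.
Proof. by move=> z0; rewrite -normr_nrm ger0_norm. Qed.

Let Re_ps c t n : (forall k, 0 <= c k) ->
  ps c t%:C n = (\sum_(0 <= k < n) nrm (c k) * t ^+ k)%:C.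
Proof.
move=> c0; rewrite /ps rmorph_sum/=; apply: eq_bigr => k _.
by rewrite {1}(ge0E (c0 k)) rmorphM rmorphXn.
Qed.

Lemma abs_partial_le c t rho M n : (forall k, 0 <= c k) -> 0 < rho ->
  abs_le c rho M -> 0 <= t -> t <= rho ->
  \sum_(0 <= k < n) nrm (c k) * t ^+ k <= nrm (psum c t%:C).
Proof.
move=> c0 r0 cM t0 tr; have tr' : nrm t%:C <= rho by rewrite nrm_real ger0_norm.
have L := psum_cvg r0 cM tr'.
apply: le_trans (le_trans (ler_norm _) (Re_le_nrm _)).
apply: (cvg_ge_lb (cvgc_Re L)); exists n => // m /= nm.
rewrite Re_ps//= (@big_cat_nat _ _ _ n 0 m)//= lerDl sumr_ge0// => k _.
by rewrite mulr_ge0 ?nrm_ge0 ?exprn_ge0.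
Qed.

Lemma psum_mono c d t rho M : (forall k, 0 <= c k) -> (forall k, c k <= d k) ->
  0 < rho -> abs_le d rho M -> 0 <= t -> t <= rho ->
  nrm (psum c t%:C) <= nrm (psum d t%:C).
Proof.
move=> c0 cd r0 dM t0 tr.
have cdn k : nrm (c k) <= nrm (d k).
  by rewrite -lecR -!normr_nrm !ger0_norm// (le_trans (c0 k)).
have cM : abs_le c t (nrm (psum d t%:C)).
  move=> n; have := @abs_partial_le d t rho M n _ r0 dM t0 tr.
  move=> /(_ (fun k => le_trans (c0 k) (cd k))); apply: le_trans.
  by apply: ler_sum => k _; rewrite ler_wpM2r ?exprn_ge0.
have tr' : nrm t%:C <= rho by rewrite nrm_real ger0_norm.
have cM' : abs_le c rho M by apply: abs_le_eq dM => //; exact: ltW.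
have L : (fun n => nrm (ps c t%:C n)) @ \oo --> nrm (psum c t%:C).
  exact: nrm_cvg (psum_cvg r0 cM' tr').
apply: (cvg_le_ub L); apply: nearW => n; rewrite Re_ps// nrm_real ger0_norm//.
by rewrite sumr_ge0// => k _; rewrite mulr_ge0 ?nrm_ge0 ?exprn_ge0.
Qed.

(** Each partial sum is a polynomial in the radius, so the bound passes to the endpoint. *)
Lemma abs_le_left c s M : 0 < s ->
  (forall t, 0 <= t -> t < s -> abs_le c t M) -> abs_le c s M.
Proof.
move=> s0 H n.
have L : (fun t => \sum_(0 <= k < n) nrm (c k) * t ^+ k) @ s^'- -->
    \sum_(0 <= k < n) nrm (c k) * s ^+ k.
  elim: n => [|n IH].
    rewrite big_nil [X in X @ _](_ : _ = fun=> 0); first exact: cvg_cst.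
    by apply/funext => t; rewrite big_nil.
  rewrite big_nat_recr//= [X in X @ _](_ : _ = fun t =>
    \sum_(0 <= k < n) nrm (c k) * t ^+ k + nrm (c n) * t ^+ n).
    apply: cvgD => //; apply: cvgMr; apply: cvg_at_left_filter.
    exact: exprn_continuous.
  by apply/funext => t; rewrite big_nat_recr.
apply: (cvg_le_ub L); near=> t; apply: H.
  by apply: ltW; near: t; exact: nbhs_left_gt.
by near: t; exact: nbhs_left_lt.
Unshelve. all: by end_near. Qed.

Lemma abs_le_fin c n rho : exists M,
  abs_le (fun k => if (k < n)%N then c k else 0) rho M.
Proof.
exists (\sum_(0 <= k < n) nrm (c k) * `|rho| ^+ k) => m.
apply: (@le_trans _ _ (\sum_(0 <= k < n + m)
    nrm (if (k < n)%N then c k else 0) * `|rho| ^+ k)).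
  rewrite [leRHS](@big_cat_nat _ _ _ m)//= ?leq_addl//.
  rewrite -[leLHS]addr0 lerD//; last first.
    by rewrite sumr_ge0// => k _; rewrite mulr_ge0 ?nrm_ge0 ?exprn_ge0.
  apply: ler_sum => k _; rewrite ler_wpM2l ?nrm_ge0//.
  by rewrite -normrX ler_norm.
rewrite (@big_cat_nat _ _ _ n)//= ?leq_addr// [X in _ + X]big_nat.
rewrite [X in _ + X]big1 ?addr0; last first.
  by move=> k /andP[nk _]; rewrite ltnNge nk /= nrm0 mul0r.
by rewrite big_nat [leRHS]big_nat; apply: ler_sum => k /andP[_ ->].
Qed.

(* A nonnegative series is bounded by the sum of its re-expansion at t, even
   beyond its known radius of convergence. *)
Lemma abs_le_recenter_ge0 c t u rho M B : (forall k, 0 <= c k) -> 0 <= t ->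
  t < rho -> abs_le c rho M -> 0 < u -> abs_le (recenter c t%:C) u B ->
  abs_le c (t + u) B.
Proof.
move=> c0 t0 tr cM u0 dB n.
(* A polynomial can be recentred without any constraint on the radius, and the recentred
   coefficients of this truncation are dominated by those of [c]. *)
pose cn k := if (k < n)%N then c k else 0.
have cn0 k : 0 <= cn k by rewrite /cn; case: ifP.
have cnc k : cn k <= c k by rewrite /cn; case: ifP.
have tu0 : 0 <= t + u by rewrite addr_ge0// ltW.
have [K cnK] := abs_le_fin c n (t + u + 1); rewrite -/cn in cnK.
have nt : nrm t%:C = t by rewrite nrm_real ger0_norm.
have nu : nrm u%:C = u by rewrite nrm_real gtr0_norm.
have E : \sum_(0 <= k < n) nrm (c k) * (t + u) ^+ k = nrm (psum cn (t + u)%:C).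
  rewrite (@psum_fin _ _ _ n); last by move=> j nj; rewrite /cn ltnNge nj.
  rewrite Re_ps// nrm_real ger0_norm.
    by rewrite big_nat [RHS]big_nat; apply: eq_bigr => k /andP[_ kn]; rewrite /cn kn.
  by rewrite sumr_ge0// => k _; rewrite mulr_ge0 ?nrm_ge0 ?exprn_ge0.
have h1 : nrm t%:C < t + u + 1 by rewrite nt; lra.
have h2 : nrm u%:C < t + u + 1 - nrm t%:C by rewrite nt nu; lra.
have r0 : 0 < rho by exact: le_lt_trans tr.
rewrite E rmorphD -(psum_recenter h1 cnK h2).
apply: (psum_bound u0); last by rewrite nu.
apply: abs_le_eq dB; last exact: ltW.
move=> j.
have cM' : abs_le c ((t + rho) / 2 + (rho - t) / 2) M.
  by rewrite (_ : (t + rho) / 2 + (rho - t) / 2 = rho)//; field.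
have q0 : 0 < (rho - t) / 2 by rewrite divr_gt0// subr_gt0.
have p0 : 0 < (t + rho) / 2 by rewrite divr_gt0// ltr_wpDl.
apply: (psum_mono _ _ p0 (abs_le_shiftc j (ltW p0) q0 cM') t0); last lra.
- by move=> k; rewrite /shiftc mulrn_wge0.
- by move=> k; rewrite /shiftc ler_wMn2r.
Qed.

Lemma inv_uniq (a b z : C) : a * z = 1 -> b * z = 1 -> a = b.
Proof. by move=> az bz; rewrite -[a]mulr1 -bz mulrCA az mulr1. Qed.

Lemma convC c d : conv c d =1 conv d c.
Proof.
move=> n; rewrite /conv !big_mkord (reindex_inj rev_ord_inj)/=.
apply: eq_bigr => k _; rewrite subSS subKn; last by rewrite -ltnS.
by rewrite mulrC.
Qed.

Lemma psum_inv c e w rho sigma M N : conv c e =1 (fun n => (n == 0)%:R) ->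
  0 < rho -> 0 < sigma -> abs_le c rho M -> abs_le e sigma N ->
  nrm w < rho -> nrm w < sigma -> psum c w * psum e w = 1.
Proof.
move=> ce r0 s0 cM eN wr ws; set q := Num.min rho sigma.
have q0 : 0 < q by rewrite lt_min r0.
have wq : nrm w < q by rewrite lt_min wr.
have qr : q <= rho by rewrite ge_min lexx.
have qs : q <= sigma by rewrite ge_min lexx orbT.
rewrite -(psumM q0 (abs_leW (ltW q0) qr cM) (abs_leW (ltW q0) qs eN) wq).
rewrite (@psum_fin _ _ _ 1); first by rewrite /ps big_nat1 ce expr0 mulr1.
by move=> [|j] //; rewrite ce.
Qed.

(* Pringsheim's theorem: a power series with nonnegative coefficients has a
   singularity at its radius of convergence, so beta converges as long as
   1 / F is analytic and bounded. *)
Lemma pringsheim (F : R -> C) c (beta : nat -> C) delta : 0 < delta ->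
  near0 F c -> c 0%N = 1 -> conv c beta =1 (fun n => (n == 0)%:R) ->
  (forall k, 0 <= beta k) -> (forall t, exists d, near0 (fun u => F (t + u)) d) ->
  (forall t, 0 <= t -> t <= delta -> 2^-1 <= nrm (F t)) ->
  abs_le beta delta 2.
Proof.
move=> delta0 Fc c0 cb b0 Fan F2.
(* The radii up to which [beta] sums to 1 / F. Their supremum [s] will be shown to be [delta]:
   otherwise [beta] still sums to 1 / F up to s + 2q, beyond [s]. *)
pose P tau := [/\ 0 < tau, tau <= delta, exists M, abs_le beta tau M &
  forall t, 0 <= t -> t < tau -> psum beta t%:C * F t = 1].
have nt t : 0 <= t -> nrm t%:C = t by move=> t0; rewrite nrm_real ger0_norm.
(* A nonnegative series has its partial sums below its sum, here 1 / |F(t)| <= 2; this replaces the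
   unknown [M] by 2. *)
have eq_bound t rho M : 0 < rho -> 0 <= t -> t <= rho -> t <= delta ->
    abs_le beta rho M -> psum beta t%:C * F t = 1 -> abs_le beta t 2.
  move=> r0 t0 tr td bM bF n; apply: le_trans (abs_partial_le n b0 r0 bM t0 tr) _.
  have := congr1 (@ComplexField.Normc.normc R) bF; rewrite nrmM nrm1 => H.
  have F0 := F2 t t0 td; have B0 := nrm_ge0 (psum beta t%:C); nra.
have P2 tau : P tau -> abs_le beta tau 2.
  move=> [tau0 td [M bM] bF]; apply: abs_le_left => // t t0 tt.
  by apply: (eq_bound t tau M) => //; [exact: ltW|exact: le_trans (ltW tt) td|
    exact: bF].
have [tau0 Ptau0] : exists tau, P tau.
  have [r [M [r0 cM FE]]] := Fc.
  have bM := abs_le_inv r0 cM c0 cb; set s := r / _ in bM.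
  have M1 : 1 <= M by have := abs_le_term 0 (ltW r0) cM; rewrite c0 nrm1 expr0 mulr1.
  have s0 : 0 < s by rewrite divr_gt0//; lra.
  exists (Num.min delta (Num.min r s)); split.
  - by rewrite !lt_min delta0 r0.
  - by rewrite ge_min lexx.
  - exists 2; apply: abs_leW bM; first by rewrite !le_min !ltW.
    by rewrite !ge_min lexx !orbT.
  - move=> t t0; rewrite !lt_min => /and3P[_ tr ts].
    rewrite FE ?ger0_norm// mulrC.
    by apply: (psum_inv cb r0 s0 cM bM); rewrite nt.
have supP : has_sup [set tau | P tau].
  by split; [exists tau0|exists delta => tau []].
set s := sup [set tau | P tau].
have Ps t : t < s -> exists2 tau, P tau & t < tau.
  move=> ts; have := sup_adherent (_ : 0 < s - t) supP; rewrite subr_gt0.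
  by move=> /(_ ts)[tau Ptau]; rewrite subKr => ?; exists tau.
have les tau : P tau -> tau <= s by move=> Pt; exact: sup_upper_bound.
have s0 : 0 < s by case: (Ptau0) => t0 _ _ _; exact: lt_le_trans (les _ Ptau0).
have sd : s <= delta by apply: ge_sup; [exists tau0|move=> tau []].
have bs : abs_le beta s 2.
  apply: abs_le_left => // t t0 /Ps[tau Pt tt].
  by apply: abs_leW (P2 _ Pt) => //; exact: ltW.
have Fs t : 0 <= t -> t < s -> psum beta t%:C * F t = 1.
  by move=> t0 /Ps[tau [_ _ _ H] tt]; exact: H.
move: sd; rewrite le_eqVlt => /predU1P[<-//|sd]; exfalso.
have [d [r [M [r0 dM FE]]]] := Fan s.
have d0 : d 0%N != 0.
  have := FE 0; rewrite normr0 addr0 psum0 => /(_ r0) <-.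
  by rewrite -nrm_gt0; apply: lt_le_trans (F2 s (ltW s0) (ltW sd)); rewrite invr_gt0.
have oneM : abs_le (fun k => (k == 0)%:R : C) r 1.
  move=> [|n]; first by rewrite big_nil.
  rewrite big_nat_recl// nrm1 mulr1 big1 ?addr0// => k _.
  by rewrite nrm0 mul0r.
have psum1 w : psum (fun k => (k == 0)%:R : C) w = 1.
  rewrite (@psum_fin _ _ _ 1); first by rewrite /ps big_nat1 mulr1.
  by case.
(* On this disc the series [d] differs from its constant term by less than half of |d 0|. *)
have [x [x0 xr Hx]] : exists x, [/\ 0 < x, x <= r &
    forall w : C, nrm w < x -> psum d w != 0].
  have n0 : 0 < nrm (d 0%N) by rewrite nrm_gt0.
  have M1 : 0 < M.
    by apply: lt_le_trans (abs_le_term 0 (ltW r0) dM); rewrite expr0 mulr1.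
  exists (Num.min r (nrm (d 0%N) * r / (2 * M))); split.
  - by rewrite lt_min r0 divr_gt0 ?mulr_gt0.
  - by rewrite ge_min lexx.
  move=> w; rewrite lt_min => /andP[wr wx]; rewrite -nrm_gt0.
  have := psum_tail 1 r0 dM (ltW wr); rewrite /ps big_nat1 mulr1 expr1.
  have : M * (nrm w / r) < nrm (d 0%N) / 2.
    rewrite mulrA ltr_pdivrMr// mulrC -ltr_pdivlMr//.
    rewrite (_ : nrm (d 0%N) / 2 * r / M = nrm (d 0%N) * r / (2 * M))//.
    by field; rewrite gt_eqF.
  have := nrmD (psum d w) (d 0%N - psum d w); rewrite addrC subrK nrmBC.
  by lra.
have [rho [E [rho0 [B EB] HE]]] : exists rho E, [/\ 0 < rho,
    exists B, abs_le E rho B & forall w : C, nrm w < rho -> (psum d w)^-1 = psum E w].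
  apply: (psum_quotient x0 (abs_leW (ltW x0) xr oneM) (abs_leW (ltW x0) xr dM) d0).
  by move=> w wx; rewrite psum1 mulVf// Hx.
pose eta := Num.min (Num.min rho x) (Num.min s (delta - s)).
have eta0 : 0 < eta by rewrite !lt_min rho0 x0 s0 subr_gt0.
have [er ex es ed] : [/\ eta <= rho, eta <= x, eta <= s & eta <= delta - s].
  by split; rewrite /eta !ge_min lexx ?orbT.
have HEF u : `|u| < eta -> psum E u%:C * F (s + u) = 1.
  move=> ue; rewrite FE ?(lt_le_trans ue (le_trans ex xr))//.
  rewrite -HE ?nrm_real ?(lt_le_trans ue er)// mulVf// Hx// nrm_real.
  exact: lt_le_trans ue ex.
(* 1 / F has an expansion of radius 4q at [s], hence of radius 3q at t1 = s - q. There it agrees on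
   (0, q) with the recentred [beta], so [abs_le_recenter_ge0] extends the latter to t1 + 3q = s +
   2q. *)
pose q := eta / 4; have q0 : 0 < q by rewrite divr_gt0.
have e4 : eta = 4 * q by rewrite /q; field.
pose t1 := s - q; have t10 : 0 <= t1 by rewrite /t1; lra.
have t1s : t1 < s by rewrite /t1; lra.
have EB' := abs_leW (ltW eta0) er EB.
have nq : nrm (- q)%:C = q by rewrite nrm_real normrN gtr0_norm.
have nqe : nrm (- q)%:C < eta by rewrite nq; lra.
have hM := abs_le_recenter nqe EB'; set h' := recenter E _ in hM.
have hq : eta - nrm (- q)%:C = 3 * q by rewrite nq e4; ring.
rewrite hq in hM.
have nt1 : nrm t1%:C < s by rewrite nt.
have DM := abs_le_recenter nt1 bs; set D := recenter beta _ in DM.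
have Dq : s - nrm t1%:C = q by rewrite nt// /t1; ring.
rewrite Dq in DM.
have q3 : q <= 3 * q by lra.
have hE w : 0 <= w -> w < 3 * q -> psum h' w%:C * F (t1 + w) = 1.
  move=> w0 wq; rewrite (psum_recenter nqe EB') ?hq ?nt//.
  rewrite -rmorphD (_ : t1 + w = s + (- q + w)); last by rewrite /t1; ring.
  by apply: HEF; rewrite ltr_norml; apply/andP; split; lra.
have Dh : D =1 h'.
  apply: (psum_inj q0 q0 DM (abs_leW (ltW q0) q3 hM)) => w w0 wq.
  have H1 : psum D w%:C * F (t1 + w) = 1.
    rewrite (psum_recenter nt1 bs) ?Dq ?nt ?(ltW w0)// -rmorphD.
    by apply: Fs; rewrite /t1; lra.
  have H2 : psum h' w%:C * F (t1 + w) = 1 by apply: hE; lra.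
  exact: inv_uniq H1 H2.
have q30 : 0 < 3 * q by lra.
have DB : abs_le D (3 * q) B.
  by apply: abs_le_eq hM => [k|]; [rewrite Dh|exact: ltW].
have bB := abs_le_recenter_ge0 b0 t10 t1s bs q30 DB.
have s' : t1 + 3 * q = s + 2 * q by rewrite /t1; ring.
suff : P (s + 2 * q) by move/les; lra.
split; [lra|lra|by exists B; rewrite -s'|].
move=> t t0 ts'; have [ts|st] := ltP t s; first exact: Fs.
have nt1' : nrm t1%:C < t1 + 3 * q by rewrite nt//; lra.
have w0 : 0 <= t - t1 by lra.
have wq : t - t1 < 3 * q by lra.
have e3 : t1 + 3 * q - nrm t1%:C = 3 * q by rewrite nt//; ring.
have h3 : nrm (t - t1)%:C < t1 + 3 * q - nrm t1%:C by rewrite e3 nt.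
have E5 : psum D (t - t1)%:C = psum beta (t1%:C + (t - t1)%:C).
  exact: (psum_recenter nt1' bB h3).
have e6 : t1 + (t - t1) = t by rewrite addrC subrK.
have e7 : t1%:C + (t - t1)%:C = t%:C :> C by rewrite -rmorphD e6.
have Dh' : D = h' by apply/funext.
by have := hE _ w0 wq; rewrite -Dh' E5 e7 e6.
Qed.

Lemma psum_conj c w rho M : 0 < rho -> abs_le c rho M -> nrm w <= rho ->
  conjc (psum c w) = psum (fun k => conjc (c k)) (conjc w).
Proof.
move=> r0 cM wr; apply/esym; apply: psum_eq; apply/cvgcP => e e0.
have /cvgcP/(_ _ e0) := psum_cvg r0 cM wr; apply: filterS => n; apply: le_trans.
have -> : ps (fun k => conjc (c k)) (conjc w) n = conjc (ps c w n).
  by rewrite /ps rmorph_sum; apply: eq_bigr => k _; rewrite rmorphM rmorphXn.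
by rewrite -rmorphB nrm_conj.
Qed.

Lemma near0_psum c rho M : 0 < rho -> abs_le c rho M ->
  near0 (fun t => psum c t%:C) c.
Proof. by move=> r0 cM; exists rho, M. Qed.

Lemma near0_inj (f g : R -> C) c d eta : near0 f c -> near0 g d -> 0 < eta ->
  (forall t, `|t| < eta -> f t = g t) -> c =1 d.
Proof.
move=> [r [M [r0 cM fE]]] [q [N [q0 dN gE]]] eta0 fg.
have m0 : 0 < Num.min r q by rewrite lt_min r0.
have mr : Num.min r q <= r by rewrite ge_min lexx.
have mq : Num.min r q <= q by rewrite ge_min lexx orbT.
apply: (@psum_inj _ c d _ _ _ (Num.min eta (Num.min r q)) m0 _
  (abs_leW (ltW m0) mr cM) (abs_leW (ltW m0) mq dN)); first by rewrite lt_min eta0.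
move=> t t0; rewrite !lt_min => /and3P[te tr tq].
by rewrite -fE ?gtr0_norm// -gE ?gtr0_norm// fg// gtr0_norm.
Qed.

Lemma near0_conj (f : R -> C) c : near0 f c ->
  near0 (fun t => conjc (f t)) (fun k => conjc (c k)).
Proof.
move=> [r [M [r0 cM fE]]]; exists r, M; split => //.
  by apply: abs_le_eq cM => [k|]; [rewrite nrm_conj|exact: ltW].
move=> t tr; rewrite fE// (psum_conj r0 cM) ?conjc_real// nrm_real.
exact: ltW.
Qed.

Lemma near0_opp (f : R -> C) c : near0 f c ->
  near0 (fun t => f (- t)) (fun k => c k * (-1) ^+ k).
Proof.
move=> [r [M [r0 cM fE]]]; exists r, M; split => //.
  apply: abs_le_eq cM => [k|]; last exact: ltW.
  by rewrite nrmM nrmX nrmN nrm1 expr1n mulr1.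
move=> t tr; rewrite fE; last by rewrite normrN.
have -> : (- t)%:C = -1 * t%:C :> C by rewrite mulN1r rmorphN.
exact: esym (psum_scale _ _ _).
Qed.

End NonnegativeCoefficients.

(** * The class D *)

Section ClassD.
Context {R : realType} (U : set_system nat) {UU : UltraFilter U}.
Context (oU : \oo `<=` U).
Local Notation C := R[i].
Implicit Types (F G : R -> C) (c beta : nat -> C).

Let imagE (t : R) : t *i = 'i%C * t%:C :> C.
Proof. by apply/eqP; rewrite eq_complex/= !mul0r !mul1r subr0 add0r !eqxx. Qed.

Lemma conv_twist c beta (a : C) : conv c beta =1 (fun n => (n == 0)%:R) ->
  conv (fun k => c k * a ^+ k) (fun k => beta k * a ^+ k) =1
  (fun n => (n == 0)%:R).
Proof.
move=> cb n; transitivity (conv c beta n * a ^+ n); last first.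
  by rewrite cb; case: n => [|n]; rewrite ?mul0r// expr0 mulr1.
rewrite /conv big_nat [in RHS]big_nat mulr_suml; apply: eq_bigr => k /andP[_ kn].
have -> : a ^+ n = a ^+ k * a ^+ (n - k) by rewrite -exprD subnKC// -ltnS.
ring.
Qed.

Lemma abs_le_twist c rho M : 0 <= rho -> abs_le c rho M ->
  abs_le (fun k => c k * 'i%C ^+ k) rho M.
Proof. by move=> r0; apply: abs_le_eq => // k; rewrite nrmM nrm_iX mulr1. Qed.

Lemma near0_local F c t : positive_definite F -> near0 F c ->
  exists d, near0 (fun u => F (t + u)) d.
Proof.
move=> pF Fc; have [r [M [r0 cM _]]] := Fc.
have cM' m : nrm (c (2 * m)%N) * r ^+ (2 * m) <= M.
  by apply: abs_le_term cM; exact: ltW.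
have [aM H] := pd_taylor oU t pF Fc r0 cM'.
exists (fun k => tc U k F t), (r / 2), (4 * M); split => //.
by rewrite divr_gt0.
Qed.

(** [near0] says nothing about the length of the interval; [pd_taylor] at 0 gives an expansion of
    radius rho / 2, with the same coefficients by the identity theorem. For a sequence the interval
    thus depends only on the common coefficient bound. *)
Lemma near0_uniform F c rho M : positive_definite F -> near0 F c -> 0 < rho ->
  abs_le c rho M -> forall t : R, `|t| < rho / 2 -> F t = psum c t%:C.
Proof.
move=> pF Fc r0 cM t tr.
have cM' m : nrm (c (2 * m)%N) * rho ^+ (2 * m) <= M.
  by apply: abs_le_term cM; exact: ltW.
have [aM H] := pd_taylor oU 0 pF Fc r0 cM'.
have r20 : 0 < rho / 2 by rewrite divr_gt0.
have E : c =1 (fun k => tc U k F 0).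
  apply: (@near0_inj _ F F _ _ 1 Fc) => //.
  by exists (rho / 2), (4 * M); split => // u; rewrite -{2}[u]add0r => /H.
have -> : c = (fun k => tc U k F 0) by apply/funext.
by have := H _ tr; rewrite add0r.
Qed.

(** Here [beta] lists the coefficients of 1 / F, so that G(t) = 1 / F(it) has coefficients beta_k
    i^k. Those of even degree have the sign given by [near0_sign], and those of odd degree vanish
    because [G] is even near 0. *)
Lemma classD_data F : classD R F -> exists G c beta,
  [/\ Pplus R G, near0 F c, near0 G (fun k => beta k * 'i%C ^+ k), c 0%N = 1 &
    conv c beta =1 (fun n => (n == 0)%:R) /\ forall k, 0 <= beta k].
Proof.
move=> [[cF pF F0] [G [cG pG G0] [a [Fext [a0 [hol FE] FG]]]]].
have [r [c [r0 [M cM] HF]]] := holomorphic_psum a0 hol.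
have Fc : near0 F c.
  by exists r, M; split => // t tr; rewrite -FE HF// nrm_real.
have c0 : c 0%N = 1 by rewrite -(near0_val Fc).
have [beta cb] := conv_inv_ex c0.
pose al k := c k * 'i%C ^+ k; pose e k := beta k * 'i%C ^+ k.
have ale : conv al e =1 (fun n => (n == 0)%:R) by exact: conv_twist.
have aM : abs_le al r M by exact: abs_le_twist (ltW r0) cM.
have al0 : al 0%N = 1 by rewrite /al c0 mulr1.
have M1 : 1 <= M by have := abs_le_term 0 (ltW r0) cM; rewrite c0 nrm1 expr0 mulr1.
have eM := abs_le_inv r0 aM al0 ale; set s := r / _ in eM.
have s0 : 0 < s by rewrite divr_gt0//; lra.
have [eta eta0 HG] : exists2 eta : R, 0 < eta & forall t : R, `|t| < eta ->
    psum al t%:C * G t = 1.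
  move: FG => /nbhs_ballP[eta /= eta0 H]; exists (Num.min eta r).
    by rewrite lt_min eta0.
  move=> t; rewrite lt_min => /andP[te tr].
  have := H t; rewrite /ball/= sub0r normrN imagE => /(_ te).
  rewrite HF; last by rewrite nrmM nrm_real -(expr1 'i%C) nrm_iX mul1r.
  have -> : psum al t%:C = psum c ('i%C * t%:C) by exact: psum_scale.
  by [].
have Ge : near0 G e.
  exists (Num.min eta (Num.min r s)), 2; split.
  - by rewrite !lt_min eta0 r0.
  - apply: abs_leW eM; first by rewrite !le_min !ltW.
    by rewrite !ge_min lexx !orbT.
  move=> t; rewrite !lt_min => /and3P[te tr ts].
  have H1 : psum al t%:C * psum e t%:C = 1.
    by apply: (psum_inv ale r0 s0 aM eM); rewrite nrm_real.
  have H2 := HG _ te.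
  rewrite mulrC in H1; rewrite mulrC in H2; exact: inv_uniq H2 H1.
(* F(-t) being the conjugate of F(t), F(it) is real for small real [t]. *)
have al_real k : conjc (al k) = al k.
  have H1 : (fun k => conjc (c k)) =1 (fun k => c k * (-1) ^+ k).
    apply: (@near0_inj _ _ _ _ _ 1 (near0_conj Fc) (near0_opp Fc)) => // t _.
    by rewrite (pd_herm _ pF).
  have iE : conjc 'i%C = - 'i%C :> C.
    by apply/eqP; rewrite /conjc eq_complex/= oppr0 !eqxx.
  rewrite /al rmorphM rmorphXn /= iE (H1 k).
  by rewrite -mulrA -exprMn mulN1r opprK.
(* Near 0 the function [G] is the inverse of a real one, hence real; being hermitian it is then
   even. *)
have e_even k : e k = e k * (-1) ^+ k.
  pose m := Num.min eta r; have m0 : 0 < m by rewrite lt_min eta0.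
  apply: (@near0_inj _ _ _ _ _ m Ge (near0_opp Ge) m0) => t.
  rewrite lt_min => /andP[te tr]; rewrite (pd_herm _ pG).
  have H2 := HG _ te.
  have : conjc (psum al t%:C) * conjc (G t) = 1 by rewrite -rmorphM H2; exact: rmorph1.
  rewrite (psum_conj r0 aM) ?nrm_real ?(ltW tr)// conjc_real.
  rewrite (_ : (fun k => conjc (al k)) = al); last by apply/funext => j; exact: al_real.
  rewrite [_ * G t]mulrC in H2; rewrite mulrC => H3; exact: inv_uniq H2 H3.
exists G, c, beta; split => //; split => // k.
have eE : beta k = e k * (-1) ^+ k * 'i%C ^+ k.
  rewrite /e -mulrA -exprMn -mulrA -exprMn mulN1r mulrN.
  by rewrite -expr2 sqr_i opprK expr1n mulr1.
rewrite -(odd_double_half k) in eE *; case: (odd k) eE => /= eE.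
  have e1 := e_even (1 + k./2.*2)%N.
  have : e (1 + k./2.*2)%N = 0.
    move: e1; rewrite exprD expr1 -mul2n exprM sqrrN expr1n expr1n mulr1 mulrN1.
    by move=> /eqP; rewrite -addr_eq0 -mulr2n mulrn_eq0 /= => /eqP.
  by move=> e0; rewrite eE e0 !mul0r.
rewrite add0n -mul2n in eE *.
have S : 0 <= (-1) ^+ k./2 * e (2 * k./2)%N := near0_sign oU k./2 pG Ge.
have E1 : (-1) ^+ (2 * k./2) = 1 :> C by rewrite exprM sqrrN !expr1n.
have E2 : 'i%C ^+ (2 * k./2) = (-1) ^+ k./2 :> C by rewrite exprM sqr_i.
have -> : beta (2 * k./2)%N = (-1) ^+ k./2 * e (2 * k./2)%N.
  by rewrite eE E1 E2 mulr1 mulrC.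
exact: S.
Qed.

Lemma locally_uniform_near (F_ : nat -> R -> C) F (a b e : R) :
  locally_uniform_cvg F_ F -> 0 < e ->
  \forall n \near \oo, forall t, a <= t -> t <= b -> nrm (F_ n t - F t) <= e.
Proof.
move=> H e0.
have N : nbhs (F : {uniform` `[a, b]%classic -> C})
    [set g | forall t, a <= t -> t <= b -> nrm (g t - F t) <= e].
  apply/uniform_nbhs; exists [set xy | ball xy.1 e%:C xy.2]; split.
    by apply: (@entourage_ball _ C (PosNum (_ : 0 < e%:C))); rewrite ltcR.
  move=> g /= Hg t ta tb; have := Hg t; rewrite /= in_itv/= ta tb => /(_ isT).
  by rewrite /ball/= normr_nrm ltcR nrmBC => /ltW.
exact: (H a b _ N).
Qed.

Lemma locally_uniform_pointwise (F_ : nat -> R -> C) F t :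
  locally_uniform_cvg F_ F -> F_ n t @[n --> \oo] --> F t.
Proof.
move=> H; apply/cvgcP => e e0.
by apply: filterS (locally_uniform_near t t H e0) => n; apply.
Qed.

(** Uniform convergence is used only for continuity at 0; positive-definiteness propagates it. *)
Lemma Pplus_lim (F_ : nat -> R -> C) F : (forall n, Pplus R (F_ n)) ->
  locally_uniform_cvg F_ F -> Pplus R F.
Proof.
move=> HF H; have pw t : F_ n t @[n --> \oo] --> F t.
  exact: locally_uniform_pointwise H.
have pF : positive_definite F.
  apply: (@pd_lim _ _ \oo _ F_) => [n|t]; first by have [] := HF n.
  exact: pw.
have F0 : F 0 = 1.
  apply: (@cvgc_unique _ _ \oo _ _ _ _ (pw 0)).
  rewrite [X in X @ _](_ : _ = fun=> 1); first exact: cvgc_cst.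
  by apply/funext => n; have [_ _ ->] := HF n.
split => //; apply: pd_cont => //.
apply/(@cvgcP R R (nbhs 0) (nbhs_filter 0)) => e e0.
have e30 : 0 < e / 3 by rewrite divr_gt0.
have [n _ /(_ n (leqnn n)) Hn] := locally_uniform_near (-1) 1 H e30.
have [cn _ _] := HF n.
move/(@cvgcP R R (nbhs 0) (nbhs_filter 0)) : (cn 0) => /(_ _ e30).
move=> /nbhs_ballP[del /= del0 Hd]; apply/nbhs_ballP.
exists (Num.min del 1) => /=; first by rewrite lt_min del0 ltr01.
move=> t; rewrite /ball/= sub0r normrN lt_min => /andP[td t1].
have := Hd t; rewrite /ball/= sub0r normrN => /(_ td) H1.
move: t1; rewrite ltr_norml => /andP[/ltW t1 /ltW t2].
have H2 := Hn t t1 t2; have H3 := Hn 0 (lerN10 _) ler01.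
have -> : F t - F 0 = - (F_ n t - F t) + (F_ n t - F_ n 0) + (F_ n 0 - F 0) by ring.
have := nrmD (- (F_ n t - F t) + (F_ n t - F_ n 0)) (F_ n 0 - F 0).
have := nrmD (- (F_ n t - F t)) (F_ n t - F_ n 0); rewrite nrmN.
by move: H1 H2 H3; lra.
Qed.

(** The value at z is read off the expansion at the real point Re z. The expansions at all real
    points have the same radius, which gives the strip its width. *)
Lemma pd_strip F c rho M : positive_definite F -> near0 F c -> 0 < rho ->
  abs_le c rho M -> exists2 Fext, extends_to_strip F (rho / 4) Fext &
    forall w, nrm w < rho / 4 -> complex.Re w = 0 -> Fext w = psum c w.
Proof.
move=> pF Fc r0 cM; pose s := rho / 2.
have s0 : 0 < s by rewrite divr_gt0.
have sE : rho / 4 = s / 2 by rewrite /s; field.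
have cM' m : nrm (c (2 * m)%N) * rho ^+ (2 * m) <= M.
  by apply: abs_le_term cM; exact: ltW.
pose a t k := tc U k F t.
have aM t : abs_le (a t) s (4 * M) by have [] := pd_taylor oU t pF Fc r0 cM'.
have aE t u : `|u| < s -> F (t + u) = psum (a t) u%:C.
  by have [_] := pd_taylor oU t pF Fc r0 cM'; apply.
have an t : near0 (fun u => F (t + u)) (a t).
  by exists s, (4 * M); split => // u; exact: aE.
pose Fext (z : C) := psum (a (complex.Re z)) (0 +i* complex.Im z).
(* Recentering the expansion at [x0] to Re z reproduces the one at Re z, as both represent [F] on
   the real line. So [Fext] is a single power series around each point of the strip. *)
have glue x0 z : `|complex.Re z - x0| + `|complex.Im z| < s ->
    Fext z = psum (a x0) (z - x0%:C).
  move=> zx; set v := complex.Re z - x0 in zx.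
  have vs : nrm v%:C < s by rewrite nrm_real; have := normr_ge0 (complex.Im z); lra.
  have s1 : 0 < s - nrm v%:C by rewrite subr_gt0.
  have rM := abs_le_recenter vs (aM x0).
  have E : recenter (a x0) v%:C =1 a (complex.Re z).
    apply: (@near0_inj _ _ _ _ _ _ (near0_psum s1 rM) (an (complex.Re z)) s1) => u us.
    have us' : nrm u%:C < s - nrm v%:C by rewrite [X in X < _]nrm_real.
    rewrite (psum_recenter vs (aM x0) us').
    have -> : v%:C + u%:C = (v + u)%:C :> C.
      by apply/eqP; rewrite eq_complex/= addr0 !eqxx.
    rewrite -aE.
      by congr F; rewrite /v; ring.
    rewrite (le_lt_trans (ler_normD _ _))//; move: us; rewrite nrm_real; lra.
  have E' : a (complex.Re z) = recenter (a x0) v%:C by apply/funext => k; rewrite E.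
  have nI : nrm (0 +i* complex.Im z) = `|complex.Im z|.
    apply/le_anti/andP; split; last exact: (Im_le_nrm (0 +i* complex.Im z)).
    by rewrite (le_trans (nrm_le_ReIm _))//= normr0 add0r.
  rewrite /Fext E' (psum_recenter vs (aM x0)); last first.
    by rewrite nI nrm_real; lra.
  congr psum; apply/eqP; rewrite eq_complex/= /v.
  by case: (z) => p q /=; rewrite addr0 add0r subr0 !eqxx.
exists Fext; last first.
  move=> w wr Re0; have := glue 0 w; rewrite Re0 subr0 normr0 add0r.
  have -> : a 0 = c.
    apply/funext => k; apply/esym; apply: (near0_inj Fc (an 0) s0) => t _.
    by rewrite add0r.
  rewrite subr0; apply; have := Im_le_nrm w; move: wr; rewrite sE; lra.
split; last first.
  move=> t; rewrite /Fext /= -[0 +i* 0]/(0 : C) psum0.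
  by rewrite -(near0_val (an t)) addr0.
rewrite sE => z zs; have {}zs : `|complex.Im z| < s / 2 by exact: zs.
set x0 := complex.Re z.
have nz : nrm (z - x0%:C) <= `|complex.Im z|.
  apply: le_trans (nrm_le_ReIm _) _; rewrite /x0; case: (z) => p q /=.
  by rewrite subrr subr0 normr0 add0r.
have zs' : nrm (z - x0%:C) < s by lra.
have /derivable_nrmP[l Hl] := derivable_psum zs' (aM x0).
apply/derivable_nrmP; exists l => e e0; have [del del0 H] := Hl _ e0.
exists (Num.min del (s / 4)); first by rewrite lt_min del0 divr_gt0.
move=> h; rewrite lt_min => /andP[/H hd hs].
rewrite (glue x0 z); last by rewrite subrr normr0 add0r; lra.
rewrite (glue x0 (z + h)); last first.
  have := Re_le_nrm h; have := Im_le_nrm h.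
  have := ler_normD (complex.Im z) (complex.Im h); rewrite /x0.
  move: zs; case: (z) => p q; case: (h) hs => p' q' /= hs.
  by rewrite [p + p']addrC addrK; lra.
by rewrite (_ : z + h - x0%:C = z - x0%:C + h); last ring.
Qed.

Lemma classD_closed (F_ : nat -> R -> C) F : (forall n, classD R (F_ n)) ->
  locally_uniform_cvg F_ F -> classD R F.
Proof.
move=> HF H.
have PF : Pplus R F by apply: Pplus_lim H => n; have [] := HF n.
have [cF pF F0] := PF.
have /choice[G HG] n : exists G, exists c beta,
  [/\ Pplus R G, near0 (F_ n) c, near0 G (fun k => beta k * 'i%C ^+ k), c 0%N = 1 &
    conv c beta =1 (fun n => (n == 0)%:R) /\ forall k, 0 <= beta k].
  exact: classD_data (HF n).
have /choice[c Hc] n : exists c, exists beta,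
  [/\ Pplus R (G n), near0 (F_ n) c, near0 (G n) (fun k => beta k * 'i%C ^+ k),
    c 0%N = 1 &
    conv c beta =1 (fun n => (n == 0)%:R) /\ forall k, 0 <= beta k].
  exact: HG.
have /choice[beta Hb] n : exists beta,
  [/\ Pplus R (G n), near0 (F_ n) (c n), near0 (G n) (fun k => beta k * 'i%C ^+ k),
    c n 0%N = 1 &
    conv (c n) beta =1 (fun n => (n == 0)%:R) /\ forall k, 0 <= beta k].
  exact: Hc.
have [d d0 Hd] : exists2 d : R, 0 < d & forall t, `|t| <= d -> nrm (F t - 1) <= 4^-1.
  have q0 : 0 < 4^-1 :> R by rewrite invr_gt0.
  move/(@cvgcP R R (nbhs 0) (nbhs_filter 0)) : (cF 0) => /(_ _ q0).
  move=> /nbhs_ballP[del /= del0 K]; exists (del / 2); first by rewrite divr_gt0.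
  by move=> t td; rewrite -F0; apply: K; rewrite /ball/= sub0r normrN; lra.
(* The radius d / (2 * 2) given by [abs_le_inv] for series bounded by 2 at radius [d]. *)
pose s := d / 4; have s0 : 0 < s by rewrite divr_gt0.
have bM : \forall n \near \oo, abs_le (beta n) d 2.
  have q0 : 0 < 4^-1 :> R by rewrite invr_gt0.
  apply: filterS (locally_uniform_near 0 d H q0) => n Hn.
  have [_ Fc _ c0 [cb b0]] := Hb n; have [[_ pFn _] _] := HF n.
  apply: (pringsheim d0 Fc c0 cb b0).
    by move=> t; exact: near0_local pFn Fc.
  move=> t t0 td; have := Hn t t0 td; have := Hd t; rewrite ger0_norm// => /(_ td).
  have := nrmD (- (F_ n t - F t) - (F t - 1)) (F_ n t).
  have := nrmD (- (F_ n t - F t)) (- (F t - 1)); rewrite !nrmN.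
  rewrite (_ : - (F_ n t - F t) - (F t - 1) + F_ n t = 1); last by ring.
  by rewrite nrm1; lra.
have b1 n : beta n 0%N = 1.
  have [_ _ _ c0 [cb _]] := Hb n.
  by have := cb 0%N; rewrite /conv big_nat1 c0 mul1r.
have cM : \forall n \near \oo, abs_le (c n) s 2.
  apply: filterS bM => n bn; have [_ _ _ _ [cb _]] := Hb n.
  have bc : conv (beta n) (c n) =1 (fun n => (n == 0)%:R) by move=> k; rewrite convC.
  have := abs_le_inv d0 bn (b1 n) bc.
  by rewrite (_ : d / (2 * 2) = s)// /s; field.
pose c0 k := ulim U (fun n => c n k).
have cc k : (fun n => c n k) @ U --> c0 k.
  apply: (ulim_cvg (K := 2 / s ^+ k)); apply: oU; apply: filterS cM => n.
  exact: abs_le_coef.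
have c0M : abs_le c0 s 2 by apply: (abs_le_lim (ltW s0) (oU cM)).
have cvU (x : nat -> C) l : x @ \oo --> l -> x @ U --> l.
  by move=> xl A /xl; exact: oU.
have s20 : 0 < s / 2 by rewrite divr_gt0.
have Fc0 : near0 F c0.
  exists (s / 2), 2; split => //; first by apply: abs_leW c0M; lra.
  move=> t ts.
  have L1 : (fun n => psum (c n) t%:C) @ U --> psum c0 t%:C.
    by apply: (psum_lim s0 (oU cM) cc); rewrite nrm_real; lra.
  have L2 : (fun n => F_ n t) @ U --> F t by apply: cvU; exact: locally_uniform_pointwise.
  apply: (cvgc_unique L2); apply/cvgcP => e e0; move/cvgcP : L1 => /(_ _ e0).
  apply: filterS2 (oU cM) => n cn; have [_ Fc _ _ _] := Hb n.
  by have [[_ pFn _] _] := HF n; rewrite (near0_uniform pFn Fc s0 cn ts).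
have [Fext Fs Fw] := pd_strip pF Fc0 s0 c0M.
pose e n k := beta n k * 'i%C ^+ k; pose e0 k := ulim U (fun n => e n k).
have eM : \forall n \near \oo, abs_le (e n) d 2.
  by apply: filterS bM => n; exact: abs_le_twist (ltW d0).
have ee k : (fun n => e n k) @ U --> e0 k.
  apply: (ulim_cvg (K := 2 / d ^+ k)); apply: oU; apply: filterS eM => n.
  exact: abs_le_coef.
have e0M : abs_le e0 d 2 by apply: (abs_le_lim (ltW d0) (oU eM)).
(* The limit exists at every [t] since |G_n| <= 1. Its continuity comes from positive-definiteness
   and the expansion at 0. *)
pose G0 t := ulim U (fun n => G n t).
have GG t : (fun n => G n t) @ U --> G0 t.
  apply: (ulim_cvg (K := 1)); apply: nearW => n.
  by have [[_ pG G1] _ _ _ _] := Hb n; have := pd_le0 t pG; rewrite G1.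
have Ge t : `|t| < d / 2 -> \forall n \near \oo, G n t = psum (e n) t%:C.
  move=> td; apply: filterS eM => n en; have [[_ pG _] _ Gn _ _] := Hb n.
  exact: near0_uniform pG Gn d0 en t td.
have d20 : 0 < d / 2 by rewrite divr_gt0.
have G0e : near0 G0 e0.
  exists (d / 2), 2; split => //; first by apply: abs_leW e0M; lra.
  move=> t td; apply: (cvgc_unique (GG t)).
  have L1 : (fun n => psum (e n) t%:C) @ U --> psum e0 t%:C.
    by apply: (psum_lim d0 (oU eM) ee); rewrite nrm_real; lra.
  apply/cvgcP => eps eps0; move/cvgcP : L1 => /(_ _ eps0).
  by apply: filterS2 (oU (Ge t td)) => n ->.
have pG0 : positive_definite G0.
  apply: (@pd_lim _ _ U _ G) => [n|t]; last exact: GG.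
  by have [[]] := Hb n.
split; [exact: PF|exists G0].
  split; [exact: pd_cont pG0 (near0_cont G0e)|exact: pG0|].
  rewrite (near0_val G0e); apply: (cvgc_unique (ee 0%N)).
  have -> : (fun n => e n 0%N) = fun=> 1.
    by apply/funext => n; rewrite /e b1 expr0 mulr1.
  exact: cvgc_cst.
exists (s / 4), Fext; split; [by rewrite divr_gt0|exact: Fs|].
apply/nbhs_ballP; exists (s / 4) => /=; first by rewrite divr_gt0.
move=> t; rewrite /ball/= sub0r normrN => ts.
have nit : nrm (t *i) = `|t|.
  by rewrite imagE nrmM nrm_real -(expr1 'i%C) nrm_iX mul1r.
rewrite Fw//; last by rewrite nit.
have ds : d = 4 * s by rewrite /s; field.
have td : `|t| < d / 2 by lra.
have L1 : (fun n => psum (c n) (t *i)) @ U --> psum c0 (t *i).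
  by apply: (psum_lim s0 (oU cM) cc); rewrite nit; lra.
have L2 : (fun n => psum (c n) (t *i) * G n t) @ U --> psum c0 (t *i) * G0 t.
  exact: cvgcM L1 (GG t).
apply: (cvgc_unique L2); apply/cvgcP => eps eps0.
apply: filterS3 (oU cM) (oU eM) (oU (Ge t td)) => n cn en ->.
have [_ _ _ _ [cb _]] := Hb n.
have -> : psum (c n) (t *i) = psum (fun k => c n k * 'i%C ^+ k) t%:C.
  by rewrite imagE; apply/esym; exact: psum_scale.
rewrite (psum_inv (conv_twist 'i%C cb) s0 d0 (abs_le_twist (ltW s0) cn) en).
- by rewrite subrr nrm0 ltW.
- by rewrite nrm_real; lra.
- by rewrite nrm_real; lra.
Qed.

End ClassD.

(** * The class D_L *)

Section LaguerrePolya.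
Context {R : realType}.
Local Notation C := R[i].
Implicit Types (z w : C) (rho M : R).

Lemma compact_square (N : R) :
  compact [set z : C | `|complex.Re z| <= N /\ `|complex.Im z| <= N].
Proof.
have -> : [set z : C | `|complex.Re z| <= N /\ `|complex.Im z| <= N] =
    (fun xy : R * R => xy.1 +i* xy.2) @` (`[- N, N] `*` `[- N, N]).
  apply/seteqP; split => [z /= [z1 z2]|_ [[x y] /= [x1 y1] <-] /=].
    exists (complex.Re z, complex.Im z); last by case: (z).
    by rewrite /= !in_itv/= -!ler_norml.
  by move: x1 y1; rewrite !in_itv/= -!ler_norml.
apply: continuous_compact; last first.
  by apply: compact_setX; exact: segment_compact.
apply: continuous_subspaceT => xy.
by apply: cvgc_ReIm; [exact: cvg_fst|exact: cvg_snd].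
Qed.

Lemma compact_nrm_bounded (K : set C) : compact K ->
  exists N : R, forall z, K z -> nrm z <= N.
Proof.
move=> cK.
have cn : compact ((fun z : C => nrm z) @` K).
  apply: continuous_compact => //; apply: continuous_subspaceT => z.
  exact: (@nrm_cvg R C (nbhs z) (nbhs_filter z) id z (@cvg_id _ (nbhs z))).
have [N [_ HN]] := compact_bounded cn.
exists (N + 1) => z Kz.
have HN1 : N < N + 1 by rewrite ltrDl.
have := HN _ HN1 (nrm z); rewrite /= ger0_norm ?nrm_ge0//.
by apply; exists z.
Qed.

Lemma family_near (f : nat -> C -> C) (phi : C -> C) (N e : R) : 0 < e ->
  {family compact, f n @[n --> \oo] --> phi} ->
  \forall n \near \oo, forall z, nrm z <= N -> nrm (f n z - phi z) <= e.
Proof.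
move=> e0 /fam_cvgP H.
pose A := [set z : C | `|complex.Re z| <= N /\ `|complex.Im z| <= N].
have HA := H A (@compact_square N).
have NB : nbhs (phi : {uniform` A -> C})
    [set g | forall z, nrm z <= N -> nrm (g z - phi z) <= e].
  apply/uniform_nbhs; exists [set xy | ball xy.1 e%:C xy.2]; split.
    have e0' : 0 < e%:C by rewrite ltcR.
    exact: (@entourage_ball _ C (PosNum e0')).
  move=> g /= Hg z zN; have := Hg z; rewrite /ball/= normr_nrm ltcR nrmBC => HH.
  apply/ltW/HH; split; first exact: le_trans (Re_le_nrm z) zN.
  exact: le_trans (Im_le_nrm z) zN.
exact: (HA _ NB).
Qed.

Lemma near_family (f : nat -> C -> C) (phi : C -> C) :
  (forall N e : R, 0 < e ->
    \forall n \near \oo, forall z, nrm z <= N -> nrm (f n z - phi z) <= e) ->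
  {family compact, f n @[n --> \oo] --> phi}.
Proof.
move=> H; apply/fam_cvgP => A cA; have [N HN] := compact_nrm_bounded cA.
move=> P /uniform_nbhs[E [entE EP]].
move: entE; rewrite -(@entourage_from_ballE R[i] C) => -[e /= e0 He].
move: e0; rewrite ltcE/= => /andP[/eqP Ime e0].
have e20 : 0 < complex.Re e / 2 by rewrite divr_gt0.
have := H N _ e20; apply: filterS => n Hn; apply: EP => z Az.
apply: He => /=; rewrite /ball/= normr_nrm ltcE/= Ime eqxx/= nrmBC.
by apply: le_lt_trans (Hn z (HN z Az)) _; lra.
Qed.

(** Cauchy's estimate without integration: averaging over z and -z leaves the even part, a
    polynomial in z^2 of half the size with the same constant coefficient and the same bound. *)
Lemma poly_circle_coef0 n (P : {poly C}) rho M : 0 < rho ->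
  (size P <= 2 ^ n)%N -> (forall z, nrm z = rho -> nrm P.[z] <= M) ->
  nrm P`_0 <= M.
Proof.
elim: n P rho => [|n IH] P rho r0 sP PM.
  have := PM rho%:C; rewrite nrm_real gtr0_norm// => /(_ erefl).
  by rewrite (size1_polyC sP) hornerC coefC eqxx.
have -> : P`_0 = (even_poly P)`_0 by rewrite coef_even_poly.
apply: (IH _ (rho ^+ 2)); first by rewrite exprn_gt0.
  by apply: leq_trans (size_even_poly _) _; move: sP; rewrite expnS; lia.
move=> w wr; have [z zw] : exists z : C, z ^+ 2 = w by exists (sqrtc w); exact: sqr_sqrtc.
have zr : nrm z = rho.
  by apply/eqP; rewrite -(@eqrXn2 _ 2) ?nrm_ge0// ?(ltW r0)// -nrmX zw wr.
have h1 : P.[z] = (even_poly P).[w] + (odd_poly P).[w] * z.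
  by rewrite -{1}(poly_even_odd P) hornerD hornerM !horner_comp hornerXn hornerX zw.
have h2 : P.[- z] = (even_poly P).[w] - (odd_poly P).[w] * z.
  rewrite -{1}(poly_even_odd P) hornerD hornerM !horner_comp hornerXn hornerX.
  by rewrite sqrrN zw mulrN.
have -> : (even_poly P).[w] = 2^-1 * (P.[z] + P.[- z]) by rewrite h1 h2; field.
have nz : nrm (- z) = rho by rewrite nrmN.
rewrite nrmM nrmV nrm_nat mulrC ler_pdivrMr//.
by apply: le_trans (nrmD _ _) _; have := PM _ zr; have := PM _ nz; lra.
Qed.

(** Removing the constant coefficient and dividing by z changes the bound [M] into 2M / rho; [k]
    such steps cost the factor 2^k. *)
Lemma poly_circle_coef k (P : {poly C}) rho M : 0 < rho ->
  (forall z, nrm z = rho -> nrm P.[z] <= M) ->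
  nrm P`_k * rho ^+ k <= 2 ^+ k * M.
Proof.
elim: k P M => [|k IH] P M r0 PM.
  rewrite !expr0 mulr1 mul1r; apply: (@poly_circle_coef0 (size P) _ rho) => //.
  by apply: ltnW; exact: ltn_expl.
have P0 : nrm P`_0 <= M.
  apply: (@poly_circle_coef0 (size P) _ rho) => //.
  by apply: ltnW; exact: ltn_expl.
pose Q := drop_poly 1 P.
have PQ z : P.[z] = P`_0 + Q.[z] * z.
  rewrite -{1}(poly_take_drop 1 P) hornerD hornerM hornerXn expr1 -/Q; congr (_ + _).
  have -> : take_poly 1 P = (P`_0)%:P; last by rewrite hornerC.
  by apply/polyP => i; rewrite coef_take_poly coefC ltnS leqn0; case: eqP => [->|].
have -> : P`_k.+1 = Q`_k by rewrite coef_drop_poly addn1.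
have := IH Q (2 * M / rho) r0; rewrite exprS => H.
have : nrm Q`_k * rho ^+ k <= 2 ^+ k * (2 * M / rho).
  apply: H => z zr; rewrite ler_pdivlMr// -zr -nrmM.
  have -> : Q.[z] * z = P.[z] - P`_0 by rewrite PQ addrAC subrr add0r.
  by apply: le_trans (nrmD _ _) _; rewrite nrmN; have := PM z zr; lra.
rewrite mulrA ler_pdivlMr// => H2.
by rewrite mulrCA mulrC [2 ^+ _]exprS -mulrA mulrCA.
Qed.

(** A form of Bernoulli's inequality, multiplied through by [y]; it is applied with squares in place
    of [y] and [d]. *)
Lemma factor_growth (y d : R) N : 0 < d -> d < y ->
  y + N%:R * d <= y * (y / (y - d)) ^+ N.
Proof.
move=> d0 dy; have yd : 0 < y - d by rewrite subr_gt0.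
elim: N => [|N IH]; first by rewrite mul0r addr0 mulr1.
rewrite exprSr mulrA; apply: (@le_trans _ _ ((y + N%:R * d) * (y / (y - d)))); last first.
  by rewrite ler_wpM2r// divr_ge0 ?ltW// (lt_trans d0).
rewrite mulrA ler_pdivlMr// -natr1.
have N0 : 0 <= N%:R :> R by [].
have : 0 <= (N%:R + 1) * d ^+ 2 by rewrite mulr_ge0 ?exprn_ge0 ?addr_ge0// ltW.
have -> : (y + (N%:R + 1) * d) * (y - d) =
  (y + N%:R * d) * y - (N%:R + 1) * d ^+ 2 by ring.
by lra.
Qed.

(** With leading coefficient l and roots x, |p(z) p(-z)| is at most |l|^2 prod (x^2 + |z|^2), and
    [factor_growth] bounds this by |p(0)|^2 (Y / Z)^N. The quotient Y / Z is |p(0)|^2 / |p(d)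
    p(-d)|, a matter of values on [-d, d] only. *)
Lemma real_rooted_growth (p : {poly R}) (d : R) N z : 0 < d ->
  only_real_zeros p ->
  (forall t : R, `|t| <= d -> nrm (complex_horner p t%:C - 1) <= 2^-1) ->
  nrm z ^+ 2 <= N%:R * d ^+ 2 ->
  nrm (complex_horner p z * complex_horner p (- z)) <= (9 / 4) * 9 ^+ N.
Proof.
move=> d0 rp pd zN; pose P := map_poly (real_complex R) p.
have [r Pr] := closed_field_poly_normal P.
set l := lead_coef P in Pr.
have near1 t : `|t| <= d -> 2^-1 <= nrm P.[t%:C] <= 3 / 2.
  move=> /pd; rewrite /complex_horner -/P => H.
  have := nrmD (P.[t%:C] - 1) 1; have := nrmD (1 - P.[t%:C]) P.[t%:C].
  by rewrite !subrK nrmBC nrm1 => *; apply/andP; split; lra.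
have hP w : P.[w] = l * \prod_(x <- r) (w - x).
  rewrite Pr hornerZ horner_prod; congr (_ * _).
  by apply: eq_bigr => x _; rewrite hornerXsubC.
(* |p| >= 1/2 on [-d, d], so no root lies there. *)
have rreal x : x \in r -> x = (complex.Re x)%:C /\ d ^+ 2 < complex.Re x ^+ 2.
  move=> xr; have Px : P.[x] = 0.
    by rewrite hP (big_rem x)//= subrr mul0r mulr0.
  have xE : x = (complex.Re x)%:C by have := rp x Px; case: (x) => a b /= ->.
  split => //; rewrite -[ltRHS]real_normK ?num_real// ltrXn2r ?nnegrE ?(ltW d0)//.
  rewrite ltNge; apply/negP => /near1; rewrite -xE Px nrm0 => /andP[].
  by rewrite invr_le0 lern0.
have PP w : P.[w] * P.[- w] = l ^+ 2 * \prod_(x <- r) (x ^+ 2 - w ^+ 2).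
  rewrite !hP mulrACA -expr2; congr (_ * _); rewrite -big_split/=.
  by apply: eq_bigr => x _; ring.
pose Y := \prod_(x <- r) (complex.Re x ^+ 2).
pose Z := \prod_(x <- r) (complex.Re x ^+ 2 - d ^+ 2).
have nprod (F : C -> C) : nrm (\prod_(x <- r) F x) = \prod_(x <- r) nrm (F x).
  by apply: (big_morph _ nrmM nrm1).
have L0 : 0 <= nrm l ^+ 2 by rewrite exprn_ge0// nrm_ge0.
have EY : nrm (P.[0] * P.[0]) = nrm l ^+ 2 * Y.
  have := PP 0; rewrite oppr0 => ->; rewrite nrmM nrmX nprod; congr (_ * _).
  rewrite big_seq [RHS]big_seq; apply: eq_bigr => x /rreal[xE _].
  by rewrite expr0n subr0 {1}xE nrmX nrm_real real_normK ?num_real.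
have EZ : nrm (P.[d%:C] * P.[- d%:C]) = nrm l ^+ 2 * Z.
  rewrite PP nrmM nrmX nprod; congr (_ * _).
  rewrite big_seq [RHS]big_seq; apply: eq_bigr => x /rreal[xE xd].
  rewrite {1}xE -!rmorphXn -rmorphB nrm_real ger0_norm//.
  by rewrite subr_ge0 ltW.
have [H0a H0b] : 2^-1 <= nrm P.[0] /\ nrm P.[0] <= 3 / 2.
  by apply/andP; apply: (near1 0); rewrite normr0 ltW.
have [Hda _] : 2^-1 <= nrm P.[d%:C] /\ nrm P.[d%:C] <= 3 / 2.
  by apply/andP; apply: near1; rewrite gtr0_norm.
have [Hea _] : 2^-1 <= nrm P.[- d%:C] /\ nrm P.[- d%:C] <= 3 / 2.
  by apply/andP; have := near1 (- d); rewrite normrN gtr0_norm// rmorphN; apply.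
have Z0 : 0 < Z.
  by rewrite /Z big_seq; apply: prodr_gt0 => x /rreal[_]; rewrite subr_gt0.
have Y0 : 0 < Y.
  rewrite /Y big_seq; apply: prodr_gt0 => x /rreal[_]; apply: lt_trans.
  by rewrite exprn_gt0.
(* |p(0)|^2 <= 9/4 and |p(d) p(-d)| >= 1/4. *)
have YZ : Y / Z <= 9.
  rewrite ler_pdivrMr//.
  have L1 : 0 < nrm l ^+ 2.
    rewrite lt_neqAle L0 andbT eq_sym; apply/eqP => l0; move: EZ.
    by rewrite l0 mul0r nrmM; nra.
  rewrite -(ler_pM2l L1) mulrCA -EY -EZ !nrmM; nra.
have prod_bound : nrm (P.[z] * P.[- z]) <= nrm l ^+ 2 * (Y * (Y / Z) ^+ N).
  rewrite PP nrmM nrmX ler_wpM2l// nprod.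
  have -> : Y * (Y / Z) ^+ N = \prod_(x <- r) (complex.Re x ^+ 2 *
      (complex.Re x ^+ 2 / (complex.Re x ^+ 2 - d ^+ 2)) ^+ N).
    rewrite [RHS]big_split/=; congr (_ * _); rewrite prodrXl; congr (_ ^+ _).
    by rewrite [RHS]big_split/= prodfV.
  rewrite big_seq [leRHS]big_seq; apply: ler_prod => x /rreal[xE xd].
  rewrite nrm_ge0/=; apply: le_trans (factor_growth N (exprn_gt0 2 d0) xd).
  apply: le_trans (nrmD _ _) _; rewrite nrmN {1}xE !nrmX nrm_real.
  by rewrite real_normK ?num_real// lerD2l.
rewrite /complex_horner -/P; apply: le_trans prod_bound _.
have x0 := nrm_ge0 P.[0].
have q1 : nrm P.[0] * nrm P.[0] <= 9 / 4.
  by apply: le_trans (ler_pM x0 x0 H0b H0b) _; lra.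
have q2 : 0 <= Y / Z by rewrite divr_ge0 ?(ltW Y0) ?(ltW Z0).
have q3 : (Y / Z) ^+ N <= 9 ^+ N by rewrite lerXn2r ?nnegrE.
rewrite mulrA -EY nrmM; apply: ler_pM => //; [exact: mulr_ge0|exact: exprn_ge0].
Qed.

End LaguerrePolya.

Section ClassDL.
Context {R : realType} (U : set_system nat) {UU : UltraFilter U}.
Context (oU : \oo `<=` U).
Local Notation C := R[i].
Local Notation h := (@step R).

(** Evenness makes phi(z) phi(-z) equal to phi(z)^2. The two errors of 1/4 add up to the 1/2
    required of the polynomials. *)
Lemma LPe_growth (phi : C -> C) (p : nat -> {poly R}) (d : R) N z : 0 < d ->
  (forall z, phi (- z) = phi z) -> (forall n, only_real_zeros (p n)) ->
  {family compact, complex_horner (p n) @[n --> \oo] --> phi} ->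
  (forall t : R, `|t| <= d -> nrm (phi t%:C - 1) <= 4^-1) ->
  nrm z ^+ 2 <= N%:R * d ^+ 2 -> nrm (phi z) ^+ 2 <= (9 / 4) * 9 ^+ N.
Proof.
move=> d0 even rp pphi phid zN.
have pw w : (fun n => complex_horner (p n) w) @ \oo --> phi w.
  apply/cvgcP => e e0.
  by apply: filterS (family_near (nrm w) e0 pphi) => n; apply; exact: lexx.
have L : (fun n => nrm (complex_horner (p n) z * complex_horner (p n) (- z))) @ \oo
    --> nrm (phi z * phi (- z)).
  exact: nrm_cvg (cvgcM (pw z) (pw (- z))).
rewrite even nrmM -expr2 in L; apply: (cvg_le_ub L).
have q0 : 0 < 4^-1 :> R by rewrite invr_gt0.
apply: filterS (family_near d q0 pphi) => n Hn.
apply: (real_rooted_growth d0 (rp n) _ zN) => t td.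
have nt : nrm t%:C <= d by rewrite nrm_real.
have := Hn _ nt; have := phid _ td.
have := nrmD (complex_horner (p n) t%:C - phi t%:C) (phi t%:C - 1).
by rewrite addrA subrK; lra.
Qed.

Lemma classDL_closed (F_ : nat -> R -> C) F : (forall n, classDL R (F_ n)) ->
  locally_uniform_cvg F_ F -> classDL R F.
Proof.
move=> HF H.
have PF : Pplus R F by apply: Pplus_lim H => n; have [] := HF n.
have [cF _ F0] := PF.
have /choice[phi_ Hphi] n : exists phi : C -> C, LPe R phi /\ forall t, phi t%:C = F_ n t.
  by have [_ [phi]] := HF n; exists phi.
have /choice[p Hp] n : exists p : nat -> {poly R}, (forall m, only_real_zeros (p m)) /\
    {family compact, complex_horner (p m) @[m --> \oo] --> phi_ n}.
  by have [[[_ _ [p]]]] := Hphi n; exists p.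
have even n z : phi_ n (- z) = phi_ n z by have [[_ + _] _] := Hphi n; apply.
have phi1 n : phi_ n 0 = 1 by have [[_ _ +] _] := Hphi n.
have phiF n t : phi_ n t%:C = F_ n t by have [_ +] := Hphi n; apply.
have [d d0 Hd] : exists2 d : R, 0 < d & forall t, `|t| <= d -> nrm (F t - 1) <= 8^-1.
  have q0 : 0 < 8^-1 :> R by rewrite invr_gt0.
  move/(@cvgcP R R (nbhs 0) (nbhs_filter 0)) : (cF 0) => /(_ _ q0).
  move=> /nbhs_ballP[del /= del0 K]; exists (del / 2); first by rewrite divr_gt0.
  by move=> t td; rewrite -F0; apply: K; rewrite /ball/= sub0r normrN; lra.
have near1 : \forall n \near \oo, forall t : R, `|t| <= d ->
    nrm (phi_ n t%:C - 1) <= 4^-1.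
  have q0 : 0 < 8^-1 :> R by rewrite invr_gt0.
  apply: filterS (locally_uniform_near (- d) d H q0) => n Hn t td.
  have := Hd _ td; move: td; rewrite ler_norml => /andP[t1 t2].
  have := Hn t t1 t2; rewrite phiF.
  by have := nrmD (F_ n t - F t) (F t - 1); rewrite addrA subrK; lra.
(* A first diagonal choice: one polynomial for each [n], close to [phi_ n] on a disc growing with
   [n], so that both sequences have the same limits. *)
have /choice[m Hm] n : exists m, forall z, nrm z <= n.+1%:R ->
    nrm (complex_horner (p n m) z - phi_ n z) <= h n.
  have [_ pn] := Hp n.
  have [m _ /(_ m (leqnn m)) Hm] := family_near n.+1%:R (step_gt0 n) pn.
  by exists m.
pose r n := p n (m n).
pose c n k : C := (map_poly (real_complex R) (r n))`_k.
have rE n w : psum (c n) w = complex_horner (r n) w by exact: psum_poly.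
have archi (x : R) : exists N : nat, x <= N%:R.
  exists (Num.bound `|x|); apply: le_trans (ler_norm x) (ltW _).
  by apply: archi_boundP.
have near_ge (x : R) : \forall n \near \oo, x <= n.+1%:R.
  have [N HN] := archi x; exists N => // n /= Nn.
  by apply: le_trans HN _; rewrite ler_nat leqW.
(* Radius 4 sigma: one factor 2 is lost in [poly_circle_coef], another in [geo_abs_le]. In B + 2,
   the summand B + 1 bounds the square root of B and 1 the approximation error. *)
have cM (sigma : R) : 0 < sigma -> exists K, \forall n \near \oo, abs_le (c n) sigma K.
  move=> s0; pose rho := 4 * sigma; have rho0 : 0 < rho by rewrite mulr_gt0.
  have [N] := archi (rho ^+ 2 / d ^+ 2); rewrite ler_pdivrMr ?exprn_gt0// => HN.
  pose B : R := 9 / 4 * 9 ^+ N; exists (2 * (B + 2)).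
  have B0 : 0 <= B by rewrite mulr_ge0 ?divr_ge0 ?exprn_ge0.
  apply: filterS2 near1 (near_ge rho) => n n1 nr.
  have [rp pn] := Hp n.
  have bound z : nrm z = rho -> nrm (map_poly (real_complex R) (r n)).[z] <= B + 2.
    move=> zr; have zN : nrm z ^+ 2 <= N%:R * d ^+ 2 by rewrite zr.
    have g1 := LPe_growth d0 (even n) rp pn n1 zN.
    have zn : nrm z <= n.+1%:R by rewrite zr.
    have g2 := Hm n z zn; rewrite -/(r n) in g2.
    have h1 : h n <= 1 by rewrite /h invf_le1// ler1n.
    have := nrmD (complex_horner (r n) z - phi_ n z) (phi_ n z); rewrite subrK.
    move/le_trans; apply; have g3 : nrm (phi_ n z) <= B + 1.
      rewrite -(@ler_pXn2r _ 2) ?nnegrE ?nrm_ge0 ?addr_ge0//.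
      by apply: le_trans g1 _; rewrite -/B; nra.
    by lra.
  have geo k : nrm (c n k) * (2 * sigma) ^+ k <= B + 2.
    have := poly_circle_coef k rho0 bound.
    rewrite (_ : rho = 2 * (2 * sigma)); last by rewrite /rho; ring.
    by rewrite [(2 * (2 * sigma)) ^+ k]exprMn mulrCA ler_pM2l// exprn_gt0.
  have s20 : 0 < 2 * sigma by rewrite mulr_gt0.
  by have := geo_abs_le s20 geo; rewrite [2 * sigma]mulrC mulfK.
pose c0 k := ulim U (fun n => c n k).
have cc k : (fun n => c n k) @ U --> c0 k.
  have [K HK] := cM 1 ltr01; apply: (ulim_cvg (K := K / 1 ^+ k)); apply: oU.
  by apply: filterS HK => n; exact: abs_le_coef.
have c0M (sigma : R) : 0 < sigma -> exists K, abs_le c0 sigma K.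
  move=> s0; have [K HK] := cM _ s0; exists K.
  exact: (abs_le_lim (ltW s0) (oU HK) cc).
pose phi := psum c0.
have rphi w : (fun n => complex_horner (r n) w) @ U --> phi w.
  have s0 : 0 < nrm w + 1 by rewrite ltr_wpDl// nrm_ge0.
  have [K HK] := cM _ s0.
  have -> : (fun n => complex_horner (r n) w) = fun n => psum (c n) w.
    by apply/funext => n; rewrite rE.
  by apply: (psum_lim s0 (oU HK) cc); rewrite ltrDl.
have phin w : (fun n => phi_ n w) @ U --> phi w.
  apply/cvgcP => e e0; have e20 : 0 < e / 2 by rewrite divr_gt0.
  move/cvgcP : (rphi w) => /(_ _ e20) L.
  apply: filterS3 L (step_small oU e20) (oU (near_ge (nrm w))) => n h1 h2 h3.
  have := Hm n w h3; rewrite -/(r n) nrmBC.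
  have := nrmD (phi_ n w - complex_horner (r n) w) (complex_horner (r n) w - phi w).
  by rewrite addrA subrK; lra.
have phi01 : phi 0 = 1.
  apply: (cvgc_unique (phin 0)); have -> : (fun n => phi_ n 0) = fun=> 1.
    by apply/funext => n; rewrite phi1.
  exact: cvgc_cst.
split; [exact: PF|exists phi]; last first.
  move=> t; apply: (cvgc_unique (phin t%:C)).
  have -> : (fun n => phi_ n t%:C) = fun n => F_ n t.
    by apply/funext => n; rewrite phiF.
  by move=> A /(locally_uniform_pointwise H) HA; exact: (oU HA).
split; [split| |exact: phi01].
- move=> z _; have s0 : 0 < nrm z + 1 by rewrite ltr_wpDl// nrm_ge0.
  have [K HK] := c0M _ s0.
  by apply: (@derivable_psum _ c0 z _ _ _ HK); rewrite ltrDl.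
- by exists 0; rewrite phi01 oner_neq0.
(* A second choice turns convergence along [U], uniform on discs, into an ordinary sequence of
   polynomials: sets of the filter are nonempty, so each [k] has a suitable index. *)
- have /choice[j Hj] k : exists n, forall w, nrm w <= k%:R ->
      nrm (complex_horner (r n) w - phi w) <= h k.
    have s0 : 0 < k%:R + 1 :> R by rewrite ltr_wpDl.
    have [K HK] := cM _ s0.
    have lk : k%:R < k%:R + 1 :> R by rewrite ltrDl.
    have : U [set n | forall w, nrm w <= k%:R -> nrm (psum (c n) w - psum c0 w) <= h k].
      exact: (psum_lim_uniform s0 (oU HK) cc (ler0n R k) lk (step_gt0 k)).
    by move=> /filter_ex[n Hn]; exists n => w wk; rewrite -rE; exact: Hn.
  exists (fun k => r (j k)); split.
    by move=> k; have [rp _] := Hp (j k); exact: rp.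
  apply: near_family => N e e0.
  have [k0 Hk0] : exists k0 : nat, forall k, (k0 <= k)%N -> h k <= e.
    have [k0 Hk0] := archi e^-1; exists k0 => k k0k.
    rewrite /h -(invrK e) lef_pV2 ?posrE ?invr_gt0//.
    by apply: le_trans Hk0 _; rewrite ler_nat leqW.
  have [n0 Hn0] := archi N.
  exists (k0 + n0)%N => // k /= kk z zN.
  apply: le_trans (Hj k z _) _; last first.
    by apply: Hk0; apply: leq_trans kk; exact: leq_addr.
  apply: le_trans zN (le_trans Hn0 _).
  by rewrite ler_nat; apply: leq_trans kk; exact: leq_addl.
- move=> z; apply: (cvgc_unique (phin (- z))).
  have -> : (fun n => phi_ n (- z)) = fun n => phi_ n z.
    by apply/funext => n; rewrite even.
  exact: phin.
Qed.

End ClassDL.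

Theorem theorem19 (R : realType) :
  (forall (F_ : nat -> R -> complex R) (F : R -> complex R),
     (forall n : nat, classD R (F_ n)) -> locally_uniform_cvg F_ F ->
     classD R F) /\
  (forall (F_ : nat -> R -> complex R) (F : R -> complex R),
     (forall n : nat, classDL R (F_ n)) -> locally_uniform_cvg F_ F ->
     classDL R F).
Proof.
(* Refining the filter at infinity, [U] keeps all ordinary limits of sequences. *)
have [U [UU oU]] := ultraFilterLemma (eventually_filter : ProperFilter \oo).
split=> F_ F; [exact: classD_closed|exact: classDL_closed].
Qed.
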